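(* If $G$ is an affine algebraic supergroup over $\mathbb{C}$, then $G$ is smooth, that is, all its closed points are smooth.
   Context: Superalgebras are unital associative $\mathbb{Z}/2$-graded $\mathbb{C}$-algebras $A=A_0\oplus A_1$, commutative in the sense $xy=(-1)^{p(x)p(y)}yx$ for homogeneous $x,y$; ideals are homogeneous. $\mathbb{C}[[x_1,\dots,x_r,\xi_1,\dots,\xi_s]]=\mathbb{C}[[x]]\otimes\Lambda(\xi)$ with $x_i$ even, $\xi_j$ odd. For a superalgebra $A$, $\underline{\mathrm{Spec}}\,A$ is the space $\mathrm{Spec}\,A_0$ with the sheaf of superalgebras with stalk at $\mathfrak p$ the localization of the $A_0$-module $A$ at $\mathfrak p$. An affine (algebraic) supervariety is $X=\underline{\mathrm{Spec}}\,\mathbb{C}[X]$ where $\mathbb{C}[X]/I^{odd}$ ($I^{odd}$ the ideal generated by the odd elements) is the coordinate ring of an ordinary affine algebraic variety and $\mathbb{C}[X]_1$ is a finitely generated $\mathbb{C}[X]_0$-module. Its functor of points sends a commutative superalgebra $A$ to $\mathrm{Hom}(\mathbb{C}[X],A)$. An affine algebraic supergroup is an affine supervariety $G$ whose functor of points is group valued; equivalently $\mathbb{C}[G]$ is a Hopf superalgebra. Smoothness: for a closed point $P\in|X|$ (a maximal ideal of $\mathbb{C}[X]_0$) let $\mathcal{O}_{X,P}$ be the stalk and $m_P$ its maximal ideal (it contains all odd elements). $P$ is smooth if $\widehat{\mathcal{O}_{X,P}}:=\varprojlim_n\mathcal{O}_{X,P}/m_P^n\cong\mathbb{C}[[x_1,\dots,x_r,\xi_1,\dots,\xi_s]]$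 for some $r,s$. *)

(* Defs.v *)
From HB Require Import structures.
From mathcomp Require Import all_boot all_order all_algebra.
From mathcomp Require Import boolp classical_sets mpoly.

Set Implicit Arguments.
Unset Strict Implicit.
Unset Printing Implicit Defensive.

Import GRing.Theory.
Local Open Scope ring_scope.
Local Open Scope quotient_scope.
Local Open Scope classical_set_scope.

(* A K-algebra is a ring with a ring morphism [salg] from K to its centre;
   [hpart false] and [hpart true] are the even and the odd part.  The image of
   [salg] being even, [super_comm] makes it central, and [hpartM] makes the two
   parts K-subspaces.  The zero algebra is allowed, so [algType], whose rings
   are nonzero, cannot be used here. *)
HB.mixin Record isSuperAlgebra (K : fieldType) A of GRing.PzRing A := {
  salg : {rmorphism K -> A};
  hpart : bool -> set A;
  hpart_salg : forall k, hpart false (salg k);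
  hpart0 : forall b, hpart b 0;
  hpartD : forall b x y, hpart b x -> hpart b y -> hpart b (x + y);
  hpartM : forall b c x y, hpart b x -> hpart c y -> hpart (b (+) c) (x * y);
  hpart_decomp : forall x, exists x0 x1,
    [/\ hpart false x0, hpart true x1 & x = x0 + x1];
  hpart_direct : forall x, hpart false x -> hpart true x -> x = 0;
  super_comm : forall b c x y, hpart b x -> hpart c y ->
    x * y = (-1) ^+ (b && c) * (y * x) }.

#[short(type="superAlgType")]
HB.structure Definition SuperAlgebra (K : fieldType) :=
  { A of isSuperAlgebra K A & GRing.PzRing A }.

Arguments hpart {K s} b.
Arguments salg {K} s.
Arguments hpartD {K s b x y}.
Arguments hpartM {K s b c x y}.
Arguments hpart_direct {K s x}.
Arguments super_comm {K s b c x y}.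
Notation even_part := (hpart false).
Notation odd_part := (hpart true).

Record superHom (K : fieldType) (A B : superAlgType K) := SuperHom {
  superHom_fun :> {rmorphism A -> B};
  superHom_salg : forall k, superHom_fun (salg A k) = salg B k;
  superHom_hpart : forall b x, hpart b x -> hpart b (superHom_fun x) }.

Section Hom.
Variable K : fieldType.

Lemma superHomP (A B : superAlgType K) (f g : superHom A B) :
  f =1 g -> f = g.
Proof.
move: f g => [f fZ fh] [g gZ gh] /= efg.
have {}efg : f = g.
  case: f fZ fh efg => f [[f1] [f2]] _ _.
  case: g gZ gh => g [[g1] [g2]] _ _ /= /funext efg.
  move: f1 f2; rewrite efg => f1 f2.
  by rewrite (Prop_irrelevance f1 g1) (Prop_irrelevance f2 g2).
move: fZ fh; rewrite efg => fZ fh.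
by rewrite (Prop_irrelevance fZ gZ) (Prop_irrelevance fh gh).
Qed.

Definition superHom_comp (A B C : superAlgType K)
  (g : superHom B C) (f : superHom A B) : superHom A C.
Proof.
exists (g \o f : {rmorphism A -> C}).
- by move=> k /=; rewrite !superHom_salg.
- by move=> b x hx /=; do 2!apply: superHom_hpart.
Defined.

Definition superIso (A B : superAlgType K) : Prop :=
  exists f : superHom A B, bijective f.

End Hom.

Section SuperTheory.
Variables (K : fieldType) (A : superAlgType K).
Implicit Types (x y s t : A) (b c : bool).

Lemma hpart1 : even_part (1 : A).
Proof. by rewrite -(rmorph1 (salg A)); apply: hpart_salg. Qed.

Lemma hpartN b x : hpart b x -> hpart b (- x).
Proof.
move=> hx; rewrite -mulN1r -(rmorphN1 (salg A)).
by move=> *; apply: (hpartM (b := false)) => //; apply: hpart_salg.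
Qed.

Lemma hpartB b x y : hpart b x -> hpart b y -> hpart b (x - y).
Proof. by move=> hx hy; apply: hpartD => //; apply: hpartN. Qed.

Lemma evenC s x : even_part s -> s * x = x * s.
Proof.
move=> hs; have [x0 [x1 [h0 h1 ->]]] := hpart_decomp x.
by rewrite mulrDr mulrDl (super_comm hs h0) (super_comm hs h1) !expr0 !mul1r.
Qed.

Lemma evenCA s x y : even_part s -> x * (s * y) = s * (x * y).
Proof. by move=> hs; rewrite mulrA -(evenC x hs) mulrA. Qed.

Lemma evenM s t : even_part s -> even_part t -> even_part (s * t).
Proof. exact: (hpartM (b := false)). Qed.

Lemma hpartMe b s x : even_part s -> hpart b x -> hpart b (s * x).
Proof. exact: (hpartM (b := false)). Qed.

End SuperTheory.

Record sideal (K : fieldType) (A : superAlgType K) := SIdeal {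
  sideal_set :> A -> Prop;
  sideal0 : sideal_set 0;
  sidealD : forall x y, sideal_set x -> sideal_set y -> sideal_set (x + y);
  sidealMl : forall a x, sideal_set x -> sideal_set (a * x);
  sidealMr : forall a x, sideal_set x -> sideal_set (x * a);
  sideal_hpart : forall x0 x1, even_part x0 -> odd_part x1 ->
    sideal_set (x0 + x1) -> sideal_set x0 /\ sideal_set x1 }.

Section IdealGen.
Variables (K : fieldType) (A : superAlgType K).

Definition sideal_gen_set (S : set A) : set A :=
  [set x | forall J : sideal A, S `<=` J -> J x].

Fact sideal_gen0 S : sideal_gen_set S 0.
Proof. by move=> J _; apply: sideal0. Qed.
Fact sideal_genD S x y :
  sideal_gen_set S x -> sideal_gen_set S y -> sideal_gen_set S (x + y).
Proof. by move=> hx hy J SJ; apply: sidealD; [apply: hx|apply: hy]. Qed.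
Fact sideal_genMl S a x : sideal_gen_set S x -> sideal_gen_set S (a * x).
Proof. by move=> hx J SJ; apply: sidealMl; apply: hx. Qed.
Fact sideal_genMr S a x : sideal_gen_set S x -> sideal_gen_set S (x * a).
Proof. by move=> hx J SJ; apply: sidealMr; apply: hx. Qed.
Fact sideal_gen_hpart S x0 x1 : even_part x0 -> odd_part x1 ->
  sideal_gen_set S (x0 + x1) -> sideal_gen_set S x0 /\ sideal_gen_set S x1.
Proof.
by move=> h0 h1 hx; split=> J SJ; have [] := sideal_hpart h0 h1 (hx J SJ).
Qed.

Definition sideal_gen (S : set A) : sideal A :=
  SIdeal (@sideal_gen0 S) (@sideal_genD S) (@sideal_genMl S) (@sideal_genMr S)
    (@sideal_gen_hpart S).

Lemma sub_sideal_gen (S : set A) : S `<=` sideal_gen S.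
Proof. by move=> x Sx J; apply. Qed.

Lemma sideal_gen_sub (S : set A) (J : sideal A) : S `<=` J -> sideal_gen S `<=` J.
Proof. by move=> SJ x; apply. Qed.

Definition odd_ideal : sideal A := sideal_gen odd_part.

Definition sideal_pow (M : set A) (n : nat) : sideal A :=
  sideal_gen [set x | exists f : 'I_n -> A,
    (forall i, M (f i)) /\ x = \prod_(i < n) f i].

Lemma sideal_pow_sub (M : set A) n k :
  (n <= k)%N -> sideal_pow M k `<=` sideal_pow M n.
Proof.
elim: k => [|k IH]; first by rewrite leqn0 => /eqP->.
rewrite leq_eqVlt => /predU1P[->//|/IH{IH} sub]; apply: subset_trans sub.
apply: sideal_gen_sub => x [f [Mf ->]]; rewrite big_ord_recr /=.
apply: sideal_genMr; apply: sub_sideal_gen.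
by exists (fun i => f (widen_ord (leqnSn k) i)); split.
Qed.

End IdealGen.

Section Quotient.
Variables (K : fieldType) (A : superAlgType K) (I : sideal A).
Implicit Types x y : A.

Lemma sidealN x : I x -> I (- x).
Proof. by move=> Ix; rewrite -mulN1r; apply: sidealMl. Qed.

Definition squot_rel x y := `[< I (x - y) >].

Lemma squot_rel_equiv : equiv_class_of squot_rel.
Proof.
split=> [x|x y|y x z].
- by apply/asboolP; rewrite subrr; apply: sideal0.
- by apply: asbool_equiv_eq; split=> /sidealN; rewrite opprB.
- move=> /asboolP xy /asboolP yz; apply/asboolP.
  by rewrite -(subrK y x) -addrA; apply: sidealD.
Qed.

Canonical squot_equiv := EquivRelPack squot_rel_equiv.

Definition squot := {eq_quot squot_rel}.
HB.instance Definition _ := Choice.on squot.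

Definition squot_pi x : squot := \pi_squot x.

Lemma squot_piP x y : squot_pi x = squot_pi y <-> I (x - y).
Proof. by split=> [/eqmodP/asboolP//|h]; apply/eqmodP/asboolP. Qed.

Lemma squot_pi_eq x y : I (x - y) -> squot_pi x = squot_pi y.
Proof. by move/squot_piP. Qed.

Lemma squot_reprK (u : squot) : squot_pi (repr u) = u.
Proof. exact: reprK. Qed.

Lemma squot_repr x : I (repr (squot_pi x) - x).
Proof. by apply/squot_piP; rewrite squot_reprK. Qed.

Lemma squot_ind (P : squot -> Prop) :
  (forall x, P (squot_pi x)) -> forall u, P u.
Proof. by move=> h u; rewrite -[u]squot_reprK. Qed.

Definition squot_add (u v : squot) := squot_pi (repr u + repr v).
Definition squot_opp (u : squot) := squot_pi (- repr u).
Definition squot_mul (u v : squot) := squot_pi (repr u * repr v).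
Lemma squot_addE x y : squot_add (squot_pi x) (squot_pi y) = squot_pi (x + y).
Proof.
by apply: squot_pi_eq; rewrite opprD addrACA; apply: sidealD; apply: squot_repr.
Qed.

Lemma squot_oppE x : squot_opp (squot_pi x) = squot_pi (- x).
Proof.
by apply: squot_pi_eq; rewrite -opprD; apply: sidealN; apply: squot_repr.
Qed.

Lemma squot_mulE x y : squot_mul (squot_pi x) (squot_pi y) = squot_pi (x * y).
Proof.
apply: squot_pi_eq; set x' := repr _; set y' := repr _.
have -> : x' * y' - x * y = x' * (y' - y) + (x' - x) * y.
  by rewrite mulrBr mulrBl addrA subrK.
by apply: sidealD; [apply: sidealMl|apply: sidealMr]; apply: squot_repr.
Qed.

Fact squot_addA : associative squot_add.
Proof.
elim/squot_ind=> x; elim/squot_ind=> y; elim/squot_ind=> z.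
by rewrite !squot_addE addrA.
Qed.
Fact squot_addC : commutative squot_add.
Proof.
by elim/squot_ind=> x; elim/squot_ind=> y; rewrite !squot_addE addrC.
Qed.
Fact squot_add0 : left_id (squot_pi 0) squot_add.
Proof. by elim/squot_ind=> x; rewrite squot_addE add0r. Qed.
Fact squot_addN : left_inverse (squot_pi 0) squot_opp squot_add.
Proof. by elim/squot_ind=> x; rewrite squot_oppE squot_addE addNr. Qed.

HB.instance Definition _ :=
  GRing.isZmodule.Build squot squot_addA squot_addC squot_add0 squot_addN.

Fact squot_mulA : associative squot_mul.
Proof.
elim/squot_ind=> x; elim/squot_ind=> y; elim/squot_ind=> z.
by rewrite !squot_mulE mulrA.
Qed.
Fact squot_mul1l : left_id (squot_pi 1) squot_mul.
Proof. by elim/squot_ind=> x; rewrite squot_mulE mul1r. Qed.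
Fact squot_mul1r : right_id (squot_pi 1) squot_mul.
Proof. by elim/squot_ind=> x; rewrite squot_mulE mulr1. Qed.
Fact squot_mulDl : left_distributive squot_mul +%R.
Proof.
elim/squot_ind=> x; elim/squot_ind=> y; elim/squot_ind=> z.
by rewrite /GRing.add /= !(squot_mulE, squot_addE) mulrDl.
Qed.
Fact squot_mulDr : right_distributive squot_mul +%R.
Proof.
elim/squot_ind=> x; elim/squot_ind=> y; elim/squot_ind=> z.
by rewrite /GRing.add /= !(squot_mulE, squot_addE) mulrDr.
Qed.

HB.instance Definition _ := GRing.Zmodule_isPzRing.Build squot
  squot_mulA squot_mul1l squot_mul1r squot_mulDl squot_mulDr.

Lemma squot_piD x y : squot_pi (x + y) = squot_pi x + squot_pi y.
Proof. by rewrite -squot_addE. Qed.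
Lemma squot_piM x y : squot_pi (x * y) = squot_pi x * squot_pi y.
Proof. by rewrite -squot_mulE. Qed.
Lemma squot_piN x : squot_pi (- x) = - squot_pi x.
Proof. by rewrite -squot_oppE. Qed.
Lemma squot_pi0 : squot_pi 0 = 0. Proof. by []. Qed.
Lemma squot_pi1 : squot_pi 1 = 1. Proof. by []. Qed.

Lemma squot_pi_eq0 x : squot_pi x = 0 <-> I x.
Proof. by rewrite -squot_pi0; rewrite squot_piP subr0. Qed.

Fact squot_pi_zmod : zmod_morphism squot_pi.
Proof. by move=> x y; rewrite squot_piD squot_piN. Qed.
Fact squot_pi_monoid : monoid_morphism squot_pi.
Proof. by split=> // x y; rewrite squot_piM. Qed.
HB.instance Definition _ :=
  GRing.isZmodMorphism.Build A squot squot_pi squot_pi_zmod.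
HB.instance Definition _ :=
  GRing.isMonoidMorphism.Build A squot squot_pi squot_pi_monoid.

Definition squot_hpart (b : bool) : set squot := squot_pi @` hpart b.

Definition squot_salg : {rmorphism K -> squot} := squot_pi \o salg A.

Fact squot_hpart_salg k : squot_hpart false (squot_salg k).
Proof. by exists (salg A k) => //; apply: hpart_salg. Qed.
Fact squot_hpart0 b : squot_hpart b 0.
Proof. by exists 0 => //; apply: hpart0. Qed.
Fact squot_hpartD b u v : squot_hpart b u -> squot_hpart b v ->
  squot_hpart b (u + v).
Proof.
move=> [x hx <-] [y hy <-]; exists (x + y); first exact: hpartD.
exact: squot_piD.
Qed.
Fact squot_hpartM b c u v : squot_hpart b u -> squot_hpart c v ->
  squot_hpart (b (+) c) (u * v).
Proof.
move=> [x hx <-] [y hy <-]; exists (x * y); first exact: hpartM.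
exact: squot_piM.
Qed.
Fact squot_hpart_decomp u : exists u0 u1,
  [/\ squot_hpart false u0, squot_hpart true u1 & u = u0 + u1].
Proof.
elim/squot_ind: u => x; have [x0 [x1 [h0 h1 ->]]] := hpart_decomp x.
exists (squot_pi x0), (squot_pi x1); split; [by exists x0|by exists x1|].
exact: squot_piD.
Qed.
Fact squot_hpart_direct u : squot_hpart false u -> squot_hpart true u -> u = 0.
Proof.
move=> [x hx <-] [y hy /squot_piP Iyx]; apply/squot_pi_eq0.
move/sidealN: Iyx; rewrite opprB => Iyx.
by have [] := sideal_hpart hx (hpartN hy) Iyx.
Qed.
Fact squot_super_comm b c u v : squot_hpart b u -> squot_hpart c v ->
  u * v = (-1) ^+ (b && c) * (v * u).
Proof.
move=> [x hx <-] [y hy <-]; rewrite -!squot_piM (super_comm hx hy).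
by case: (b && c); rewrite ?expr1 ?expr0 ?mulN1r ?mul1r ?squot_piN.
Qed.

HB.instance Definition _ := isSuperAlgebra.Build K squot
  squot_hpart_salg squot_hpart0 squot_hpartD
  squot_hpartM squot_hpart_decomp squot_hpart_direct squot_super_comm.

End Quotient.

Section QuotientMap.
Variables (K : fieldType) (A : superAlgType K).

(* The canonical map A/I -> A/J; used only when I is contained in J. *)
Definition squot_map (I J : sideal A) (u : squot I) : squot J :=
  squot_pi J (repr u).

Lemma squot_mapE (I J : sideal A) x : I `<=` J ->
  squot_map J (squot_pi I x) = squot_pi J x.
Proof. by move=> IJ; apply: squot_pi_eq; apply: IJ; apply: squot_repr. Qed.

End QuotientMap.

(* Ideals of the ring [even_part] (not of the whole superalgebra). *)
Record evenIdeal (K : fieldType) (A : superAlgType K) := EvenIdeal {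
  evenIdeal_set :> A -> Prop;
  evenIdeal_even : forall x, evenIdeal_set x -> even_part x;
  evenIdeal0 : evenIdeal_set 0;
  evenIdealD : forall x y,
    evenIdeal_set x -> evenIdeal_set y -> evenIdeal_set (x + y);
  evenIdealM : forall a x,
    even_part a -> evenIdeal_set x -> evenIdeal_set (a * x) }.

Definition prime_evenIdeal (K : fieldType) (A : superAlgType K)
    (p : evenIdeal A) : Prop :=
  ~ p 1 /\ forall x y, even_part x -> even_part y -> p (x * y) -> p x \/ p y.

Definition maximal_evenIdeal (K : fieldType) (A : superAlgType K)
    (p : evenIdeal A) : Prop :=
  ~ p 1 /\ forall J : evenIdeal A, p `<=` J -> ~ J 1 -> J `<=` p.

Record spec (K : fieldType) (A : superAlgType K) := Spec {
  spec_ideal :> evenIdeal A;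
  spec_prime : prime_evenIdeal spec_ideal }.

Definition closed_point (K : fieldType) (A : superAlgType K) (p : spec A) :=
  maximal_evenIdeal p.

Lemma hpart_uniq (K : fieldType) (A : superAlgType K) (x0 x1 y0 y1 : A) :
  even_part x0 -> odd_part x1 -> even_part y0 -> odd_part y1 ->
  x0 + x1 = y0 + y1 -> x0 = y0 /\ x1 = y1.
Proof.
move=> ex ox ey oy e.
have e' : x0 - y0 = y1 - x1.
  by apply/eqP; rewrite subr_eq addrAC -subr_eq opprK e addrC.
have z : x0 - y0 = 0.
  by apply: hpart_direct; [apply: hpartB|rewrite e'; apply: hpartB].
by split; apply/eqP; [|rewrite eq_sym]; rewrite -subr_eq0 -?e' z.
Qed.

Section Stalk.
Variables (K : fieldType) (A : superAlgType K) (p : spec A).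
Implicit Types (a b : A).

Definition outside (s : A) : Prop := even_part s /\ ~ p s.

Lemma outside1 : outside 1.
Proof. by split; [apply: hpart1|case: (spec_prime p)]. Qed.

Lemma outsideM s t : outside s -> outside t -> outside (s * t).
Proof.
move=> [es ns] [et nt]; split; first exact: evenM.
by case: (spec_prime p) => _ h /(h _ _ es et)[].
Qed.

Record sfrac := SFrac { snum : A; sden : A; sdenP : outside sden }.

HB.instance Definition _ := gen_eqMixin sfrac.
HB.instance Definition _ := gen_choiceMixin sfrac.

Definition sfrac_eq (x y : sfrac) : Prop := exists2 u, outside u &
  u * (sden y * snum x) = u * (sden x * snum y).

Definition sfrac_rel x y := `[< sfrac_eq x y >].

Lemma sfrac_rel_equiv : equiv_class_of sfrac_rel.
Proof.
split=> [x|x y|y x z].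
- by apply/asboolP; exists 1 => //; apply: outside1.
- by apply: asbool_equiv_eq; split=> -[u]; exists u.
- case: x y z => a s [es ns] [b t [et nt]] [c w [ew nw]].
  move=> /asboolP[u [eu nu] /= hu] /asboolP[v [ev nv] /= hv].
  apply/asboolP; exists (u * v * t); first by do 2![apply: outsideM => //].
  rewrite /= -!mulrA.
  rewrite [t * (w * _)]evenCA // [v * (w * _)]evenCA // [u * (w * _)]evenCA //.
  rewrite [u * (v * _)]evenCA // hu.
  rewrite [w * (v * _)]evenCA // [w * (u * _)]evenCA // [w * (s * _)]evenCA //.
  rewrite [v * (u * _)]evenCA // [v * (s * _)]evenCA // hv.
  by rewrite -[s * (v * _)]evenCA // [t * (s * _)]evenCA.
Qed.

Canonical sfrac_equiv := EquivRelPack sfrac_rel_equiv.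

(* The localization at p of the A_0-module A. *)
Definition stalk := {eq_quot sfrac_rel}.
HB.instance Definition _ := Choice.on stalk.

Definition stalk_frac (x : sfrac) : stalk := \pi_stalk x.
Definition loc a s (hs : outside s) : stalk := stalk_frac (SFrac a hs).

Lemma stalk_fracP (x y : sfrac) : stalk_frac x = stalk_frac y <-> sfrac_eq x y.
Proof. by split=> [/eqmodP/asboolP//|h]; apply/eqmodP/asboolP. Qed.

Lemma loc_eqP a s hs b t ht : @loc a s hs = @loc b t ht <->
  exists2 u, outside u & u * (t * a) = u * (s * b).
Proof. exact: stalk_fracP. Qed.

Lemma stalk_reprK (u : stalk) : stalk_frac (repr u) = u.
Proof. exact: reprK. Qed.

Lemma stalk_repr (x : sfrac) : sfrac_eq (repr (stalk_frac x)) x.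
Proof. by apply/stalk_fracP; rewrite stalk_reprK. Qed.

Lemma loc_ind (P : stalk -> Prop) :
  (forall a s hs, P (@loc a s hs)) -> forall u, P u.
Proof. by move=> h u; rewrite -[u]stalk_reprK; case: (repr u). Qed.

Lemma loc_eq a b s t hs ht : a = b -> s = t -> @loc a s hs = @loc b t ht.
Proof.
by move=> eab est; subst; rewrite (Prop_irrelevance hs ht).
Qed.

Lemma loc_scale a s hs t (ht : outside t) (hts : outside (t * s)) :
  @loc a s hs = @loc (t * a) (t * s) hts.
Proof.
case: (hs) (ht) => es ns [et nt]; apply/loc_eqP; exists 1; first exact: outside1.
by rewrite !mul1r -mulrA [s * (t * _)]evenCA.
Qed.

Lemma loc_scaler a s hs t (ht : outside t) (hst : outside (s * t)) :
  @loc a s hs = @loc (t * a) (s * t) hst.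
Proof.
rewrite (loc_scale a hs ht (outsideM ht hs)); apply: loc_eq => //.
by apply: evenC; case: ht.
Qed.

Lemma loc_ind2 (P : stalk -> stalk -> Prop) :
  (forall a b s hs, P (@loc a s hs) (@loc b s hs)) -> forall u v, P u v.
Proof.
move=> h; elim/loc_ind=> a s hs; elim/loc_ind=> b t ht.
rewrite (loc_scaler a hs ht (outsideM hs ht)).
by rewrite (loc_scale b ht hs (outsideM hs ht)).
Qed.

Definition sfrac_add (x y : sfrac) := SFrac
  (sden y * snum x + sden x * snum y) (outsideM (sdenP x) (sdenP y)).
Definition sfrac_opp (x : sfrac) := SFrac (- snum x) (sdenP x).
Definition sfrac_mul (x y : sfrac) :=
  SFrac (snum x * snum y) (outsideM (sdenP x) (sdenP y)).

Definition stalk_add (u v : stalk) := stalk_frac (sfrac_add (repr u) (repr v)).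
Definition stalk_opp (u : stalk) := stalk_frac (sfrac_opp (repr u)).
Definition stalk_mul (u v : stalk) := stalk_frac (sfrac_mul (repr u) (repr v)).

Lemma sfrac_addC (x y : sfrac) :
  stalk_frac (sfrac_add x y) = stalk_frac (sfrac_add y x).
Proof.
apply/stalk_fracP; exists 1; first exact: outside1.
by case: x y => a s [es ns] [b t [et nt]] /=; rewrite (evenC s et) addrC.
Qed.

Lemma sfrac_addr (x y y' : sfrac) : sfrac_eq y y' ->
  stalk_frac (sfrac_add x y) = stalk_frac (sfrac_add x y').
Proof.
case: x y y' => a s [es ns] [b t [et nt]] [b' t' [et' nt']] [v [ev nv] /= hv].
apply/stalk_fracP; exists v => //=; rewrite -!mulrA !mulrDr.
rewrite [t' * (t * a)]evenCA //; congr (_ + _).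
rewrite [t' * (s * b)]evenCA // [t * (s * b')]evenCA //.
by rewrite ![v * (s * _)]evenCA // hv.
Qed.

Lemma stalk_addE (x y : sfrac) :
  stalk_add (stalk_frac x) (stalk_frac y) = stalk_frac (sfrac_add x y).
Proof.
rewrite /stalk_add (sfrac_addr _ (stalk_repr y)) sfrac_addC.
by rewrite (sfrac_addr _ (stalk_repr x)) sfrac_addC.
Qed.

Lemma stalk_oppE (x : sfrac) : stalk_opp (stalk_frac x) = stalk_frac (sfrac_opp x).
Proof.
have [u hu e] := stalk_repr x.
by apply/stalk_fracP; exists u; rewrite //= !mulrN e.
Qed.

Lemma sfrac_mulr (x y y' : sfrac) : sfrac_eq y y' ->
  stalk_frac (sfrac_mul x y) = stalk_frac (sfrac_mul x y').
Proof.
case: x y y' => a s [es ns] [b t [et nt]] [b' t' [et' nt']] [v [ev nv] /= hv].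
apply/stalk_fracP; exists v => //=; rewrite -!mulrA.
rewrite -[t' * (a * b)]evenCA // -[t * (a * b')]evenCA //.
rewrite ![v * (s * _)]evenCA //.
by rewrite -[v * (a * (t' * b))]evenCA // -[v * (a * (t * b'))]evenCA // hv.
Qed.

Lemma sfrac_mull (x x' y : sfrac) : sfrac_eq x x' ->
  stalk_frac (sfrac_mul x y) = stalk_frac (sfrac_mul x' y).
Proof.
case: x x' y => a s [es ns] [a' s' [es' ns']] [b t [et nt]] [u [eu nu] /= hu].
apply/stalk_fracP; exists u => //=; rewrite -!mulrA.
rewrite [s' * (t * _)]evenCA // [s * (t * _)]evenCA // ![u * (t * _)]evenCA //.
by have := congr1 (fun z => z * b) hu; rewrite -!mulrA => ->.
Qed.

Lemma stalk_mulE (x y : sfrac) :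
  stalk_mul (stalk_frac x) (stalk_frac y) = stalk_frac (sfrac_mul x y).
Proof.
by rewrite /stalk_mul (sfrac_mulr _ (stalk_repr y)) (sfrac_mull _ (stalk_repr x)).
Qed.

Lemma stalk_add_loc a b s hs : stalk_add (@loc a s hs) (@loc b s hs) = loc (a + b) hs.
Proof.
by rewrite stalk_addE (loc_scale (a + b) hs hs (outsideM hs hs)) mulrDr.
Qed.

Lemma stalk_mul_loc a s hs b t ht :
  stalk_mul (@loc a s hs) (@loc b t ht) = loc (a * b) (outsideM hs ht).
Proof. exact: stalk_mulE. Qed.

Lemma loc_ind3 (P : stalk -> stalk -> stalk -> Prop) :
  (forall a b c s hs, P (@loc a s hs) (@loc b s hs) (@loc c s hs)) ->
  forall u v w, P u v w.
Proof.
move=> h u v; move: u v; apply: loc_ind2 => a b s hs; elim/loc_ind=> c t ht.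
have hst := outsideM hs ht.
rewrite (loc_scaler a hs ht hst) (loc_scaler b hs ht hst).
by rewrite (loc_scale c ht hs hst).
Qed.

Fact stalk_addA : associative stalk_add.
Proof. by apply: loc_ind3 => a b c s hs; rewrite !stalk_add_loc addrA. Qed.
Fact stalk_addC : commutative stalk_add.
Proof. by apply: loc_ind2 => a b s hs; rewrite !stalk_add_loc addrC. Qed.
Fact stalk_add0 : left_id (loc 0 outside1) stalk_add.
Proof.
elim/loc_ind=> a s hs.
by rewrite stalk_addE; apply: loc_eq; rewrite /= ?mulr0 ?add0r mul1r.
Qed.
Fact stalk_addN : left_inverse (loc 0 outside1) stalk_opp stalk_add.
Proof.
elim/loc_ind=> a s hs; rewrite stalk_oppE stalk_add_loc addNr.
by apply/loc_eqP; exists 1; [apply: outside1|rewrite !mulr0].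
Qed.

HB.instance Definition _ :=
  GRing.isZmodule.Build stalk stalk_addA stalk_addC stalk_add0 stalk_addN.

Fact stalk_mulA : associative stalk_mul.
Proof.
apply: loc_ind3 => a b c s hs; rewrite !stalk_mul_loc.
by apply: loc_eq; rewrite mulrA.
Qed.
Fact stalk_mul1l : left_id (loc 1 outside1) stalk_mul.
Proof. by elim/loc_ind=> a s hs; rewrite stalk_mul_loc; apply: loc_eq; rewrite mul1r. Qed.
Fact stalk_mul1r : right_id (loc 1 outside1) stalk_mul.
Proof. by elim/loc_ind=> a s hs; rewrite stalk_mul_loc; apply: loc_eq; rewrite mulr1. Qed.
Fact stalk_mulDl : left_distributive stalk_mul +%R.
Proof.
apply: loc_ind3 => a b c s hs.
by rewrite /GRing.add /= !(stalk_add_loc, stalk_mul_loc) mulrDl.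
Qed.
Fact stalk_mulDr : right_distributive stalk_mul +%R.
Proof.
apply: loc_ind3 => a b c s hs.
by rewrite /GRing.add /= !(stalk_add_loc, stalk_mul_loc) mulrDr.
Qed.

HB.instance Definition _ := GRing.Zmodule_isPzRing.Build stalk
  stalk_mulA stalk_mul1l stalk_mul1r stalk_mulDl stalk_mulDr.

Lemma locD a b s hs : @loc a s hs + @loc b s hs = loc (a + b) hs.
Proof. exact: stalk_add_loc. Qed.
Lemma locM a s hs b t ht :
  @loc a s hs * @loc b t ht = loc (a * b) (outsideM hs ht).
Proof. exact: stalk_mul_loc. Qed.
Lemma locN a s hs : - @loc a s hs = loc (- a) hs.
Proof. exact: stalk_oppE. Qed.
Lemma loc0 s hs : @loc 0 s hs = 0.
Proof. by apply/loc_eqP; exists 1; [apply: outside1|rewrite !mulr0]. Qed.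

Lemma loc_eq0 a s hs : @loc a s hs = 0 <-> exists2 u, outside u & u * a = 0.
Proof.
rewrite -[0](loc0 outside1) loc_eqP.
by split=> -[u hu]; rewrite !mulr0 ?mul1r => h; exists u; rewrite // ?mul1r ?mulr0.
Qed.

Definition stalk_in (a : A) : stalk := loc a outside1.

Fact stalk_in_zmod : zmod_morphism stalk_in.
Proof. by move=> a b; rewrite /stalk_in locN locD. Qed.
Fact stalk_in_monoid : monoid_morphism stalk_in.
Proof.
by split=> // a b; rewrite /stalk_in locM; apply: loc_eq; rewrite ?mulr1.
Qed.
HB.instance Definition _ :=
  GRing.isZmodMorphism.Build A stalk stalk_in stalk_in_zmod.
HB.instance Definition _ :=
  GRing.isMonoidMorphism.Build A stalk stalk_in stalk_in_monoid.

Definition stalk_hpart (b : bool) : set stalk :=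
  [set u | exists a s (hs : outside s), hpart b a /\ u = loc a hs].

Definition stalk_salg : {rmorphism K -> stalk} := stalk_in \o salg A.

Fact stalk_hpart_salg k : stalk_hpart false (stalk_salg k).
Proof. by exists (salg A k), 1, outside1; split=> //; apply: hpart_salg. Qed.
Fact stalk_hpart0 (b : bool) : stalk_hpart b 0.
Proof. by exists 0, 1, outside1; split=> //; apply: hpart0. Qed.
Fact stalk_hpartD (b : bool) u v : stalk_hpart b u -> stalk_hpart b v ->
  stalk_hpart b (u + v).
Proof.
move=> [x [s [hs [hx ->]]]] [y [t [ht [hy ->]]]].
exists (t * x + s * y), (s * t), (outsideM hs ht).
by split; [apply: hpartD; apply: hpartMe => //; [case: ht|case: hs]|apply: stalk_addE].
Qed.
Fact stalk_hpartM (b c : bool) u v : stalk_hpart b u -> stalk_hpart c v ->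
  stalk_hpart (b (+) c) (u * v).
Proof.
move=> [x [s [hs [hx ->]]]] [y [t [ht [hy ->]]]].
by exists (x * y), (s * t), (outsideM hs ht); split; [apply: hpartM|apply: locM].
Qed.
Fact stalk_hpart_decomp u : exists u0 u1,
  [/\ stalk_hpart false u0, stalk_hpart true u1 & u = u0 + u1].
Proof.
elim/loc_ind: u => x s hs; have [x0 [x1 [h0 h1 ->]]] := hpart_decomp x.
exists (loc x0 hs), (loc x1 hs).
by split; [exists x0, s, hs|exists x1, s, hs|rewrite locD].
Qed.
Fact stalk_hpart_direct u : stalk_hpart false u -> stalk_hpart true u -> u = 0.
Proof.
move=> [x [s [hs [hx ->]]]] [y [t [ht [hy]]]] /loc_eqP[w hw e].
apply/loc_eq0; exists (w * t); first exact: outsideM.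
rewrite -mulrA; apply: hpart_direct; last rewrite e;
  by do 2![apply: hpartMe; rewrite /outside in hs ht hw; first tauto].
Qed.
Fact stalk_super_comm (b c : bool) u v : stalk_hpart b u -> stalk_hpart c v ->
  u * v = (-1) ^+ (b && c) * (v * u).
Proof.
move=> [x [s [hs [hx ->]]]] [y [t [ht [hy ->]]]].
rewrite !locM (super_comm hx hy).
case: (b && c); rewrite ?expr1 ?expr0 ?mulN1r ?mul1r ?locN;
  by apply: loc_eq => //; apply: evenC; case: hs.
Qed.

HB.instance Definition _ := isSuperAlgebra.Build K stalk
  stalk_hpart_salg stalk_hpart0 stalk_hpartD
  stalk_hpartM stalk_hpart_decomp stalk_hpart_direct stalk_super_comm.

(* The maximal ideal of the stalk: fractions (a + b) / s with a in p, b odd.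
   See [sub_stalk_max], [stalk_max_proper] and [stalk_max_sideal]. *)
Definition stalk_max : set stalk :=
  [set u | exists a b s (hs : outside s),
    [/\ p a, odd_part b & u = loc (a + b) hs]].

Lemma stalk_max_proper : ~ stalk_max 1.
Proof.
move=> [a [b [s [hs [pa ob /loc_eqP[u hu e]]]]]].
have [[es ns] [eu nu]] := (hs, hu).
have ea : even_part a := evenIdeal_even pa.
rewrite mulr1 mul1r mulrDr in e.
have z : u * s = u * a.
  apply/eqP; rewrite -subr_eq0; apply/eqP/hpart_direct.
    by apply: hpartB; apply: evenM.
  by rewrite e addrAC subrr add0r; apply: hpartMe.
by case: (outsideM hu hs) => _; apply; rewrite z; apply: evenIdealM.
Qed.

Lemma sub_stalk_max (J : sideal stalk) : ~ J 1 -> J `<=` stalk_max.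
Proof.
move=> J1; elim/loc_ind=> x s hs; have [x0 [x1 [h0 h1 ->]]] := hpart_decomp x.
rewrite -locD => Jx; have [Jx0 _] : J (loc x0 hs) /\ J (loc x1 hs).
  by apply: sideal_hpart Jx; [exists x0, s, hs|exists x1, s, hs].
rewrite locD; exists x0, x1, s, hs; split=> //; apply: contrapT => px0.
have hx0 : outside x0 by [].
apply: J1; suff <- : loc s hx0 * loc x0 hs = 1 by apply: sidealMl.
rewrite locM -(rmorph1 stalk_in); apply/loc_eqP.
by exists 1; [exact: outside1|rewrite !mul1r mulr1 (evenC s h0)].
Qed.

Section MaxIdeal.
Hypothesis K2 : (2%:R : K) != 0.

Lemma odd_sqr b : odd_part b -> b * b = 0.
Proof.
move=> ob; have := super_comm ob ob; rewrite /= expr1 mulN1r => /eqP.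
rewrite -subr_eq0 opprK -mulr2n -mulr_natl -(rmorph_nat (salg A)) => /eqP e.
by rewrite -[LHS]mul1r -(rmorph1 (salg A)) -(mulVf K2) rmorphM -mulrA e mulr0.
Qed.

Lemma oddM_in b c : odd_part b -> odd_part c -> p (b * c).
Proof.
move=> ob oc; have ebc : even_part (b * c) by apply: (hpartM ob oc).
suff: p (b * c * (b * c)) by case: (spec_prime p) => _ h /(h _ _ ebc ebc)[].
rewrite -mulrA [c * (b * c)]mulrA (super_comm oc ob) expr1 mulN1r mulNr mulrN.
by rewrite -!mulrA (odd_sqr oc) !mulr0 oppr0; apply: evenIdeal0.
Qed.

Fact stalk_max0 : stalk_max 0.
Proof.
exists 0, 0, 1, outside1; split; [exact: evenIdeal0|exact: hpart0|].
by rewrite addr0 loc0.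
Qed.
Fact stalk_maxD u v : stalk_max u -> stalk_max v -> stalk_max (u + v).
Proof.
move=> [a [b [s [hs [pa ob ->]]]]] [c [d [t [ht [pc od ->]]]]].
exists (t * a + s * c), (t * b + s * d), (s * t), (outsideM hs ht).
have [[es _] [et _]] := (hs, ht).
split; [|by apply: hpartD; apply: hpartMe|].
  by apply: evenIdealD; apply: evenIdealM.
by rewrite addrACA -!mulrDr; apply: stalk_addE.
Qed.
Fact stalk_maxMl u v : stalk_max v -> stalk_max (u * v).
Proof.
move=> [a [b [s [hs [pa ob ->]]]]]; elim/loc_ind: u => x t ht.
have [x0 [x1 [h0 h1 ->]]] := hpart_decomp x.
exists (x0 * a + x1 * b), (x0 * b + x1 * a), (t * s), (outsideM ht hs); split.
- by apply: evenIdealD; [apply: evenIdealM|apply: oddM_in].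
- apply: hpartD; first exact: hpartMe.
  by apply: (hpartM (b := true) (c := false)) => //; apply: evenIdeal_even pa.
- by rewrite locM; apply: loc_eq; rewrite // mulrDl !mulrDr [x1 * a + _]addrC addrACA.
Qed.
Fact stalk_maxMr u v : stalk_max v -> stalk_max (v * u).
Proof.
move=> [a [b [s [hs [pa ob ->]]]]]; elim/loc_ind: u => x t ht.
have [x0 [x1 [h0 h1 ->]]] := hpart_decomp x; have ea := evenIdeal_even pa.
exists (a * x0 + b * x1), (a * x1 + b * x0), (s * t), (outsideM hs ht); split.
- by apply: evenIdealD; [rewrite -evenC //; apply: evenIdealM|apply: oddM_in].
- by apply: hpartD; [apply: hpartMe|rewrite -evenC //; apply: hpartMe].
- by rewrite locM; apply: loc_eq; rewrite // mulrDl !mulrDr [b * x0 + _]addrC addrACA.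
Qed.
Fact stalk_max_hpart u0 u1 : even_part u0 -> odd_part u1 ->
  stalk_max (u0 + u1) -> stalk_max u0 /\ stalk_max u1.
Proof.
move=> e0 o1 [a [b [s [hs [pa ob]]]]]; rewrite -locD => e.
have [] : u0 = loc a hs /\ u1 = loc b hs.
  apply: hpart_uniq e => //; last by exists b, s, hs.
  by exists a, s, hs; split=> //; apply: evenIdeal_even pa.
move=> -> ->; split.
- by exists a, 0, s, hs; split=> //; [apply: hpart0|rewrite addr0].
- by exists 0, b, s, hs; split=> //; [apply: evenIdeal0|rewrite add0r].
Qed.

Definition stalk_max_sideal : sideal stalk :=
  SIdeal stalk_max0 stalk_maxD stalk_maxMl stalk_maxMr stalk_max_hpart.

End MaxIdeal.

End Stalk.

Section QuotientMapTheory.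
Variables (K : fieldType) (A : superAlgType K) (I J : sideal A).
Hypothesis IJ : I `<=` J.
Implicit Types u v : squot I.

Lemma squot_mapD u v : squot_map J (u + v) = squot_map J u + squot_map J v.
Proof.
elim/squot_ind: u => x; elim/squot_ind: v => y.
by rewrite -squot_piD !(squot_mapE _ IJ) squot_piD.
Qed.
Lemma squot_mapM u v : squot_map J (u * v) = squot_map J u * squot_map J v.
Proof.
elim/squot_ind: u => x; elim/squot_ind: v => y.
by rewrite -squot_piM !(squot_mapE _ IJ) squot_piM.
Qed.
Lemma squot_mapN u : squot_map J (- u) = - squot_map J u.
Proof.
by elim/squot_ind: u => x; rewrite -squot_piN !(squot_mapE _ IJ) squot_piN.
Qed.
Lemma squot_map_hpart b u : hpart b u -> hpart b (squot_map J u).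
Proof. by move=> [x hx <-]; rewrite squot_mapE //; exists x. Qed.

End QuotientMapTheory.

Section Completion.
Variables (K : fieldType) (A : superAlgType K) (M : set A).

Record completion := Completion {
  cproj : forall n, squot (sideal_pow M n);
  cprojP : forall n k, (n <= k)%N ->
    squot_map (sideal_pow M n) (cproj k) = cproj n }.

HB.instance Definition _ := gen_eqMixin completion.
HB.instance Definition _ := gen_choiceMixin completion.

Lemma completionP (u v : completion) : (forall n, cproj u n = cproj v n) -> u = v.
Proof.
case: u v => u hu [v hv] /= e; have {}e : u = v by apply: functional_extensionality_dep.
by subst v; rewrite (Prop_irrelevance hu hv).
Qed.

Definition cconst (a : A) : completion.
Proof.
exists (fun n => squot_pi _ a) => n k nk.
by apply: squot_mapE; apply: sideal_pow_sub.
Defined.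

Definition cadd (u v : completion) : completion.
Proof.
exists (fun n => cproj u n + cproj v n) => n k nk.
by rewrite squot_mapD ?cprojP //; apply: sideal_pow_sub.
Defined.

Definition copp (u : completion) : completion.
Proof.
exists (fun n => - cproj u n) => n k nk.
by rewrite squot_mapN ?cprojP //; apply: sideal_pow_sub.
Defined.

Definition cmul (u v : completion) : completion.
Proof.
exists (fun n => cproj u n * cproj v n) => n k nk.
by rewrite squot_mapM ?cprojP //; apply: sideal_pow_sub.
Defined.

Fact caddA : associative cadd.
Proof. by move=> u v w; apply: completionP => n /=; rewrite addrA. Qed.
Fact caddC : commutative cadd.
Proof. by move=> u v; apply: completionP => n /=; rewrite addrC. Qed.
Fact cadd0 : left_id (cconst 0) cadd.
Proof. by move=> u; apply: completionP => n /=; rewrite squot_pi0 add0r. Qed.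
Fact caddN : left_inverse (cconst 0) copp cadd.
Proof. by move=> u; apply: completionP => n /=; rewrite addNr. Qed.

HB.instance Definition _ :=
  GRing.isZmodule.Build completion caddA caddC cadd0 caddN.

Fact cmulA : associative cmul.
Proof. by move=> u v w; apply: completionP => n /=; rewrite mulrA. Qed.
Fact cmul1l : left_id (cconst 1) cmul.
Proof. by move=> u; apply: completionP => n /=; rewrite squot_pi1 mul1r. Qed.
Fact cmul1r : right_id (cconst 1) cmul.
Proof. by move=> u; apply: completionP => n /=; rewrite squot_pi1 mulr1. Qed.
Fact cmulDl : left_distributive cmul +%R.
Proof. by move=> u v w; apply: completionP => n /=; rewrite mulrDl. Qed.
Fact cmulDr : right_distributive cmul +%R.
Proof. by move=> u v w; apply: completionP => n /=; rewrite mulrDr. Qed.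

HB.instance Definition _ := GRing.Zmodule_isPzRing.Build completion
  cmulA cmul1l cmul1r cmulDl cmulDr.

Fact cconst_zmod : zmod_morphism cconst.
Proof. by move=> a b; apply: completionP => n /=; rewrite raddfB. Qed.
Fact cconst_monoid : monoid_morphism cconst.
Proof. by split=> // a b; apply: completionP => n /=; rewrite rmorphM. Qed.
HB.instance Definition _ :=
  GRing.isZmodMorphism.Build A completion cconst cconst_zmod.
HB.instance Definition _ :=
  GRing.isMonoidMorphism.Build A completion cconst cconst_monoid.

Definition completion_salg : {rmorphism K -> completion} := cconst \o salg A.

Definition completion_hpart (b : bool) : set completion :=
  [set u | forall n, hpart b (cproj u n)].

Fact completion_hpart_salg k : completion_hpart false (completion_salg k).
Proof. by move=> n; apply: (hpart_salg (s := squot (sideal_pow M n))). Qed.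
Fact completion_hpart0 b : completion_hpart b 0.
Proof. by move=> n; apply: hpart0. Qed.
Fact completion_hpartD b u v : completion_hpart b u -> completion_hpart b v ->
  completion_hpart b (u + v).
Proof. by move=> hu hv n; apply: hpartD. Qed.
Fact completion_hpartM b c u v : completion_hpart b u -> completion_hpart c v ->
  completion_hpart (b (+) c) (u * v).
Proof. by move=> hu hv n; apply: hpartM. Qed.
Fact completion_hpart_decomp u : exists u0 u1,
  [/\ completion_hpart false u0, completion_hpart true u1 & u = u0 + u1].
Proof.
have dec n : {w : squot (sideal_pow M n) * squot (sideal_pow M n) |
    [/\ even_part w.1, odd_part w.2 & cproj u n = w.1 + w.2]}.
  apply: cid; have [w0 [w1 h]] := hpart_decomp (cproj u n).
  by exists (w0, w1).
pose w n := sval (dec n); have wP n := svalP (dec n); rewrite -/(w _) in wP.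
have coh n k : (n <= k)%N ->
    squot_map (sideal_pow M n) (w k).1 = (w n).1 /\
    squot_map (sideal_pow M n) (w k).2 = (w n).2.
  move=> nk; have sub := sideal_pow_sub (M := M) nk.
  have [e0 e1 ek] := wP k; have [f0 f1 en] := wP n.
  apply: hpart_uniq => //; try exact: squot_map_hpart.
  by rewrite -squot_mapD // -ek -en cprojP.
exists (Completion (fun n k nk => proj1 (coh n k nk))).
exists (Completion (fun n k nk => proj2 (coh n k nk))).
split=> [n|n|]; try by have [] := wP n.
by apply: completionP => n /=; have [] := wP n.
Qed.
Fact completion_hpart_direct u :
  completion_hpart false u -> completion_hpart true u -> u = 0.
Proof. by move=> h0 h1; apply: completionP => n; apply: hpart_direct. Qed.
Fact completion_super_comm b c u v :
  completion_hpart b u -> completion_hpart c v ->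
  u * v = (-1) ^+ (b && c) * (v * u).
Proof.
move=> hu hv; apply: completionP => n.
have /= -> := super_comm (hu n) (hv n).
by case: (b && c); rewrite ?expr1 ?expr0 ?mulN1r ?mul1r.
Qed.

HB.instance Definition _ := isSuperAlgebra.Build K completion
  completion_hpart_salg completion_hpart0 completion_hpartD
  completion_hpartM completion_hpart_decomp completion_hpart_direct
  completion_super_comm.

End Completion.

Section PowerSeries.
Variables (K : fieldType) (r : nat).

Definition pseries : Type := 'X_{1..r} -> K.

HB.instance Definition _ := gen_eqMixin pseries.
HB.instance Definition _ := gen_choiceMixin pseries.

Implicit Types f g h : pseries.

Definition pseries_add f g : pseries := fun m => f m + g m.
Definition pseries_opp f : pseries := fun m => - f m.
Definition pseries_const (c : K) : pseries := fun m => if m == 0%MM then c else 0.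
Definition pseries_mul f g : pseries := fun m =>
  \sum_(k : 'X_{1..r < (mdeg m).+1} | (k <= m)%MM) f k * g (m - k)%MM.

Fact pseries_addA : associative pseries_add.
Proof. by move=> f g h; apply: funext => m; rewrite /pseries_add addrA. Qed.
Fact pseries_addC : commutative pseries_add.
Proof. by move=> f g; apply: funext => m; rewrite /pseries_add addrC. Qed.
Fact pseries_add0 : left_id (pseries_const 0) pseries_add.
Proof.
by move=> f; apply: funext => m; rewrite /pseries_add /pseries_const if_same add0r.
Qed.
Fact pseries_addN : left_inverse (pseries_const 0) pseries_opp pseries_add.
Proof.
move=> f; apply: funext => m.
by rewrite /pseries_add /pseries_const if_same /pseries_opp addNr.
Qed.

HB.instance Definition _ := GRing.isZmodule.Build pseries
  pseries_addA pseries_addC pseries_add0 pseries_addN.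

Lemma pseriesDE f g m : (f + g) m = f m + g m. Proof. by []. Qed.
Lemma pseriesNE f m : (- f) m = - f m. Proof. by []. Qed.
Lemma pseries0E m : (0 : pseries) m = 0. Proof. exact: if_same. Qed.

(* The ring axioms are transported from polynomials, by truncation. *)
Definition pseries_trunc (d : nat) f : {mpoly K[r]} :=
  \sum_(m : 'X_{1..r < d}) f m *: 'X_[m].

Lemma pseries_truncE d f m : (mdeg m < d)%N -> (pseries_trunc d f)@_m = f m.
Proof. exact: mcoeff_mpoly. Qed.

Lemma mdeg_le (k m : 'X_{1..r}) : (k <= m)%MM -> (mdeg k <= mdeg m)%N.
Proof. by move=> km; rewrite -(submK km) mdegD leq_addl. Qed.

Lemma mcoeffM_lin (p q : {mpoly K[r]}) m : (p * q)@_m =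
  \sum_(k : 'X_{1..r < (mdeg m).+1} | (k <= m)%MM) p@_k * q@_(m - k).
Proof. exact: mcoeff_poly_mul_lin. Qed.

Lemma eq_mcoeffM (p p' q q' : {mpoly K[r]}) m :
  (forall k, (mdeg k <= mdeg m)%N -> p@_k = p'@_k) ->
  (forall k, (mdeg k <= mdeg m)%N -> q@_k = q'@_k) ->
  (p * q)@_m = (p' * q')@_m.
Proof.
move=> ep eq; rewrite !mcoeffM_lin; apply: eq_bigr => k km.
by rewrite ep ?mdeg_le // eq // mdegB.
Qed.

Lemma pseries_mulE d f g m : (mdeg m < d)%N ->
  pseries_mul f g m = (pseries_trunc d f * pseries_trunc d g)@_m.
Proof.
move=> md; rewrite mcoeffM_lin; apply: eq_bigr => k km.
by rewrite !pseries_truncE //; apply: leq_ltn_trans md; rewrite ?mdegB ?mdeg_le.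
Qed.

Fact pseries_mulA : associative pseries_mul.
Proof.
move=> f g h; apply: funext => m; rewrite !(@pseries_mulE (mdeg m).+1) //.
set d := (mdeg m).+1.
have e k : (mdeg k <= mdeg m)%N -> (pseries_trunc d (pseries_mul g h))@_k =
    (pseries_trunc d g * pseries_trunc d h)@_k.
  by move=> km; rewrite pseries_truncE // (@pseries_mulE d).
have e' k : (mdeg k <= mdeg m)%N -> (pseries_trunc d (pseries_mul f g))@_k =
    (pseries_trunc d f * pseries_trunc d g)@_k.
  by move=> km; rewrite pseries_truncE // (@pseries_mulE d).
by rewrite (eq_mcoeffM (fun k _ => erefl) e) (eq_mcoeffM e' (fun k _ => erefl)) mulrA.
Qed.
Fact pseries_mulC : commutative pseries_mul.
Proof.
move=> f g; apply: funext => m.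
by rewrite !(@pseries_mulE (mdeg m).+1) // mulrC.
Qed.
Fact pseries_mul1 : left_id (pseries_const 1) pseries_mul.
Proof.
move=> f; apply: funext => m; rewrite (@pseries_mulE (mdeg m).+1) //.
rewrite -[RHS](@pseries_truncE (mdeg m).+1) // -[in RHS](mul1r (pseries_trunc _ f)).
apply: eq_mcoeffM => // k km; rewrite pseries_truncE // mcoeff1 /pseries_const.
by case: (_ == _).
Qed.
Fact pseries_mulD : left_distributive pseries_mul +%R.
Proof.
move=> f g h; apply: funext => m; rewrite pseriesDE -big_split /=.
by apply: eq_bigr => k _; rewrite pseriesDE mulrDl.
Qed.

HB.instance Definition _ := GRing.Zmodule_isComPzRing.Build pseries
  pseries_mulA pseries_mulC pseries_mul1 pseries_mulD.

Fact pseries_const_zmod : zmod_morphism pseries_const.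
Proof.
move=> a b; apply: funext => m; rewrite pseriesDE pseriesNE /pseries_const.
by case: (_ == _); rewrite ?subr0.
Qed.
Fact pseries_const_monoid : monoid_morphism pseries_const.
Proof.
split=> // a b; apply: funext => m.
rewrite [RHS](@pseries_mulE (mdeg m).+1) //.
rewrite (@eq_mcoeffM _ a%:MP _ b%:MP).
- by rewrite -mpolyCM mcoeffC /pseries_const; case: (_ == _); rewrite ?mulr1 ?mulr0.
- move=> k km; rewrite pseries_truncE // mcoeffC /pseries_const.
  by case: (_ == _); rewrite ?mulr1 ?mulr0.
- move=> k km; rewrite pseries_truncE // mcoeffC /pseries_const.
  by case: (_ == _); rewrite ?mulr1 ?mulr0.
Qed.
HB.instance Definition _ :=
  GRing.isZmodMorphism.Build K pseries pseries_const pseries_const_zmod.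
HB.instance Definition _ :=
  GRing.isMonoidMorphism.Build K pseries pseries_const pseries_const_monoid.

End PowerSeries.

Section SuperSeries.
Local Close Scope classical_set_scope.
Variables (K : fieldType) (r s : nat).
Local Notation B := (pseries K r).
Local Notation mon := {set 'I_s}.
Implicit Types S T U V : mon.

(* Number of pairs (i, j) in T x U with j < i. *)
Definition inversions T U : nat := \sum_(i in T) \sum_(j in U) (j < i)%N.

(* For T = {i_1 < ... < i_k}, put xi_T := xi_{i_1} ... xi_{i_k}.  Then
   xi_T * xi_U = xi_coef T U * xi_{T :|: U}. *)
Definition xi_coef T U : B :=
  if [disjoint T & U] then (-1) ^+ inversions T U else 0.

(* [f S] is the coefficient of xi_S in f. *)
Definition superseries := {ffun mon -> B}.
HB.instance Definition _ := GRing.Zmodule.copy superseries {ffun mon -> B}.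
Implicit Types f g h : superseries.

Definition superseries_const (c : B) : superseries :=
  [ffun S => if S == finset.set0 then c else 0].
Definition superseries_mul f g : superseries :=
  [ffun S => \sum_(P : mon * mon | P.1 :|: P.2 == S)
     xi_coef P.1 P.2 * (f P.1 * g P.2)].

Lemma inversionsUl T U V : [disjoint T & U] ->
  inversions (T :|: U) V = (inversions T V + inversions U V)%N.
Proof.
move=> dTU; rewrite /inversions -bigU //.
by apply: eq_bigl => i; rewrite !inE.
Qed.

Lemma inversionsUr T U V : [disjoint U & V] ->
  inversions T (U :|: V) = (inversions T U + inversions T V)%N.
Proof.
move=> dUV; rewrite /inversions -big_split /=; apply: eq_bigr => i _.
by rewrite -bigU //; apply: eq_bigl => j; rewrite !inE.
Qed.

Lemma inversions_sym T U : [disjoint T & U] ->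
  (inversions T U + inversions U T = #|T| * #|U|)%N.
Proof.
move=> dTU; rewrite /inversions [X in (_ + X)%N]exchange_big -big_split /=.
rewrite -sum_nat_const; apply: eq_bigr => i iT.
rewrite -sum1_card -big_split /=; apply: eq_bigr => j jU.
have : nat_of_ord i != j.
  by apply: contraTneq jU => /ord_inj <-; rewrite (disjointFr dTU).
by rewrite neq_ltn => /orP[] lt; rewrite lt ltnNge (ltnW lt).
Qed.

Lemma xi_coef_cocycle T U V :
  xi_coef T U * xi_coef (T :|: U) V = xi_coef U V * xi_coef T (U :|: V).
Proof.
have dU : [disjoint T :|: U & V] = [disjoint T & V] && [disjoint U & V].
  by rewrite -!finset.setI_eq0 finset.setIUl finset.setU_eq0.
have dV : [disjoint T & U :|: V] = [disjoint T & U] && [disjoint T & V].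
  by rewrite -!finset.setI_eq0 finset.setIUr finset.setU_eq0.
rewrite /xi_coef dU dV; case dTU: [disjoint T & U]; case dTV: [disjoint T & V];
  case dUV: [disjoint U & V]; rewrite /= ?mulr0 ?mul0r //.
by rewrite inversionsUl // inversionsUr // -!exprD addnA addnC.
Qed.

Lemma xi_coef_sym T U : xi_coef T U = (-1) ^+ (#|T| * #|U|) * xi_coef U T.
Proof.
rewrite /xi_coef disjoint_sym; case: ifP => dUT; last by rewrite mulr0.
have dTU : [disjoint T & U] by rewrite disjoint_sym.
by rewrite -inversions_sym // exprD -mulrA -expr2 sqrr_sign mulr1.
Qed.

Lemma xi_coef0l T : xi_coef finset.set0 T = 1.
Proof. by rewrite /xi_coef -finset.setI_eq0 finset.set0I eqxx /inversions big_set0. Qed.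

Lemma xi_coef0r T : xi_coef T finset.set0 = 1.
Proof.
rewrite /xi_coef -finset.setI_eq0 finset.setI0 eqxx /inversions big1 // => i _.
by rewrite big_set0.
Qed.

Lemma superseries_mulE f g S : superseries_mul f g S =
  \sum_T \sum_(U | T :|: U == S) xi_coef T U * (f T * g U).
Proof. by rewrite ffunE pair_big_dep. Qed.

Fact superseries_mulA : associative superseries_mul.
Proof.
move=> f g h; apply/ffunP => S; rewrite !superseries_mulE.
transitivity (\sum_T \sum_U \sum_(V | T :|: (U :|: V) == S)
  (xi_coef U V * xi_coef T (U :|: V)) * (f T * (g U * h V))).
  apply: eq_bigr => T _.
  under eq_bigr => W _ do rewrite superseries_mulE !mulr_sumr.
  rewrite exchange_big /=; apply: eq_bigr => U _.
  under eq_bigr => W _ do rewrite !mulr_sumr.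
  rewrite (exchange_big_dep xpredT) //= [RHS]big_mkcond /=.
  apply: eq_bigr => V _; case: ifP => hS; last first.
    by apply: big1 => W /andP[hW /eqP eW]; rewrite -eW hS in hW.
  rewrite (big_pred1 (U :|: V)) => [|W]; last first.
    by rewrite /= [RHS]eq_sym andbC; case: eqP => //= <-.
  by rewrite -!mulrA [RHS]mulrCA; congr (_ * _); rewrite mulrCA.
transitivity (\sum_T \sum_U \sum_(V | T :|: (U :|: V) == S)
  (xi_coef T U * xi_coef (T :|: U) V) * (f T * (g U * h V))).
  apply: eq_bigr => T _; apply: eq_bigr => U _; apply: eq_bigr => V _.
  by rewrite xi_coef_cocycle.
symmetry.
under eq_bigr => W _.
  under eq_bigr => V _ do rewrite superseries_mulE mulr_suml mulr_sumr.
  over.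
under eq_bigr => W _ do rewrite exchange_big /=.
rewrite exchange_big /=; apply: eq_bigr => T _.
under eq_bigr => W _.
  under eq_bigr => V _ do rewrite mulr_suml mulr_sumr.
  rewrite (exchange_big_dep xpredT) //=.
  over.
rewrite exchange_big /=; apply: eq_bigr => U _.
rewrite (exchange_big_dep xpredT) //= [RHS]big_mkcond /=.
apply: eq_bigr => V _; case: ifP => hS; last first.
  by apply: big1 => W /andP[hW /eqP eW]; rewrite -eW -finset.setUA hS in hW.
rewrite (big_pred1 (T :|: U)) => [|W]; last first.
  rewrite /= [RHS]eq_sym andbC; case: eqP => //= <-.
  by rewrite -finset.setUA hS.
by rewrite -!mulrA mulrCA.
Qed.

Fact superseries_mul1l : left_id (superseries_const 1) superseries_mul.
Proof.
move=> f; apply/ffunP => S; rewrite superseries_mulE (bigD1 finset.set0) //=.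
rewrite (big_pred1 S) => [|U]; last by rewrite finset.set0U.
rewrite xi_coef0l ffunE eqxx !mul1r big1 ?addr0 // => T nT.
by apply: big1 => U _; rewrite ffunE (negbTE nT) mul0r mulr0.
Qed.
Fact superseries_mul1r : right_id (superseries_const 1) superseries_mul.
Proof.
move=> f; apply/ffunP => S; rewrite superseries_mulE.
rewrite (exchange_big_dep xpredT) //= (bigD1 finset.set0) //=.
rewrite (big_pred1 S) => [|U]; last by rewrite finset.setU0.
rewrite xi_coef0r ffunE eqxx mulr1 mul1r big1 ?addr0 // => T nT.
by apply: big1 => U _; rewrite ffunE (negbTE nT) !mulr0.
Qed.
Fact superseries_mulDl : left_distributive superseries_mul +%R.
Proof.
move=> f g h; apply/ffunP => S; rewrite !ffunE -big_split /=.
by apply: eq_bigr => P _; rewrite ffunE mulrDl mulrDr.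
Qed.
Fact superseries_mulDr : right_distributive superseries_mul +%R.
Proof.
move=> f g h; apply/ffunP => S; rewrite !ffunE -big_split /=.
by apply: eq_bigr => P _; rewrite ffunE !mulrDr.
Qed.

HB.instance Definition _ := GRing.Zmodule_isPzRing.Build superseries
  superseries_mulA superseries_mul1l superseries_mul1r
  superseries_mulDl superseries_mulDr.

Fact superseries_const_zmod : zmod_morphism superseries_const.
Proof.
by move=> a b; apply/ffunP => S; rewrite !ffunE; case: (_ == _); rewrite ?subr0.
Qed.
Fact superseries_const_monoid : monoid_morphism superseries_const.
Proof.
split=> // a b; apply/ffunP => S; rewrite superseries_mulE (bigD1 finset.set0) //=.
rewrite (big_pred1 S) => [|U]; last by rewrite finset.set0U.
rewrite xi_coef0l !ffunE eqxx mul1r big1 ?addr0; first by case: eqP; rewrite ?mulr0.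
by move=> T nT; apply: big1 => U _; rewrite ffunE (negbTE nT) mul0r mulr0.
Qed.
HB.instance Definition _ := GRing.isZmodMorphism.Build B superseries
  superseries_const superseries_const_zmod.
HB.instance Definition _ := GRing.isMonoidMorphism.Build B superseries
  superseries_const superseries_const_monoid.

Definition superseries_salg : {rmorphism K -> superseries} :=
  superseries_const \o @pseries_const K r.

Definition superseries_hpart (b : bool) : set superseries :=
  [set f | forall S, f S != 0 -> odd #|S| = b].

Fact superseries_hpart_salg k : superseries_hpart false (superseries_salg k).
Proof. move=> S; rewrite ffunE; have [->|_] := eqVneq S finset.set0; last by rewrite eqxx.
by rewrite cards0. Qed.
Fact superseries_hpart0 b : superseries_hpart b 0.
Proof. by move=> S; rewrite ffunE eqxx. Qed.
Fact superseries_hpartD b f g : superseries_hpart b f ->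
  superseries_hpart b g -> superseries_hpart b (f + g).
Proof.
move=> hf hg S; rewrite ffunE; have [->|/hf //] := eqVneq (f S) 0.
by rewrite add0r => /hg.
Qed.
Fact superseries_hpartM b c f g : superseries_hpart b f ->
  superseries_hpart c g -> superseries_hpart (b (+) c) (f * g).
Proof.
move=> hf hg S; rewrite ffunE; apply: contraNeq => hS; apply/eqP/big1.
move=> [T U] /= /eqP eS; rewrite /xi_coef; case: ifP => dTU; last by rewrite mul0r.
have [->|/hf hT] := eqVneq (f T) 0; first by rewrite mul0r mulr0.
have [->|/hg hU] := eqVneq (g U) 0; first by rewrite !mulr0.
case/eqP: hS; rewrite -eS -hT -hU cardsU.
by move: dTU; rewrite -finset.setI_eq0 => /eqP->; rewrite cards0 subn0 oddD.
Qed.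
Fact superseries_hpart_decomp f : exists f0 f1,
  [/\ superseries_hpart false f0, superseries_hpart true f1 & f = f0 + f1].
Proof.
exists [ffun S : mon => if odd #|S| then 0 else f S].
exists [ffun S : mon => if odd #|S| then f S else 0].
split.
- by move=> S; rewrite ffunE; case: (odd _); rewrite ?eqxx.
- by move=> S; rewrite ffunE; case: (odd _); rewrite ?eqxx.
- by apply/ffunP => S; rewrite !ffunE; case: (odd _); rewrite ?add0r ?addr0.
Qed.
Fact superseries_hpart_direct f :
  superseries_hpart false f -> superseries_hpart true f -> f = 0.
Proof.
move=> h0 h1; apply/ffunP => S; rewrite ffunE; apply/eqP; apply: contraT => nz.
by have := h0 S nz; rewrite (h1 S nz).
Qed.
Fact superseries_super_comm b c f g : superseries_hpart b f ->
  superseries_hpart c g -> f * g = (-1) ^+ (b && c) * (g * f).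
Proof.
move=> hf hg; have -> : (-1) ^+ (b && c) * (g * f) = (g * f) *~ (-1) ^+ (b && c).
  by case: (b && c); rewrite ?expr1 ?expr0 ?mulN1r ?mul1r ?mulrN1z ?mulr1z.
have mulzE (x : superseries) (e : bool) S :
    (x *~ (-1) ^+ e) S = (-1) ^+ e * x S.
  by case: e; rewrite ?expr1 ?expr0 ?mulN1r ?mul1r ?mulrN1z ?mulr1z ?ffunE.
apply/ffunP => S; rewrite mulzE !superseries_mulE.
rewrite [in RHS](exchange_big_dep xpredT) //= mulr_sumr.
apply: eq_bigr => T _; rewrite mulr_sumr.
apply: eq_big => [U|U _]; first by rewrite finset.setUC.
have [->|/hf hT] := eqVneq (f T) 0; first by rewrite mul0r !mulr0.
have [->|/hg hU] := eqVneq (g U) 0; first by rewrite mul0r !mulr0.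
rewrite xi_coef_sym -signr_odd oddM hT hU -!mulrA; congr (_ * (_ * _)).
exact: mulrC.
Qed.

HB.instance Definition _ := isSuperAlgebra.Build K superseries
  superseries_hpart_salg superseries_hpart0 superseries_hpartD
  superseries_hpartM superseries_hpart_decomp superseries_hpart_direct
  superseries_super_comm.

End SuperSeries.

Section Supervariety.
Variable K : fieldType.

Definition zero_locus (n : nat) (s : seq {mpoly K[n]}) : set ('I_n -> K) :=
  [set v | forall q, q \in s -> q.@[v] = 0].

(* B is isomorphic to K[t_1, ..., t_n] / I(V) for some algebraic subset V of
   K^n; V need not be irreducible. *)
Definition is_coordinate_ring (B : superAlgType K) : Prop :=
  exists n (s : seq {mpoly K[n]}) (phi : {rmorphism {mpoly K[n]} -> B}),
    [/\ forall c, phi c%:MP = salg B c,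
        forall b, exists q, phi q = b &
        forall q, phi q = 0 <-> (forall v, zero_locus s v -> q.@[v] = 0)].

Definition odd_part_finite (A : superAlgType K) : Prop :=
  exists n (g : 'I_n -> A), (forall i, odd_part (g i)) /\
    forall y, odd_part y -> exists c : 'I_n -> A,
      (forall i, even_part (c i)) /\ y = \sum_(i < n) c i * g i.

(* A supervariety is represented by its superalgebra A of global functions;
   its points are the elements of [spec A]. *)
Definition affine_supervariety (A : superAlgType K) : Prop :=
  is_coordinate_ring (squot (odd_ideal A)) /\ odd_part_finite A.

Definition smooth_point (A : superAlgType K) (P : spec A) : Prop :=
  exists r s, superIso (completion (@stalk_max K A P)) (superseries K r s).

Definition smooth (A : superAlgType K) : Prop :=
  forall P : spec A, closed_point P -> smooth_point P.

(* A group structure on the functor of points T |-> Hom(A, T). *)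
Record group_functor (A : superAlgType K) := GroupFunctor {
  pt_mul : forall T, superHom A T -> superHom A T -> superHom A T;
  pt_one : forall T, superHom A T;
  pt_inv : forall T, superHom A T -> superHom A T;
  pt_mulA : forall T, associative (@pt_mul T);
  pt_mul1 : forall T, left_id (pt_one T) (@pt_mul T);
  pt_mulV : forall T, left_inverse (pt_one T) (@pt_inv T) (@pt_mul T);
  pt_natural : forall T T' (h : superHom T T') (x y : superHom A T),
    superHom_comp h (pt_mul x y) =
    pt_mul (superHom_comp h x) (superHom_comp h y) }.

Record affineSupergroup := AffineSupergroup {
  coord_alg :> superAlgType K;
  coord_algP : affine_supervariety coord_alg;
  coord_group : group_functor coord_alg }.

End Supervariety.

(* Main.v *)
From HB Require Import structures.
Require Import Defs.
From mathcomp Require Import all_boot all_order all_algebra reals complex.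
From mathcomp Require Import boolp classical_sets mpoly.

(** The proof is Cartier's theorem on group schemes in characteristic zero, in
    the super setting: invariant vector fields force the associated graded ring
    at a point to be a free supercommutative algebra.

    Let A be the algebra of functions and P a closed point.  Since the complex
    field is algebraically closed and uncountable, a short form of the
    Nullstellensatz ([nullstellensatz]) shows that P is the even part of the
    kernel M of some point g of the group over the base field
    ([closed_point_hom]).  The space M / M^2 is finite dimensional, because A
    is generated by finitely many elements, and it has a basis of even elements
    x_1, ..., x_r and odd elements xi_1, ..., xi_s ([cotangent_basis]).
    Monomials in the x_i and xi_j then span the stalk modulo every power of its
    maximal ideal ([tspan_all]), so the map sending a power series to its
    values is onto the completion ([series_eval_surj]).

    The group structure gives injectivity.  The coordinate functions of
    M / M^2 are tangent vectors at g, that is, points over the dual numbers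
    that specialize to g, the new variable being even or odd.  Translating by
    the group law extends each of them to an invariant superderivation D of A
    with g (D a) = v a ([sder_of_tangent]).  A derivation maps M^(n+1) to M^n,
    and up to higher order terms the ones just built differentiate monomials in
    the x_i and xi_j as partial derivatives do.  In characteristic zero suitable
    multiples of iterated derivations, evaluated at g, are therefore dual to the
    monomials of degree n and kill M^(n+1) ([dual_functional_exists]), and no
    nontrivial combination of monomials of degree less than n lies in M^n
    ([tsum_free]).  This passes to the stalk because the denominators are
    nonzero constants modulo M ([stalk_in_powP]). *)

Set Implicit Arguments.
Unset Strict Implicit.
Unset Printing Implicit Defensive.

Import Order.TTheory GRing.Theory Num.Theory.
Local Open Scope ring_scope.
Local Open Scope classical_set_scope.

(** * Homogeneous components and powers of an ideal *)

Section Components.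
Variables (K : fieldType) (A : superAlgType K).
Implicit Types (x y : A) (b p : bool).

Lemma salgC k x : salg A k * x = x * salg A k.
Proof. by apply: evenC; apply: hpart_salg. Qed.

Lemma salgCA k x y : x * (salg A k * y) = salg A k * (x * y).
Proof. by apply: evenCA; apply: hpart_salg. Qed.

Lemma hpartZ b k x : hpart b x -> hpart b (salg A k * x).
Proof. by apply: hpartMe; apply: hpart_salg. Qed.

Lemma hpart_sum I (r : seq I) (P : pred I) (F : I -> A) b :
  (forall i, P i -> hpart b (F i)) -> hpart b (\sum_(i <- r | P i) F i).
Proof.
by move=> h; elim/big_rec: _ => [|i x Pi hx]; [apply: hpart0|apply: hpartD; auto].
Qed.

Fact hcomp_exists x : exists w : A * A,
  [/\ even_part w.1, odd_part w.2 & x = w.1 + w.2].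
Proof. by have [x0 [x1 h]] := hpart_decomp x; exists (x0, x1). Qed.

Definition hcomp b x : A :=
  let w := sval (cid (hcomp_exists x)) in if b then w.2 else w.1.

Lemma hcomp_hpart b x : hpart b (hcomp b x).
Proof. by rewrite /hcomp; case: cid => w [] /=; case: b. Qed.

Lemma hcompE x : x = hcomp false x + hcomp true x.
Proof. by rewrite /hcomp; case: cid => w []. Qed.

Lemma hcomp_uniq x x0 x1 : even_part x0 -> odd_part x1 -> x = x0 + x1 ->
  hcomp false x = x0 /\ hcomp true x = x1.
Proof.
move=> h0 h1 e; apply: hpart_uniq => //; try exact: hcomp_hpart.
by rewrite -hcompE.
Qed.

Lemma hcomp_hom b c x : hpart b x -> hcomp c x = if b == c then x else 0.
Proof.
case: b => hx.
  have [e0 e1] := hcomp_uniq (hpart0 _) hx (esym (add0r x)).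
  by case: c; rewrite ?e0 ?e1.
have [e0 e1] := hcomp_uniq hx (hpart0 _) (esym (addr0 x)).
by case: c; rewrite ?e0 ?e1.
Qed.

Lemma hcomp_sum2 x y : x + y =
  (hcomp false x + hcomp false y) + (hcomp true x + hcomp true y).
Proof. by rewrite addrACA -!hcompE. Qed.

Lemma hcompD b x y : hcomp b (x + y) = hcomp b x + hcomp b y.
Proof.
have [e0 e1] : hcomp false (x + y) = hcomp false x + hcomp false y /\
    hcomp true (x + y) = hcomp true x + hcomp true y.
  by apply: hcomp_uniq (hcomp_sum2 x y); apply: hpartD; apply: hcomp_hpart.
by case: b.
Qed.

Lemma hcompN b x : hcomp b (- x) = - hcomp b x.
Proof.
by apply/eqP; rewrite -addr_eq0 -hcompD addNr (hcomp_hom _ (hpart0 false)) if_same.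
Qed.

Lemma hcompB b x y : hcomp b (x - y) = hcomp b x - hcomp b y.
Proof. by rewrite hcompD hcompN. Qed.

Lemma hcompM x y :
  hcomp false (x * y) = hcomp false x * hcomp false y + hcomp true x * hcomp true y /\
  hcomp true (x * y) = hcomp false x * hcomp true y + hcomp true x * hcomp false y.
Proof.
apply: hcomp_uniq.
- by apply: hpartD; [apply: (hpartM (b := false) (c := false))|
    apply: (hpartM (b := true) (c := true))]; apply: hcomp_hpart.
- by apply: hpartD; [apply: (hpartM (b := false) (c := true))|
    apply: (hpartM (b := true) (c := false))]; apply: hcomp_hpart.
- rewrite {1}(hcompE x) {1}(hcompE y) mulrDl !mulrDr.
  by rewrite [hcomp true x * hcomp false y + _]addrC addrACA.
Qed.

(** The parity automorphism for [p = true], the identity for [p = false]: the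
    sign that appears when an element of parity [p] moves past [x]. *)
Definition psign p x : A := hcomp false x + (-1) ^+ p * hcomp true x.

Lemma psignD p x y : psign p (x + y) = psign p x + psign p y.
Proof. by rewrite /psign !hcompD mulrDr addrACA. Qed.

Lemma psign_hom p b x : hpart b x -> psign p x = (-1) ^+ (p && b) * x.
Proof.
move=> hx; rewrite /psign !(hcomp_hom _ hx).
by case: b hx => hx /=; rewrite ?andbT ?andbF ?add0r // mulr0 addr0 mul1r.
Qed.

Lemma psign0 x : psign false x = x.
Proof. by rewrite /psign mul1r -hcompE. Qed.

Lemma psign_hpart p b x : hpart b x -> hpart b (psign p x).
Proof.
move=> hx; rewrite (psign_hom _ hx).
by case: (_ && _); rewrite ?mulN1r ?mul1r //; apply: hpartN.
Qed.

Lemma psignM p x y : psign p (x * y) = psign p x * psign p y.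
Proof.
case: p; last by rewrite !psign0.
have [e0 e1] := hcompM x y.
rewrite /psign e0 e1 !mulN1r mulrDl !mulrDr !mulNr !mulrN opprK opprD.
by rewrite -!addrA; congr (_ + _); rewrite addrC -!addrA.
Qed.

End Components.

Section IdealPowers.
Variables (K : fieldType) (A : superAlgType K).

Lemma sidealB (J : sideal A) x y : J x -> J y -> J (x - y).
Proof. by move=> Jx Jy; apply: sidealD => //; apply: sidealN. Qed.

Lemma sideal_comp (J : sideal A) b x : J x -> J (hcomp b x).
Proof.
move=> Jx; rewrite (hcompE x) in Jx.
by have [] := sideal_hpart (hcomp_hpart _ _) (hcomp_hpart _ _) Jx; case: b.
Qed.

Lemma sideal_psign (J : sideal A) p x : J x -> J (psign p x).
Proof.
by move=> Jx; apply: sidealD; [|apply: sidealMl]; apply: sideal_comp.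
Qed.

Lemma sideal_sum (J : sideal A) I (r : seq I) (P : pred I) (F : I -> A) :
  (forall i, P i -> J (F i)) -> J (\sum_(i <- r | P i) F i).
Proof.
by move=> h; elim/big_rec: _ => [|i x Pi hx]; [apply: sideal0|apply: sidealD; auto].
Qed.

Variable M : sideal A.
Local Notation "M ^^ n" := (sideal_pow M n) (at level 30).

Lemma sideal_pow0 x : (M ^^ 0) x.
Proof.
rewrite -[x]mulr1; apply: sidealMl; apply: sub_sideal_gen.
by exists (fun=> 0); split=> [i|]; rewrite ?big_ord0 //; apply: sideal0.
Qed.

Fact sideal_pow_mul_sideal n x : M x -> (M ^^ n `<=` [set b | (M ^^ n.+1) (x * b)]).
Proof.
move=> Mx b hb; move: x Mx.
have hom (J : sideal A) (y0 y1 : A) : even_part y0 -> odd_part y1 ->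
    (forall x, M x -> J (x * (y0 + y1))) ->
    (forall x, M x -> J (x * y0)) /\ (forall x, M x -> J (x * y1)).
  move=> h0 h1 h.
  have hc c x : M x -> J (hcomp c x * y0) /\ J (hcomp c x * y1).
    move=> Mx; have := h _ (sideal_comp c Mx); rewrite mulrDr => hJ.
    case: c hJ => hJ.
      rewrite addrC in hJ.
      by have [] := sideal_hpart (hpartM (hcomp_hpart true x) h1)
        (hpartM (hcomp_hpart true x) h0) hJ.
    by have [] := sideal_hpart (hpartM (hcomp_hpart false x) h0)
        (hpartM (hcomp_hpart false x) h1) hJ.
  by split=> x Mx; rewrite (hcompE x) mulrDl; apply: sidealD;
    case: (hc false x Mx); case: (hc true x Mx).
pose S b := forall x, M x -> (M ^^ n.+1) (x * b).
have S0 : S 0 by move=> x _; rewrite mulr0; apply: sideal0.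
have SD x y : S x -> S y -> S (x + y).
  by move=> hx hy z Mz; rewrite mulrDr; apply: sidealD; auto.
have Sl a x : S x -> S (a * x).
  by move=> hx z Mz; rewrite mulrA; apply: hx; apply: sidealMr.
have Sr a x : S x -> S (x * a).
  by move=> hx z Mz; rewrite mulrA; apply: sidealMr; apply: hx.
apply: (hb (SIdeal S0 SD Sl Sr (hom _))) => _ [f [Mf ->]] x Mx.
apply: sub_sideal_gen; exists (fun i => if unlift ord0 i is Some j then f j else x).
split=> [i|]; first by case: unliftP.
by rewrite big_ord_recl unlift_none; congr (_ * _); apply: eq_bigr => i _; rewrite liftK.
Qed.

Lemma sideal_powM1 n x b : M x -> (M ^^ n) b -> (M ^^ n.+1) (x * b).
Proof. by move=> Mx; apply: sideal_pow_mul_sideal. Qed.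

(** [sideal_pow] is an intersection of ideals; this gives back the usual
    description of M^(n+1) as the additive span of the products M * M^n, by
    checking that this span is already a homogeneous ideal. *)
Lemma sideal_powS_ind n (P : A -> Prop) :
  P 0 -> (forall x y, P x -> P y -> P (x + y)) ->
  (forall x b, M x -> (M ^^ n) b -> P (x * b)) ->
  forall w, (M ^^ n.+1) w -> P w.
Proof.
pose S w := forall P : A -> Prop, P 0 -> (forall x y, P x -> P y -> P (x + y)) ->
  (forall x b, M x -> (M ^^ n) b -> P (x * b)) -> P w.
have S0 : S 0 by [].
have SD x y : S x -> S y -> S (x + y).
  by move=> hx hy Q h0 hD hM; apply: (hD); [apply: hx|apply: hy].
have Sl a x : S x -> S (a * x).
  move=> hx Q h0 hD hM; apply: (hx (fun x => Q (a * x))).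
  - by rewrite mulr0.
  - by move=> y z Qy Qz; rewrite mulrDr; apply: hD.
  - by move=> y b My hb; rewrite mulrA; apply: hM => //; apply: sidealMl.
have Sr a x : S x -> S (x * a).
  move=> hx Q h0 hD hM; apply: (hx (fun x => Q (x * a))).
  - by rewrite mul0r.
  - by move=> y z Qy Qz; rewrite mulrDl; apply: hD.
  - by move=> y b My hb; rewrite -mulrA; apply: hM => //; apply: sidealMr.
have Sc w : S w -> S (hcomp false w) /\ S (hcomp true w).
  move=> hw; apply: (hw (fun w => S (hcomp false w) /\ S (hcomp true w))).
  - by rewrite !(hcomp_hom _ (hpart0 false)).
  - by move=> x y [? ?] [? ?]; rewrite !hcompD; split; apply: SD.
  move=> x b Mx hb; have [-> ->] := hcompM x b.
  split=> Q h0 hD hM; apply: (hD); apply: (hM); exact: sideal_comp.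
have Sh (x0 x1 : A) : even_part x0 -> odd_part x1 -> S (x0 + x1) -> S x0 /\ S x1.
  by move=> h0 h1 /Sc; have [-> ->] := hcomp_uniq h0 h1 erefl.
move=> P0 PD PM w hw.
apply: (hw (SIdeal S0 SD Sl Sr Sh)) => // _ [f [Mf ->]] Q h0 hD hM.
rewrite big_ord_recl; apply: hM => //; apply: sub_sideal_gen.
by exists (fun i => f (lift ord0 i)).
Qed.

Lemma sideal_powM i j x y : (M ^^ i) x -> (M ^^ j) y -> (M ^^ (i + j)) (x * y).
Proof.
move=> hx hy; elim: i x hx => [|i IH] x hx; first exact: sidealMl.
move: x hx; apply: sideal_powS_ind.
- by rewrite mul0r; apply: sideal0.
- by move=> x z hx hz; rewrite mulrDl; apply: sidealD.
- by move=> x b Mx hb; rewrite -mulrA addSn; apply: sideal_powM1 => //; apply: IH.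
Qed.

Lemma sideal_pow1 x : (M ^^ 1) x <-> M x.
Proof.
split=> [|Mx]; last by rewrite -[x]mulr1; apply: sideal_powM1 => //; apply: sideal_pow0.
move: x; apply: sideal_powS_ind; first exact: sideal0.
- by move=> x y; apply: sidealD.
- by move=> x b Mx _; apply: sidealMr.
Qed.

Lemma sideal_powMr n x b : (M ^^ n) b -> M x -> (M ^^ n.+1) (b * x).
Proof. by move=> hb Mx; rewrite -addn1; apply: sideal_powM => //; apply/sideal_pow1. Qed.

Lemma sideal_pow2 x y : M x -> M y -> (M ^^ 2) (x * y).
Proof. by move=> Mx My; apply: sideal_powM1 => //; apply/sideal_pow1. Qed.

End IdealPowers.

(** * The Nullstellensatz over an uncountable algebraically closed field *)

Section Uncountable.

(** The consequence of uncountability that makes the Nullstellensatz easy. *)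
Definition has_infinite_fibre (T : eqType) : Prop := forall f : T -> nat,
  exists d, forall N, exists s : seq T,
    [/\ uniq s, size s = N & forall c, c \in s -> f c = d].

Variable R : realType.

Lemma itv_avoid (s : seq R) (a b : R) : a < b -> exists w : R * R,
  [/\ a <= w.1, w.1 < w.2, w.2 <= b & forall x, x \in s -> ~~ (w.1 <= x <= w.2)].
Proof.
move=> ab; elim: s => [|x s [[a' b'] /= [aa' ab' bb' h]]].
  by exists (a, b); split=> //=; rewrite lexx.
pose m := (a' + b') / 2; have [am mb] := midf_lt ab'.
have [xm|mx] := leP x m.
  have [mm mb2] := midf_lt mb; exists ((m + b') / 2, b'); split=> //=.
    by apply: le_trans aa' _; apply: ltW; apply: lt_trans am mm.
  move=> y; rewrite inE => /predU1P[->|/h].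
    by rewrite negb_and -ltNge (le_lt_trans xm mm).
  apply: contraNN => /andP[h1 ->]; rewrite andbT; apply: le_trans h1.
  by apply: ltW; apply: lt_trans am mm.
exists (a', m); split=> //=; first by apply: le_trans bb'; apply: ltW.
move=> y; rewrite inE => /predU1P[->|/h].
  by rewrite negb_and -!ltNge mx orbT.
apply: contraNN => /andP[-> h1] /=; apply: le_trans h1 _.
exact: ltW.
Qed.

(** Nested intervals: the n-th one avoids the finite fibre over n, and the
    point common to all of them lies in no fibre at all. *)
Lemma real_not_countable (f : R -> nat) (s : nat -> seq R) :
  ~ (forall x, x \in s (f x)).
Proof.
move=> hs.
have step (w : R * R) n : exists w' : R * R, w.1 < w.2 ->
    [/\ w.1 <= w'.1, w'.1 < w'.2, w'.2 <= w.2 &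
        forall x, x \in s n -> ~~ (w'.1 <= x <= w'.2)].
  have [lt|nlt] := boolP (w.1 < w.2); last by exists w.
  by have [w' hw'] := itv_avoid (s n) lt; exists w'.
pose g w n := sval (cid (step w n)); pose I := fix I n :=
  if n is n'.+1 then g (I n') n' else (0, 1).
have Ilt n : (I n).1 < (I n).2.
  by elim: n => [|n IH] /=; [apply: ltr01|rewrite /g; case: cid => w /= /(_ IH)[]].
have Istep n : [/\ (I n).1 <= (I n.+1).1, (I n.+1).2 <= (I n).2 &
    forall x, x \in s n -> ~~ ((I n.+1).1 <= x <= (I n.+1).2)].
  by rewrite /= /g; case: cid => w /= /(_ (Ilt n))[].
have Imono n k : (I n).1 <= (I (n + k)%N).1 /\ (I (n + k)%N).2 <= (I n).2.
  elim: k => [|k [h1 h2]]; first by rewrite addn0.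
  rewrite addnS; have [h3 h4 _] := Istep (n + k)%N.
  by split; [apply: le_trans h3|apply: le_trans h2].
have cross n k : (I n).1 <= (I k).2.
  have [h1 _] := Imono n k; have [_ h2] := Imono k n; rewrite addnC in h2.
  exact: le_trans h1 (le_trans (ltW (Ilt _)) h2).
pose E : set R := [set x | exists n, x = (I n).1].
have E0 : E !=set0 by exists (I 0%N).1, 0%N.
have Eub k : ubound E (I k).2 by move=> _ [n ->].
have hsup : has_sup E by split=> //; exists (I 0%N).2.
pose c := sup E; have [_ _ /(_ c (hs c))/negP[]] := Istep (f c).
apply/andP; split; last exact: ge_sup.
by apply: sup_upper_bound => //; exists (f c).+1.
Qed.

Lemma real_has_infinite_fibre : has_infinite_fibre R.
Proof.
move=> f; apply: contrapT => hn.
have fin d : exists s : seq R, forall x, f x = d -> x \in s.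
  apply: contrapT => inf; apply: hn; exists d; elim=> [|N [s [us ss hs]]].
    by exists [::]; split.
  have [x fx xs] : exists2 x, f x = d & x \notin s.
    apply: contrapT => nx; apply: inf; exists s => x fx.
    by apply: contrapT => /negP xs; apply: nx; exists x.
  exists (x :: s); split=> /=; [by rewrite xs|by rewrite ss|].
  by move=> c; rewrite inE => /predU1P[->|/hs].
pose s d := sval (cid (fin d)).
apply: (@real_not_countable f s) => x; rewrite /s; case: cid => /= t; exact.
Qed.

Lemma complex_has_infinite_fibre : has_infinite_fibre R[i].
Proof.
move=> f; have [d hd] := real_has_infinite_fibre (f \o real_complex R).
exists d => N; have [s [us ss hs]] := hd N.
exists (map (real_complex R) s); split; last 2 first.
- by rewrite size_map.
- by move=> _ /mapP[x xs ->]; apply: hs.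
by rewrite map_inj_uniq // => x y [].
Qed.

End Uncountable.

Section Nullstellensatz.
Variables (K : closedFieldType) (n : nat) (m : {mpoly K[n]} -> Prop).
Hypothesis uncount : has_infinite_fibre K.
Hypothesis mD : forall p q, m p -> m q -> m (p + q).
Hypothesis mM : forall a q, m q -> m (a * q).
Hypothesis m1 : ~ m 1.
Hypothesis m_prime : forall p q, m (p * q) -> m p \/ m q.
Hypothesis m_inv : forall q, ~ m q -> exists h, m (h * q - 1).

Lemma mpoly_dependent d (h : 'I_(#|{: 'X_{1..n < d}}|).+1 -> {mpoly K[n]}) :
  (forall i, (msize (h i) <= d)%N) ->
  exists2 l : 'I_(#|{: 'X_{1..n < d}}|).+1 -> K, exists i, l i != 0 &
    \sum_i l i *: h i = 0.
Proof.
move=> hd; set N := #|_|; rewrite -/N in h hd *.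
pose W : 'M[K]_(N.+1, N) := \matrix_(i, j) (h i)@_(enum_val j : 'X_{1..n < d}).
have : kermx W != 0.
  rewrite -mxrank_eq0 mxrank_ker subn_eq0 -ltnNge ltnS.
  exact: rank_leq_col.
case/rowV0Pn => l /sub_kermxP lW l0; exists (l 0).
  apply: contrapT => nl; case/eqP: l0; apply/rowP => i; rewrite mxE.
  by apply: contrapT => li; apply: nl; exists i; apply/eqP.
apply/mpolyP => u; rewrite mcoeff0 raddf_sum /=.
have [ud|du] := ltnP (mdeg u) d; last first.
  apply: big1 => i _; rewrite mcoeffZ; apply/eqP; rewrite mulf_eq0; apply/orP; right.
  apply/eqP/memN_msupp_eq0; apply: contraTN du => us; rewrite -ltnNge.
  exact: leq_trans (msize_mdeg_lt us) (hd i).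
have := congr1 (fun v : 'rV_N => v 0 (enum_rank (BMultinom ud))) lW.
rewrite !mxE => e; rewrite -[RHS]e; apply: eq_bigr => i _.
by rewrite mcoeffZ !mxE enum_rankK.
Qed.

(** If no [q - c] were in the maximal ideal, all of them would be invertible
    modulo it; the inverses would have bounded degree for infinitely many c, so
    would be linearly dependent, and clearing denominators would give a nonzero
    univariate polynomial vanishing at q.  It splits into linear factors, one of
    which must be in the ideal. *)
Lemma nullstellensatz q : exists c, m (q - c%:MP).
Proof.
apply: contrapT => nq.
have inv c : exists h, m (h * (q - c%:MP) - 1).
  by apply: m_inv => mc; apply: nq; exists c.
pose h c := sval (cid (inv c)).
have hP c : m (h c * (q - c%:MP) - 1) by rewrite /h; case: cid.
have [d /(_ (#|{: 'X_{1..n < d}}|).+1)[s [us ss hs]]] := uncount (fun c => msize (h c)).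
set N := (#|_|).+1 in ss.
have hd (i : 'I_N) : (msize (h (s`_i)%R) <= d)%N by rewrite hs // mem_nth ?ss.
have [l [i0 li0] hl] := mpoly_dependent hd.
pose r : {poly K} := \sum_(i < N) l i *: \prod_(j < N | j != i) ('X - (s`_j)%:P).
pose ev : {rmorphism {poly K} -> {mpoly K[n]}} :=
  horner_eval q \o map_poly (@mpolyC n K).
have evC c : ev c%:P = c%:MP by rewrite /= /horner_eval map_polyC hornerC.
have evX c : ev ('X - c%:P) = q - c%:MP.
  by rewrite rmorphB evC /= /horner_eval map_polyX hornerX.
have m0 : m 0 by have := mM 0 (hP 0); rewrite mul0r.
have mr : m (ev r).
  rewrite -[ev r]subr0 -(mul0r (\prod_(j < N) (q - (s`_j)%:MP))) -hl.
  rewrite mulr_suml rmorph_sum -sumrB.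
  elim/big_ind: _ => [//|p1 p2|i _]; first exact: mD.
  rewrite -mul_polyC rmorphM evC mul_mpolyC -scalerAl -scalerBr -mul_mpolyC.
  apply: mM; rewrite rmorph_prod (eq_bigr (fun j : 'I_N => q - (s`_j)%:MP)).
    rewrite [X in _ * X](bigD1 i) //= mulrA -{1}[\prod_(_ < _ | _) _]mul1r -mulrBl mulrC.
    by apply: mM; rewrite -opprB -mulN1r; apply: mM.
  by move=> j _; apply: evX.
have r0 : r != 0.
  apply: contra_neq li0 => r0; have /eqP := congr1 (fun p => p.[s`_i0]) r0.
  rewrite horner0 horner_sum (bigD1 i0) //= [X in _ + X == _]big1 => [|i ni]; last first.
    rewrite hornerZ horner_prod (bigD1 i0) 1?eq_sym //=.
    by rewrite hornerXsubC subrr mul0r mulr0.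
  rewrite addr0 hornerZ mulf_eq0 => /orP[/eqP//|].
  rewrite horner_prod prodf_seq_eq0 => /hasP[j _ /andP[nj]].
  rewrite hornerXsubC subr_eq0 nth_uniq ?ss // => /eqP/val_inj e.
  by rewrite e eqxx in nj.
have [z rz] := closed_field_poly_normal r.
have : m (ev (\prod_(x <- z) ('X - x%:P))).
  have := mM (lead_coef r)^-1%:MP mr; rewrite [X in ev X]rz -mul_polyC rmorphM evC mulrA.
  by rewrite -mpolyCM mulVf ?lead_coef_eq0 // mpolyC1 mul1r.
elim: z {rz} => [|x z IH]; first by rewrite big_nil rmorph1.
rewrite big_cons rmorphM => /m_prime[|//]; rewrite evX => mx.
by apply: nq; exists x.
Qed.

End Nullstellensatz.

(** * Dual numbers and invariant derivations *)

Section BaseField.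
Variable K : fieldType.

Definition base_alg : Type := K.
HB.instance Definition _ := GRing.PzRing.copy base_alg K.

Definition base_hpart (b : bool) : set base_alg := [set x | b -> x = 0].

Definition base_salg : {rmorphism K -> base_alg} := idfun.

Fact base_hpart_salg k : base_hpart false (base_salg k). Proof. by []. Qed.
Fact base_hpart0 b : base_hpart b 0. Proof. by []. Qed.
Fact base_hpartD b x y : base_hpart b x -> base_hpart b y -> base_hpart b (x + y).
Proof. by move=> hx hy bT; rewrite hx // hy // addr0. Qed.
Fact base_hpartM b c x y :
  base_hpart b x -> base_hpart c y -> base_hpart (b (+) c) (x * y).
Proof.
by case: b => hx; case: c => hy //= _; rewrite ?(hx isT) ?(hy isT) ?mul0r ?mulr0.
Qed.
Fact base_hpart_decomp x : exists x0 x1,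
  [/\ base_hpart false x0, base_hpart true x1 & x = x0 + x1].
Proof. by exists x, 0; split=> //; rewrite addr0. Qed.
Fact base_hpart_direct x : base_hpart false x -> base_hpart true x -> x = 0.
Proof. by move=> _; exact. Qed.
Fact base_super_comm b c x y : base_hpart b x -> base_hpart c y ->
  x * y = (-1) ^+ (b && c) * (y * x).
Proof.
case: b => hx; case: c => hy; rewrite ?(hx isT) ?(hy isT) ?mul0r ?mulr0 ?mulr0 //.
rewrite mul1r; exact: (@mulrC K).
Qed.
HB.instance Definition _ := isSuperAlgebra.Build K base_alg
  base_hpart_salg base_hpart0 base_hpartD base_hpartM base_hpart_decomp
  base_hpart_direct base_super_comm.

Lemma psign_base p (x : base_alg) : psign p x = x.
Proof. by rewrite (@psign_hom _ _ p false) // andbF mul1r. Qed.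

Variable A : superAlgType K.

Definition salg_hom : superHom base_alg A.
Proof.
exists (salg A : {rmorphism base_alg -> A}) => // [[]] x hx /=; last exact: hpart_salg.
by rewrite (hx isT) rmorph0; apply: hpart0.
Defined.

End BaseField.

(** A[eps] with eps of parity [p] and eps^2 = 0; the pair (a, b) is a + b eps.
    The pairs are the same for both parities while the product and the grading
    differ, so the parity is made part of the type for the instances to be found. *)
Definition dual (K : fieldType) (p : bool) (A : superAlgType K) : Type := (A * A)%type.

Section DualNumbers.
Variables (K : fieldType) (p : bool) (A : superAlgType K).
Local Notation dual := (dual p A).

HB.instance Definition _ := GRing.Zmodule.copy dual (A * A)%type.
Implicit Types u v w : dual.

Definition dual_mul u v : dual := (u.1 * v.1, u.1 * v.2 + u.2 * psign p v.1).
Definition dual_in (a : A) : dual := (a, 0).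

Fact psignE1 : psign p (1 : A) = 1.
Proof. by rewrite (psign_hom _ (hpart1 A)) andbF mul1r. Qed.

Fact dual_mulA : associative dual_mul.
Proof.
move=> u v w; congr (_, _) => /=; first by rewrite mulrA.
by rewrite psignM mulrDr [in RHS]mulrDl !mulrA addrA.
Qed.
Fact dual_mul1l : left_id (dual_in 1) dual_mul.
Proof. by case=> a b; rewrite /dual_mul /= !mul1r mul0r addr0. Qed.
Fact dual_mul1r : right_id (dual_in 1) dual_mul.
Proof. by case=> a b; rewrite /dual_mul /= !mulr1 mulr0 psignE1 mulr1 add0r. Qed.
Fact dual_mulDl : left_distributive dual_mul +%R.
Proof.
by case=> a b [c d] [e f]; congr (_, _); rewrite /= !mulrDl // addrACA.
Qed.
Fact dual_mulDr : right_distributive dual_mul +%R.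
Proof.
by case=> a b [c d] [e f]; congr (_, _); rewrite /= ?psignD !mulrDr // addrACA.
Qed.

HB.instance Definition _ := GRing.Zmodule_isPzRing.Build dual
  dual_mulA dual_mul1l dual_mul1r dual_mulDl dual_mulDr.

Fact dual_in_zmod : zmod_morphism dual_in.
Proof. by move=> a b; congr (_, _); rewrite /= subr0. Qed.
Fact dual_in_monoid : monoid_morphism dual_in.
Proof. by split=> // a b; congr (_, _); rewrite /= mul0r mulr0 addr0. Qed.
HB.instance Definition _ := GRing.isZmodMorphism.Build A dual dual_in dual_in_zmod.
HB.instance Definition _ :=
  GRing.isMonoidMorphism.Build A dual dual_in dual_in_monoid.

Definition dual_salg : {rmorphism K -> dual} := dual_in \o salg A.
Definition dual_hpart (b : bool) : set dual :=
  [set u | hpart b u.1 /\ hpart (b (+) p) u.2].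

Fact dual_hpart_salg k : dual_hpart false (dual_salg k).
Proof. by split; [apply: hpart_salg|apply: hpart0]. Qed.
Fact dual_hpart0 b : dual_hpart b 0.
Proof. by split; apply: hpart0. Qed.
Fact dual_hpartD b u v : dual_hpart b u -> dual_hpart b v -> dual_hpart b (u + v).
Proof. by move=> [? ?] [? ?]; split; apply: hpartD. Qed.
Fact dual_hpartM b c u v :
  dual_hpart b u -> dual_hpart c v -> dual_hpart (b (+) c) (u * v).
Proof.
move=> [u1 u2] [v1 v2]; split; first exact: hpartM.
apply: hpartD; first by rewrite -addbA; apply: hpartM.
by rewrite addbAC; apply: hpartM => //; apply: psign_hpart.
Qed.
Fact dual_hpart_decomp u : exists u0 u1,
  [/\ dual_hpart false u0, dual_hpart true u1 & u = u0 + u1].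
Proof.
exists (hcomp false u.1, hcomp p u.2), (hcomp true u.1, hcomp (~~ p) u.2).
split; [by split; apply: hcomp_hpart|by split; apply: hcomp_hpart|].
case: u => a b; have e : b = hcomp p b + hcomp (~~ p) b.
  by rewrite {1}(hcompE b); case: (p) => //; rewrite addrC.
exact: (congr2 (@pair A A) (hcompE a) e).
Qed.
Fact dual_hpart_direct u : dual_hpart false u -> dual_hpart true u -> u = 0.
Proof.
case: u => a b [/= a0 b0] [/= a1 b1]; congr (_, _); first exact: hpart_direct.
by case: p b0 b1 => b0 b1; apply: hpart_direct.
Qed.
Fact dual_super_comm b c u v : dual_hpart b u -> dual_hpart c v ->
  u * v = (-1) ^+ (b && c) * (v * u).
Proof.
have sgn (e : bool) (w : dual) : (-1) ^+ e * w = ((-1) ^+ e * w.1, (-1) ^+ e * w.2).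
  by case: w => ? ?; case: e; rewrite ?expr1 ?expr0 ?mulN1r ?mul1r.
move=> [u1 u2] [v1 v2]; rewrite sgn; congr (_, _) => /=; first exact: super_comm.
rewrite (psign_hom p v1) (psign_hom p u1) mulrDr addrC.
have sgA (e : bool) (x y : A) : x * ((-1) ^+ e * y) = (-1) ^+ e * (x * y).
  by case: e; rewrite ?expr1 ?expr0 ?mulN1r ?mul1r // mulrN.
have sgS (e f : bool) (x : A) : (-1) ^+ e * ((-1) ^+ f * x) = (-1) ^+ (e (+) f) * x.
  by rewrite mulrA signr_addb.
rewrite [u.2 * _]sgA [v.2 * _]sgA; congr (_ + _).
  by rewrite (super_comm u2 v1) sgS; congr (_ ^+ nat_of_bool _ * _);
    case: (b); case: (c); case: (p).
by rewrite (super_comm u1 v2) sgS; congr (_ ^+ nat_of_bool _ * _);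
  case: (b); case: (c); case: (p).
Qed.

HB.instance Definition _ := isSuperAlgebra.Build K dual
  dual_hpart_salg dual_hpart0 dual_hpartD dual_hpartM dual_hpart_decomp
  dual_hpart_direct dual_super_comm.

Definition dual_fst (u : dual) : A := u.1.
Fact dual_fst_zmod : zmod_morphism dual_fst. Proof. by []. Qed.
Fact dual_fst_monoid : monoid_morphism dual_fst. Proof. by []. Qed.
HB.instance Definition _ := GRing.isZmodMorphism.Build dual A dual_fst dual_fst_zmod.
HB.instance Definition _ :=
  GRing.isMonoidMorphism.Build dual A dual_fst dual_fst_monoid.

Definition dual_fst_hom : superHom dual A.
Proof. by exists (dual_fst : {rmorphism dual -> A}) => // b u []. Defined.

Definition dual_in_hom : superHom A dual.
Proof.
exists (dual_in : {rmorphism A -> dual}) => // b a ha.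
by split=> //; apply: hpart0.
Defined.

End DualNumbers.
Arguments dual_fst_hom {K} p A.
Arguments dual_in_hom {K} p A.

Section DualMap.
Variables (K : fieldType) (p : bool) (A B : superAlgType K) (f : superHom A B).

Lemma hom_psign x : f (psign p x) = psign p (f x).
Proof.
have fc b : hcomp b (f x) = f (hcomp b x).
  have [e0 e1] : hcomp false (f x) = f (hcomp false x) /\
      hcomp true (f x) = f (hcomp true x).
    apply: hcomp_uniq; try by apply: superHom_hpart; apply: hcomp_hpart.
    by rewrite -rmorphD -hcompE.
  by case: b.
by rewrite /psign rmorphD rmorphM rmorph_sign !fc.
Qed.

Definition dual_map (u : dual p A) : dual p B := (f u.1, f u.2).
Fact dual_map_zmod : zmod_morphism dual_map.
Proof. by move=> u v; congr (_, _); rewrite /= rmorphB. Qed.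
Fact dual_map_monoid : monoid_morphism dual_map.
Proof.
split; first by congr (_, _); rewrite ?rmorph1 ?rmorph0.
by move=> u v; congr (_, _); rewrite /= ?rmorphD !rmorphM // hom_psign.
Qed.
HB.instance Definition _ :=
  GRing.isZmodMorphism.Build (dual p A) (dual p B) dual_map dual_map_zmod.
HB.instance Definition _ :=
  GRing.isMonoidMorphism.Build (dual p A) (dual p B) dual_map dual_map_monoid.

Definition dual_map_hom : superHom (dual p A) (dual p B).
Proof.
exists (dual_map : {rmorphism dual p A -> dual p B}).
- by move=> k; congr (_, _); rewrite /= ?superHom_salg ?rmorph0.
- by move=> b u [u1 u2]; split; apply: superHom_hpart.
Defined.

End DualMap.

Section GroupLaws.
Variables (K : fieldType) (A : superAlgType K) (G : group_functor A).
Variable T : superAlgType K.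
Implicit Types x y z : superHom A T.
Local Notation "x ** y" := (pt_mul G x y) (at level 40, left associativity).
Local Notation e := (pt_one G T).
Local Notation inv := (@pt_inv _ _ G T).

Lemma pt_idem x : x ** x = x -> x = e.
Proof.
by move=> h; rewrite -[LHS](pt_mul1 G) -(pt_mulV G x) -pt_mulA h.
Qed.

Lemma pt_mulVr x : x ** inv x = e.
Proof.
by apply: pt_idem; rewrite pt_mulA -[x ** _ ** x]pt_mulA pt_mulV -pt_mulA pt_mul1.
Qed.

Lemma pt_mul1r x : x ** e = x.
Proof. by rewrite -(pt_mulV G x) pt_mulA pt_mulVr pt_mul1. Qed.

End GroupLaws.

(** The unit is the only idempotent of a group and idempotents are preserved. *)
Lemma pt_one_natural (K : fieldType) (A : superAlgType K) (G : group_functor A)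
  (T T' : superAlgType K) (h : superHom T T') :
  superHom_comp h (pt_one G T) = pt_one G T'.
Proof. by apply: pt_idem; rewrite -pt_natural pt_mul1. Qed.

Section Derivations.
Variables (K : fieldType) (A : superAlgType K).

(** Superderivations act from the right: [D] passes over the second factor. *)
Record sder (p : bool) (D : A -> A) : Prop := SDer {
  sderD : forall x y, D (x + y) = D x + D y;
  sderM : forall x y, D (x * y) = x * D y + D x * psign p y;
  sder_salg : forall k, D (salg A k) = 0;
  sder_hpart : forall b x, hpart b x -> hpart (b (+) p) (D x) }.

Record tangent (p : bool) (g : superHom A (base_alg K)) (v : A -> K) : Prop :=
  Tangent {
  tangentD : forall x y, v (x + y) = v x + v y;
  tangentM : forall x y, v (x * y) = g x * v y + v x * g y;
  tangent_salg : forall k, v (salg A k) = 0;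
  tangent_hpart : forall b x, hpart b x -> b != p -> v x = 0 }.

Section Tangent.
Variables (p : bool) (g : superHom A (base_alg K)) (v : A -> K).
Hypothesis hv : tangent p g v.

Definition tangent_fun (a : A) : dual p (base_alg K) := (g a, v a).

Fact tangent_zmod : zmod_morphism tangent_fun.
Proof.
move=> a b; have vB : v (a - b) = v a - v b.
  by apply/eqP; rewrite eq_sym subr_eq -(tangentD hv) subrK.
exact: (congr2 (@pair K K) (rmorphB g a b) vB).
Qed.
Fact tangent_monoid : monoid_morphism tangent_fun.
Proof.
split; first by congr (_, _); rewrite ?rmorph1 // -(rmorph1 (salg A)) (tangent_salg hv).
by move=> a b; congr (_, _); rewrite /= ?rmorphM // psign_base (tangentM hv).
Qed.
HB.instance Definition _ := GRing.isZmodMorphism.Build A (dual p (base_alg K))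
  tangent_fun tangent_zmod.
HB.instance Definition _ := GRing.isMonoidMorphism.Build A (dual p (base_alg K))
  tangent_fun tangent_monoid.

Definition tangent_hom : superHom A (dual p (base_alg K)).
Proof.
exists (tangent_fun : {rmorphism A -> dual p (base_alg K)}).
- by move=> k; congr (_, _); rewrite ?superHom_salg // (tangent_salg hv).
- move=> b x hx; split; first exact: superHom_hpart.
  by move=> bp; apply: (tangent_hpart hv hx); move: bp; case: (b); case: (p).
Defined.

End Tangent.

(** Translation carries a tangent vector v at the point g to an invariant
    derivation: the A[eps]-point (v g^-1) id has constant term id because v
    has constant term g, and evaluating it at g gives v back. *)
Lemma sder_of_tangent (G : group_functor A) p g v :
  tangent p g v -> exists2 D, sder p D & forall a, g (D a) = v a.
Proof.
move=> hv; pose tau := tangent_hom hv.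
pose w := pt_mul G tau (superHom_comp (dual_in_hom p (base_alg K)) (pt_inv G g)).
pose idA := SuperHom (superHom_fun := idfun) (fun=> erefl) (fun _ _ h => h) : superHom A A.
pose phi := pt_mul G (superHom_comp (dual_map_hom p (salg_hom A)) w)
  (superHom_comp (dual_in_hom p A) idA).
have phi1 : superHom_comp (dual_fst_hom p A) phi = idA.
  rewrite pt_natural.
  have -> : superHom_comp (dual_fst_hom p A)
      (superHom_comp (dual_map_hom p (salg_hom A)) w) = pt_one G A.
    transitivity (superHom_comp (salg_hom A)
        (superHom_comp (dual_fst_hom p (base_alg K)) w)); first exact: superHomP.
    rewrite pt_natural; have -> : superHom_comp (dual_fst_hom p (base_alg K)) tau = g.
      exact: superHomP.
    have -> : superHom_comp (dual_fst_hom p (base_alg K)) (superHom_comp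
        (dual_in_hom p (base_alg K)) (pt_inv G g)) = pt_inv G g by exact: superHomP.
    by rewrite pt_mulVr pt_one_natural.
  by rewrite pt_mul1; apply: superHomP.
have phi2 : superHom_comp (dual_map_hom p g) phi = tau.
  rewrite pt_natural.
  have -> : superHom_comp (dual_map_hom p g)
      (superHom_comp (dual_map_hom p (salg_hom A)) w) = w.
    have gK k : g (salg A k) = k := superHom_salg g k.
    apply: superHomP => a; rewrite [RHS]surjective_pairing.
    exact: (congr2 (@pair K K) (gK _) (gK _)).
  have -> : superHom_comp (dual_map_hom p g) (superHom_comp (dual_in_hom p A) idA)
      = superHom_comp (dual_in_hom p (base_alg K)) g.
    by apply: superHomP => a; congr (_, _); rewrite /= rmorph0.
  by rewrite -pt_mulA -pt_natural pt_mulV pt_one_natural pt_mul1r.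
have fst_phi a : (phi a).1 = a := congr1 (fun h : superHom A A => h a) phi1.
exists (fun a => (phi a).2); last first.
  by move=> a; have := congr1 (fun h : superHom A (dual p (base_alg K)) => (h a).2) phi2.
split.
- by move=> x y; rewrite rmorphD.
- by move=> x y; rewrite rmorphM [LHS]/((phi x).1 * (phi y).2 + (phi x).2 * psign p (phi y).1) !fst_phi.
- by move=> k; rewrite superHom_salg.
- by move=> b x hx; have [] := superHom_hpart phi hx.
Qed.

End Derivations.

(** * Closed points as homomorphisms to the base field *)

Section SpecIdeal.
Variables (K : fieldType) (A : superAlgType K) (P : spec A).
Hypothesis K2 : (2%:R : K) != 0.

Lemma evenIdealN (J : evenIdeal A) x : J x -> J (- x).
Proof.
by move=> Jx; rewrite -mulN1r; apply: evenIdealM => //; apply/hpartN/hpart1.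
Qed.

Definition spec_sideal_set (a : A) : Prop := P (hcomp false a).

Fact spec_sideal0 : spec_sideal_set 0.
Proof. by rewrite /spec_sideal_set (hcomp_hom _ (hpart0 false)); apply: evenIdeal0. Qed.
Fact spec_sidealD x y : spec_sideal_set x -> spec_sideal_set y -> spec_sideal_set (x + y).
Proof. by rewrite /spec_sideal_set hcompD; apply: evenIdealD. Qed.
Fact spec_sidealMl a x : spec_sideal_set x -> spec_sideal_set (a * x).
Proof.
rewrite /spec_sideal_set (hcompM a x).1 => hx; apply: evenIdealD.
  by apply: evenIdealM => //; apply: hcomp_hpart.
by apply: oddM_in => //; apply: hcomp_hpart.
Qed.
Fact spec_sidealMr a x : spec_sideal_set x -> spec_sideal_set (x * a).
Proof.
rewrite /spec_sideal_set (hcompM x a).1 => hx; apply: evenIdealD.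
  by rewrite evenC; [apply: evenIdealM|]; rewrite //; apply: hcomp_hpart.
by apply: oddM_in => //; apply: hcomp_hpart.
Qed.
Fact spec_sideal_hpart x0 x1 : even_part x0 -> odd_part x1 ->
  spec_sideal_set (x0 + x1) -> spec_sideal_set x0 /\ spec_sideal_set x1.
Proof.
move=> h0 h1; rewrite /spec_sideal_set hcompD !(hcomp_hom _ h0, hcomp_hom _ h1) addr0.
by split=> //; apply: evenIdeal0.
Qed.

Definition spec_sideal : sideal A :=
  SIdeal spec_sideal0 spec_sidealD spec_sidealMl spec_sidealMr spec_sideal_hpart.

Lemma odd_ideal_spec a : odd_ideal A a -> even_part a -> P a.
Proof.
move=> ha ea; have : spec_sideal a.
  apply: (sideal_gen_sub _ ha) => x hx.
  by rewrite /= /spec_sideal_set (hcomp_hom _ hx); apply: evenIdeal0.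
by rewrite /= /spec_sideal_set (hcomp_hom _ ea).
Qed.

Lemma spec_salg k : P (salg A k) -> k = 0.
Proof.
have [->//|k0 Pk] := eqVneq k 0; case: (spec_prime P) => + _; case.
rewrite -(rmorph1 (salg A)) -(mulVf k0) rmorphM.
by apply: evenIdealM => //; apply: hpart_salg.
Qed.

Lemma closed_point_inv a : closed_point P -> even_part a -> ~ P a ->
  exists2 b, even_part b & P (b * a - 1).
Proof.
move=> [_ Pmax] ea nPa.
pose S x := exists b q, [/\ even_part b, P q & x = b * a + q].
have Se x : S x -> even_part x.
  move=> [b [q [eb Pq ->]]]; apply: hpartD; first exact: hpartMe.
  exact: evenIdeal_even Pq.
have S0 : S 0.
  by exists 0, 0; split; [apply: hpart0|apply: evenIdeal0|rewrite mul0r addr0].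
have SD x y : S x -> S y -> S (x + y).
  move=> [b [q [eb Pq ->]]] [c [t [ec Pt ->]]]; exists (b + c), (q + t).
  by split; [apply: hpartD|apply: evenIdealD|rewrite mulrDl addrACA].
have SM c x : even_part c -> S x -> S (c * x).
  move=> ec [b [q [eb Pq ->]]]; exists (c * b), (c * q).
  by split; [apply: evenM|apply: evenIdealM|rewrite mulrDr mulrA].
have [[b [q [eb Pq e]]]|nS] := pselect (S 1).
  by exists b => //; rewrite e opprD addNKr; apply: evenIdealN.
case: nPa; apply: (Pmax (EvenIdeal Se S0 SD SM)) => //= [x Px|].
  by exists 0, x; split=> //; [apply: hpart0|rewrite mul0r add0r].
by exists 1, 0; split; [apply: hpart1|apply: evenIdeal0|rewrite mul1r addr0].
Qed.

End SpecIdeal.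

Section EvenLift.
Variables (K : fieldType) (A : superAlgType K).

Lemma squot_odd_even (u : squot (odd_ideal A)) :
  exists2 a, even_part a & squot_pi (odd_ideal A) a = u.
Proof.
elim/squot_ind: u => x; exists (hcomp false x); first exact: hcomp_hpart.
apply: squot_pi_eq; rewrite {2}(hcompE x) opprD addNKr; apply: sidealN.
by apply: sub_sideal_gen; apply: hcomp_hpart.
Qed.

End EvenLift.

Section Residue.
Variables (K : closedFieldType) (A : superAlgType K) (P : spec A).
Hypothesis K2 : (2%:R : K) != 0.
Hypothesis uncount : has_infinite_fibre K.
Hypothesis ringA : is_coordinate_ring (squot (odd_ideal A)).
Hypothesis closedP : closed_point P.

(** Every element of the reduced ring comes from a polynomial, and the
    polynomials that vanish at P form a maximal ideal. *)
Lemma closed_point_residue a : even_part a -> exists c, P (a - salg A c).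
Proof.
have [n [s [phi [phiC phi_surj _]]]] := ringA.
pose pi := squot_pi (odd_ideal A).
pose m (q : {mpoly K[n]}) := exists a, P a /\ pi a = phi q.
have mE q b : even_part b -> pi b = phi q -> m q -> P b.
  move=> eb e [c [Pc e']]; rewrite -(subrK c b); apply: evenIdealD => //.
  apply: odd_ideal_spec => //; first by apply/squot_piP; rewrite -/pi e e'.
  by apply: hpartB => //; apply: evenIdeal_even Pc.
have lift q : exists2 b, even_part b & pi b = phi q := squot_odd_even (phi q).
have mD p q : m p -> m q -> m (p + q).
  move=> [b [Pb eb]] [c [Pc ec]]; exists (b + c); split; first exact: evenIdealD.
  by rewrite [phi _]rmorphD /= -eb -ec; apply: squot_piD.
have mM p q : m q -> m (p * q).
  move=> [c [Pc ec]]; have [b eb e] := lift p.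
  exists (b * c); split; first exact: evenIdealM.
  by rewrite [phi _]rmorphM /= -e -ec; apply: squot_piM.
have m1 : ~ m 1.
  move=> /(mE _ 1 (hpart1 _)); rewrite rmorph1 => /(_ erefl).
  by case: (spec_prime P).
have m_prime p q : m (p * q) -> m p \/ m q.
  have [[b eb e] [c ec e']] := (lift p, lift q).
  move=> /(mE _ (b * c) (evenM eb ec)); rewrite rmorphM -e -e' => /(_ (squot_piM _ _ _)).
  case: (spec_prime P) => _ h /(h _ _ eb ec)[Pb|Pc]; first by left; exists b.
  by right; exists c.
have m_inv q : ~ m q -> exists h, m (h * q - 1).
  have [b eb e] := lift q => nm.
  have [c ec Pc] := closed_point_inv closedP eb (fun Pb => nm (ex_intro _ b (conj Pb e))).
  have [h eh] := phi_surj (pi c); exists h, (c * b - 1); split=> //.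
  by rewrite rmorphB rmorphM rmorph1 eh -e /pi -squot_piM -squot_pi1 -squot_piN -squot_piD.
move=> ea; have [q eq] := phi_surj (pi a).
have [c mc] := nullstellensatz uncount mD mM m1 m_prime m_inv q.
exists c; apply: mE mc; first by apply: hpartB => //; apply: hpart_salg.
by rewrite rmorphB /= eq phiC /pi squot_piD squot_piN.
Qed.

(** This turns a closed point into a point of the functor with values in the
    base field, which the group law can invert and translate. *)
Lemma closed_point_hom : exists g : superHom A (base_alg K),
  forall a, even_part a -> (P a <-> g a = 0).
Proof.
have res a : exists c, P (hcomp false a - salg A c).
  by apply: closed_point_residue; apply: hcomp_hpart.
pose g a := sval (cid (res a)).
have gP a : P (hcomp false a - salg A (g a)) by rewrite /g; case: cid.
have gE a c : P (hcomp false a - salg A c) -> g a = c.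
  move=> h; apply/eqP; rewrite -subr_eq0; apply/eqP/(@spec_salg _ _ P).
  have := evenIdealD h (evenIdealN (gP a)).
  by rewrite opprB addrC addrA subrK rmorphB.
have gZ : zmod_morphism g.
  move=> x y; apply: gE.
  have := evenIdealD (gP x) (evenIdealN (gP y)); rewrite hcompB rmorphB => h.
  rewrite opprB [X in P (_ + X)]addrC addrACA [X in P (_ + X)]addrC.
  by rewrite opprB in h.
have gM : monoid_morphism g.
  split=> [|x y].
    by apply: gE; rewrite (hcomp_hom _ (hpart1 A)) /= rmorph1 subrr; apply: evenIdeal0.
  apply: gE; rewrite (hcompM x y).1 rmorphM addrAC.
  apply: evenIdealD; last by apply: oddM_in => //; apply: hcomp_hpart.
  set x0 := hcomp false x; set y0 := hcomp false y.
  have -> : x0 * y0 - salg A (g x) * salg A (g y) =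
      x0 * (y0 - salg A (g y)) + salg A (g y) * (x0 - salg A (g x)).
    by rewrite !mulrBr -!(salgC (g y)) addrA subrK.
  by apply: evenIdealD; (apply: evenIdealM; last exact: gP);
    [apply: hcomp_hpart|apply: hpart_salg].
pose gz := GRing.isZmodMorphism.Build A (base_alg K) g gZ.
pose gm := GRing.isMonoidMorphism.Build A (base_alg K) g gM.
pose gr : {rmorphism A -> base_alg K} := HB.pack g gz gm.
have gs k : gr (salg A k) = salg (base_alg K) k.
  apply: gE; rewrite (hcomp_hom _ (hpart_salg _)) /= subrr; exact: evenIdeal0.
have gh b x : hpart b x -> hpart b (gr x).
  case: b => // hx _; apply: gE; rewrite (hcomp_hom _ hx) /= rmorph0 subr0.
  exact: evenIdeal0.
exists (SuperHom gs gh) => a ea; have ha := gP a; rewrite (hcomp_hom _ ea) /= in ha.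
split=> [Pa|/= e]; last by rewrite e rmorph0 subr0 in ha.
by apply: gE; rewrite (hcomp_hom _ ea) /= rmorph0 subr0.
Qed.

End Residue.

(** * The cotangent space at a point *)

Section HomKernel.
Variables (K : fieldType) (A B : superAlgType K) (f : superHom A B).

Fact hom_ker0 : f 0 = 0. Proof. exact: rmorph0. Qed.
Fact hom_kerD x y : f x = 0 -> f y = 0 -> f (x + y) = 0.
Proof. by rewrite rmorphD => -> ->; rewrite addr0. Qed.
Fact hom_kerMl a x : f x = 0 -> f (a * x) = 0.
Proof. by rewrite rmorphM => ->; rewrite mulr0. Qed.
Fact hom_kerMr a x : f x = 0 -> f (x * a) = 0.
Proof. by rewrite rmorphM => ->; rewrite mul0r. Qed.
Fact hom_ker_hpart x0 x1 : even_part x0 -> odd_part x1 ->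
  f (x0 + x1) = 0 -> f x0 = 0 /\ f x1 = 0.
Proof.
move=> h0 h1; rewrite rmorphD => e; apply: hpart_uniq;
  [exact: superHom_hpart|exact: superHom_hpart|exact: hpart0|exact: hpart0|].
by rewrite e addr0.
Qed.

Definition hom_ker : sideal A :=
  @SIdeal _ _ (fun x => f x = 0) hom_ker0 hom_kerD hom_kerMl hom_kerMr hom_ker_hpart.

End HomKernel.

Section LinearSpan.
Variables (K : fieldType) (A : superAlgType K) (W : sideal A).

Definition lincomb (I : finType) (y : I -> A) (l : I -> K) : A :=
  \sum_i salg A (l i) * y i.

Definition spans_mod (I : finType) (y : I -> A) (a : A) : Prop :=
  exists l, W (a - lincomb y l).

Definition free_mod (I : finType) (y : I -> A) : Prop :=
  forall l, W (lincomb y l) -> forall i, l i = 0.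

Lemma lincombD (I : finType) (y : I -> A) l l' :
  lincomb y (fun i => l i + l' i) = lincomb y l + lincomb y l'.
Proof. by rewrite -big_split; apply: eq_bigr => i _; rewrite rmorphD mulrDl. Qed.

Lemma lincombZ (I : finType) (y : I -> A) k l :
  lincomb y (fun i => k * l i) = salg A k * lincomb y l.
Proof. by rewrite mulr_sumr; apply: eq_bigr => i _; rewrite rmorphM mulrA. Qed.

Lemma lincombN (I : finType) (y : I -> A) l :
  lincomb y (fun i => - l i) = - lincomb y l.
Proof. by rewrite -sumrN; apply: eq_bigr => i _; rewrite rmorphN mulNr. Qed.

Lemma lincomb0 (I : finType) (y : I -> A) : lincomb y (fun=> 0) = 0.
Proof. by apply: big1 => i _; rewrite rmorph0 mul0r. Qed.

Lemma lincomb_delta (I : finType) (y : I -> A) i :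
  lincomb y (fun j => (j == i)%:R) = y i.
Proof.
rewrite /lincomb (bigD1 i) //= eqxx rmorph1 mul1r big1 ?addr0 // => j nj.
by rewrite (negbTE nj) rmorph0 mul0r.
Qed.

Lemma lincomb_in (J : sideal A) (I : finType) (y : I -> A) l :
  (forall i, J (y i)) -> J (lincomb y l).
Proof. by move=> h; apply: sideal_sum => i _; apply: sidealMl. Qed.

Lemma spans_modD (I : finType) (y : I -> A) a b :
  spans_mod y a -> spans_mod y b -> spans_mod y (a + b).
Proof.
move=> [l hl] [l' hl']; exists (fun i => l i + l' i).
by rewrite lincombD opprD addrACA; apply: sidealD.
Qed.

Lemma spans_modZ (I : finType) (y : I -> A) k a :
  spans_mod y a -> spans_mod y (salg A k * a).
Proof.
move=> [l hl]; exists (fun i => k * l i).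
by rewrite lincombZ -mulrBr; apply: sidealMl.
Qed.

Lemma spans_mod_ideal (I : finType) (y : I -> A) a : W a -> spans_mod y a.
Proof. by move=> Wa; exists (fun=> 0); rewrite lincomb0 subr0. Qed.

Lemma spans_mod_mem (I : finType) (y : I -> A) i : spans_mod y (y i).
Proof. by exists (fun j => (j == i)%:R); rewrite lincomb_delta subrr; apply: sideal0. Qed.

Lemma spans_mod_trans (I J : finType) (y : I -> A) (z : J -> A) a :
  (forall i, spans_mod z (y i)) -> spans_mod y a -> spans_mod z a.
Proof.
move=> yz [l hl]; rewrite -(subrK (lincomb y l) a).
apply: spans_modD; first exact: spans_mod_ideal.
rewrite /lincomb; elim/big_ind: _ => [||i _]; [|exact: spans_modD|exact: spans_modZ].
by apply: spans_mod_ideal; apply: sideal0.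
Qed.

(** A family that is not free has a member spanned by the others. *)
Lemma free_subfamily n (x : 'I_n -> A) : exists r (f : 'I_r -> 'I_n),
  free_mod (x \o f) /\ forall i, spans_mod (x \o f) (x i).
Proof.
elim: n x => [|n IH] x; first by exists 0%N, id; split=> [l _|] [].
have [fr|nfr] := pselect (free_mod x).
  by exists n.+1, id; split=> // i; apply: (spans_mod_mem (x \o id)).
have [l [i0 [Wl li0]]] : exists l i0, W (lincomb x l) /\ l i0 != 0.
  apply: contrapT => h; apply: nfr => l Wl i; apply: contrapT => /eqP li.
  by apply: h; exists l, i.
have [r [f [frf spf]]] := IH (x \o lift i0); exists r, (lift i0 \o f); split=> //.
have sp' i : spans_mod (x \o lift i0) (x i).
  case: (unliftP i0 i) => [j ->|->]; first exact: (spans_mod_mem (x \o lift i0)).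
  exists (fun j => - (l i0)^-1 * l (lift i0 j)).
  have -> : x i0 - lincomb (x \o lift i0) (fun j => - (l i0)^-1 * l (lift i0 j))
      = salg A (l i0)^-1 * lincomb x l.
    rewrite lincombZ /lincomb (bigD1_ord i0) //= mulrDr mulrA -rmorphM mulVf //.
    by rewrite rmorph1 mul1r rmorphN mulNr opprK.
  exact: sidealMl.
by move=> i; apply: spans_mod_trans (sp' i) => j; apply: spf.
Qed.

End LinearSpan.

Lemma salg_mulB (K : fieldType) (A : superAlgType K) (a b : A) k l :
  a * b - salg A k * salg A l = (a - salg A k) * (b - salg A l) +
    (salg A k * (b - salg A l) + salg A l * (a - salg A k)).
Proof.
rewrite [in RHS]mulrBl addrA subrK [a * (_ - _)]mulrBr [salg A l * (_ - _)]mulrBr.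
by rewrite (salgC l a) addrA subrK (salgC l).
Qed.

Section CotangentBasis.
Variables (K : fieldType) (A : superAlgType K) (g : superHom A (base_alg K)).
Local Notation M := (hom_ker g).
Local Notation M2 := (sideal_pow M 2).

Lemma odd_in_ker a : odd_part a -> M a.
Proof. by move=> ha; apply: (superHom_hpart g ha). Qed.

Lemma sub_residue_in_ker a : M (a - salg A (g a)).
Proof. by rewrite /= rmorphB superHom_salg subrr. Qed.

Lemma sideal_pow2_sub a : M2 a -> M a.
Proof. by move=> h; apply/sideal_pow1; apply: sideal_pow_sub h. Qed.

Lemma spans_in_ker (I : finType) (y : I -> A) a :
  (forall i, M (y i)) -> spans_mod M2 y a -> M a.
Proof.
move=> hy [l hl]; rewrite -(subrK (lincomb y l) a); apply: sidealD.
  exact: sideal_pow2_sub.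
exact: lincomb_in.
Qed.

(** The elements with even component in M^2 form a homogeneous ideal, since the
    odd components of two factors contribute a product of two elements of M to
    the even component of their product; and this ideal contains all odd
    elements. *)
Lemma even_odd_ideal a : odd_ideal A a -> M2 (hcomp false a).
Proof.
pose S a := M2 (hcomp false a).
have S0 : S 0 by rewrite /S (hcomp_hom _ (hpart0 false)); apply: sideal0.
have SD x y : S x -> S y -> S (x + y) by rewrite /S hcompD; apply: sidealD.
have odd2 x y : M2 (hcomp true x * hcomp true y).
  by apply: sideal_pow2; apply: odd_in_ker; apply: hcomp_hpart.
have Sl x y : S y -> S (x * y).
  rewrite /S (hcompM x y).1 => hy; apply: sidealD => //; exact: sidealMl.
have Sr x y : S y -> S (y * x).
  rewrite /S (hcompM y x).1 => hy; apply: sidealD => //; exact: sidealMr.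
have Sh (x0 x1 : A) : even_part x0 -> odd_part x1 -> S (x0 + x1) -> S x0 /\ S x1.
  move=> h0 h1; rewrite /S hcompD !(hcomp_hom _ h0, hcomp_hom _ h1) addr0.
  by split=> //; apply: sideal0.
apply: (sideal_gen_sub (J := SIdeal S0 SD Sl Sr Sh)) => x hx.
by rewrite /= /S (hcomp_hom _ hx); apply: sideal0.
Qed.

(** The constants plus the span of the t_i - g(t_i) plus M^2 form a subalgebra,
    where the t_i are even lifts of generators of the reduced ring.  By
    [even_odd_ideal] the choice of lifts does not matter modulo M^2, so this
    subalgebra contains every even element. *)
Lemma even_cotangent_finite : is_coordinate_ring (squot (odd_ideal A)) ->
  exists n (x : 'I_n -> A), [/\ forall i, even_part (x i), forall i, M (x i) &
    forall a, even_part a -> M a -> spans_mod M2 x a].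
Proof.
move=> [n [_ [phi [phiC phi_surj _]]]].
have lift q := squot_odd_even (phi q).
pose t i := s2val (cid2 (lift 'X_i)).
have te i : even_part (t i) by rewrite /t; case: cid2.
have tE i : squot_pi _ (t i) = phi 'X_i by rewrite /t; case: cid2.
pose x i := t i - salg A (g (t i)).
have xe i : even_part (x i) by apply: hpartB => //; apply: hpart_salg.
have xM i : M (x i) by apply: sub_residue_in_ker.
pose S a := exists k, spans_mod M2 x (a - salg A k).
have S_M2 a : M2 a -> S a.
  by exists 0; rewrite rmorph0 subr0; apply: spans_mod_ideal.
have SC k : S (salg A k).
  by exists k; rewrite subrr; apply: spans_mod_ideal; apply: sideal0.
have SD a b : S a -> S b -> S (a + b).
  move=> [k hk] [l hl]; exists (k + l).
  by rewrite rmorphD opprD addrACA; apply: spans_modD.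
have SM a b : S a -> S b -> S (a * b).
  move=> [k hk] [l hl]; exists (k * l).
  rewrite rmorphM salg_mulB.
  apply: spans_modD.
    by apply/spans_mod_ideal/sideal_pow2; apply: spans_in_ker.
  by apply: spans_modD; apply: spans_modZ.
pose T q := exists a, [/\ even_part a, squot_pi _ a = phi q & S a].
have TM p q : T p -> T q -> T (p * q).
  move=> [a [ea hp Sa]] [b [eb hq Sb]]; exists (a * b).
  by split; [apply: evenM|rewrite squot_piM hp hq rmorphM|apply: SM].
have TC c : T c%:MP.
  by exists (salg A c); split; [apply: hpart_salg|rewrite phiC|apply: SC].
have TX i : T 'X_i.
  exists (t i); split=> //; exists (g (t i)); exact: spans_mod_mem.
have Tall q : T q.
  elim/mpolyind: q => [|c m p _ _ [b [eb hp Sb]]]; first by rewrite -mpolyC0; apply: TC.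
  have [a [ea hm Sa]] : T (c *: 'X_[m]).
    rewrite -mul_mpolyC mpolyXE_id; apply: (TM) => //.
    elim/big_ind: _ => [||i _]; [by rewrite -mpolyC1|exact: TM|].
    by elim: (m i) => [|k IH]; rewrite ?expr0 -?mpolyC1 ?exprS //; apply: TM.
  exists (a + b); split; [exact: hpartD|by rewrite squot_piD hm hp rmorphD|exact: SD].
exists n, x; split=> // a ea Ma.
have [q hq] := phi_surj (squot_pi _ a); have [b [eb hb Sb]] := Tall q.
have : S a.
  rewrite -(subrK b a); apply: SD => //; apply: S_M2.
  have eab : even_part (a - b) by apply: hpartB.
  rewrite -[a - b](hcomp_hom false eab); apply: even_odd_ideal.
  by apply/squot_piP; rewrite hb hq.
move=> [k hk]; suff k0 : k = 0 by rewrite k0 rmorph0 subr0 in hk.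
have := spans_in_ker xM hk.
have ga : g a = 0 := Ma.
by rewrite /= rmorphB superHom_salg ga sub0r => /eqP; rewrite oppr_eq0 => /eqP.
Qed.

Lemma odd_cotangent_finite : odd_part_finite A ->
  exists n (x : 'I_n -> A), (forall i, odd_part (x i)) /\
    forall a, odd_part a -> spans_mod M2 x a.
Proof.
move=> [n [x [ox hx]]]; exists n, x; split=> // a /hx[c [ec ->]].
exists (fun i => g (c i)); rewrite -sumrB; apply: sideal_sum => i _.
rewrite -mulrBl; apply: sideal_pow2; first exact: sub_residue_in_ker.
exact: odd_in_ker.
Qed.

Definition is_inr (S T : Type) (k : S + T) : bool := if k is inr _ then true else false.

Lemma lincomb_sum (I J : finType) (y : I + J -> A) l :
  lincomb y l = lincomb (y \o inl) (l \o inl) + lincomb (y \o inr) (l \o inr).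
Proof. by rewrite /lincomb big_sumType. Qed.

Lemma lincomb_hpart (I : finType) (y : I -> A) l b :
  (forall i, hpart b (y i)) -> hpart b (lincomb y l).
Proof. by move=> h; apply: hpart_sum => i _; apply: hpartZ. Qed.

Lemma cotangent_basis : affine_supervariety A ->
  exists r s (y : 'I_r + 'I_s -> A),
    [/\ forall k, hpart (is_inr k) (y k), forall k, M (y k),
        free_mod M2 y & forall a, M a -> spans_mod M2 y a].
Proof.
move=> [/even_cotangent_finite[n [x [ex Mx spx]]]
        /odd_cotangent_finite[m [z [oz spz]]]].
have [r [f [frf spf]]] := free_subfamily M2 x.
have [s [h [frh sph]]] := free_subfamily M2 z.
exists r, s, (fun k => match k with inl i => x (f i) | inr j => z (h j) end).
split=> [[i|j]|[i|j]|l|a Ma] //; first exact: odd_in_ker.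
- rewrite lincomb_sum => hl.
  have [hl0 hl1] := sideal_hpart (lincomb_hpart (l \o inl) (fun i => ex (f i)))
    (lincomb_hpart (l \o inr) (fun i => oz (h i))) hl.
  by case=> [i|j]; [apply: (frf _ hl0)|apply: (frh _ hl1)].
have [l0 hl0] := spans_mod_trans spf (spx _ (hcomp_hpart false a) (sideal_comp _ Ma)).
have [l1 hl1] := spans_mod_trans sph (spz _ (hcomp_hpart true a)).
exists (fun k => match k with inl i => l0 i | inr j => l1 j end).
by rewrite lincomb_sum {1}(hcompE a) opprD addrACA; apply: sidealD.
Qed.

End CotangentBasis.

Section Coordinates.
Variables (K : fieldType) (A : superAlgType K) (g : superHom A (base_alg K)).
Local Notation M := (hom_ker g).
Local Notation M2 := (sideal_pow M 2).
Variables (I : finType) (par : pred I) (y : I -> A).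
Hypothesis hy : forall k, hpart (par k) (y k).
Hypothesis fr : free_mod M2 y.
Hypothesis sp : forall a, M a -> spans_mod M2 y a.

Fact coord_exists a : exists l, M2 (a - salg A (g a) - lincomb y l).
Proof. by apply: sp; apply: sub_residue_in_ker. Qed.

Definition coord a : I -> K := sval (cid (coord_exists a)).

Lemma coordP a : M2 (a - salg A (g a) - lincomb y (coord a)).
Proof. by rewrite /coord; case: cid. Qed.

Lemma coord_uniq a l : M2 (a - salg A (g a) - lincomb y l) -> coord a =1 l.
Proof.
move=> h k; apply/eqP; rewrite -subr_eq0; apply/eqP.
apply: (fr (l := fun k => coord a k - l k)); rewrite (lincombD _ _ (fun k => - l k)) lincombN.
have := sidealB h (coordP a); congr (sideal_set _ _).
by rewrite opprB addrC addrA subrK.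
Qed.

(** The product rule holds because a - g a and b - g b have product in M^2. *)
Lemma coord_tangent k : tangent (par k) g (coord ^~ k).
Proof.
split.
- move=> a b; apply: (@coord_uniq _ (fun k => coord a k + coord b k)).
  have := sidealD (coordP a) (coordP b); congr (sideal_set _ _).
  rewrite lincombD !rmorphD !opprD /=.
  by rewrite addrACA; congr (_ + _); rewrite addrACA.
- move=> a b; apply: (@coord_uniq _ (fun k => g a * coord b k + coord a k * g b)).
  have -> : (fun k => g a * coord b k + coord a k * g b) =
      (fun k => (fun k => g a * coord b k) k + (fun k => (g b : K) * coord a k) k).
    by apply: funext => i; congr (_ + _); apply: (@mulrC K).
  rewrite lincombD !lincombZ [g (a * b)]rmorphM rmorphM.
  have -> : a * b - salg A (g a) * salg A (g b) -
      (salg A (g a) * lincomb y (coord b) + salg A (g b) * lincomb y (coord a)) =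
      (a - salg A (g a)) * (b - salg A (g b)) +
      (salg A (g a) * (b - salg A (g b) - lincomb y (coord b)) +
       salg A (g b) * (a - salg A (g a) - lincomb y (coord a))).
    by rewrite salg_mulB -addrA opprD addrACA -!mulrBr.
  apply: sidealD; first by apply: sideal_pow2; apply: sub_residue_in_ker.
  by apply: sidealD; apply: sidealMl; apply: coordP.
- move=> c; apply: (@coord_uniq _ (fun=> 0)).
  by rewrite superHom_salg lincomb0 subrr subr0; apply: sideal0.
- move=> b a ha nb.
  rewrite (@coord_uniq a (fun i => if par i == b then coord a i else 0)) //.
    by rewrite eq_sym (negbTE nb).
  have := sideal_comp b (coordP a); congr (sideal_set _ _).
  rewrite !hcompB (hcomp_hom _ ha) eqxx; congr (_ - _ - _).
    rewrite (hcomp_hom _ (hpart_salg _)); case: b ha {nb} => // ha /=.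
    by have /= -> := odd_in_ker g ha; rewrite rmorph0.
  have hc (F : I -> A) : hcomp b (\sum_i F i) = \sum_i hcomp b (F i).
    apply: (big_morph (hcomp b) (hcompD b)).
    by rewrite (hcomp_hom _ (hpart0 false)) if_same.
  rewrite hc; apply: eq_bigr => i _.
  rewrite (hcomp_hom _ (hpartZ _ (hy i))); case: (_ == _) => //.
  by rewrite rmorph0 mul0r.
Qed.

Lemma coord_basis i k : M (y i) -> coord (y i) k = (k == i)%:R.
Proof.
move=> Myi; have gy : g (y i) = 0 := Myi.
apply: (coord_uniq (l := fun k => (k == i)%:R)); by rewrite lincomb_delta gy rmorph0 subr0 subrr; apply: sideal0.
Qed.

End Coordinates.

(** * Monomials *)

Section Monomials.
Variables (K : fieldType) (A : superAlgType K) (r s : nat).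
Variables (x : 'I_r -> A) (z : 'I_s -> A).
Hypothesis K2 : (2%:R : K) != 0.
Hypothesis ex : forall i, even_part (x i).
Hypothesis oz : forall i, odd_part (z i).
Implicit Types (m : 'X_{1..r}) (S T U : {set 'I_s}).

Definition xmon m : A := \prod_(i < r) x i ^+ m i.
Definition zmon S : A := \prod_(i < s | i \in S) z i.
Definition mono m S : A := xmon m * zmon S.

Lemma evenX (a : A) n : even_part a -> even_part (a ^+ n).
Proof.
by move=> ea; elim: n => [|n IH]; rewrite ?exprS; [apply: hpart1|apply: evenM].
Qed.

Lemma xmon_even m : even_part (xmon m).
Proof.
rewrite /xmon; elim/big_ind: _ => [||i _]; first exact: hpart1.
  by move=> *; apply: evenM.
exact: evenX.
Qed.

Lemma xmon0 : xmon 0%MM = 1.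
Proof. by apply: big1 => i _; rewrite mnm0E. Qed.

Lemma xmonD m m' : xmon (m + m')%MM = xmon m * xmon m'.
Proof.
rewrite /xmon -prodrM_comm => [|i j _ _].
  by apply: eq_bigr => i _; rewrite mnmDE exprD.
by apply: evenC; apply: evenX.
Qed.

Lemma xmon1 i : xmon U_(i)%MM = x i.
Proof.
transitivity (\prod_(j < r | j == i) x j); last by rewrite big_pred1_eq.
rewrite /xmon [RHS]big_mkcond.
by apply: eq_bigr => j _; rewrite mnm1E eq_sym; case: (_ == _).
Qed.

Lemma zmon0 : zmon finset.set0 = 1.
Proof. by rewrite /zmon big_pred0 // => i; rewrite inE. Qed.

(** Inserting z_i at its place among the factors of an increasing product moves
    it past the factors of smaller index, with one sign for each. *)
Fact zmon_seq_mul i S (l : seq 'I_s) :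
  sorted (fun a b : 'I_s => (a < b)%N) l -> i \in l ->
  z i * \prod_(j <- l | j \in S) z j =
  if i \in S then 0
  else (-1) ^+ (\sum_(j <- l | j \in S) (j < i))%N *
       \prod_(j <- l | j \in (i |: S)%SET) z j.
Proof.
have tr : transitive (fun a b : 'I_s => (a < b)%N) by move=> a b c; apply: ltn_trans.
elim: l => [//|j l IH]; rewrite /= path_sortedE // => /andP[/allP jl sl].
rewrite inE !big_cons !inE; have [->|nij] /= := eqVneq i j.
  move=> _; rewrite ?eqxx /=; case: ifP => jS; first by rewrite mulrA odd_sqr // mul0r.
  have -> : (\sum_(k <- l | k \in S) (k < j) = 0)%N.
    by rewrite big_seq_cond big1 // => k /andP[/jl jk _]; rewrite ltnNge (ltnW jk).
  rewrite mul1r; congr (_ * _); rewrite big_seq_cond [RHS]big_seq_cond.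
  apply: eq_bigl => k; rewrite !inE; case kl: (k \in l) => //=.
  by have [kj|//] := eqVneq k j; have := jl _ kl; rewrite kj ltnn.
move=> il.
have ji : (j < i)%N by apply: jl.
have := IH sl il; case: (i \in S) => IHl; case: ifP => jS //.
- by rewrite mulrA (super_comm (oz i) (oz j)) expr1 mulN1r mulNr -mulrA IHl mulr0 oppr0.
- rewrite mulrA (super_comm (oz i) (oz j)) expr1 mulN1r mulNr -mulrA IHl ji exprD expr1.
  by rewrite mulN1r mulNr [z j * (_ * _)]mulrA commr_sign -mulrA.
Qed.

Lemma zmon_mul1 i S : z i * zmon S =
  if i \in S then 0 else (-1) ^+ inversions [set i]%SET S * zmon (i |: S)%SET.
Proof.
rewrite /zmon zmon_seq_mul ?mem_index_enum //; last first.
  have := iota_ltn_sorted 0 s; rewrite -val_enum_ord sorted_map.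
  by rewrite [index_enum _]unlock -enumT.

by rewrite /inversions big_set1.
Qed.

Lemma zmonU1 i S : i \notin S ->
  zmon (i |: S)%SET = (-1) ^+ inversions [set i]%SET S * (z i * zmon S).
Proof.
by move=> iS; rewrite zmon_mul1 (negbTE iS) mulrA -expr2 sqrr_sign mul1r.
Qed.

Lemma zmon_hpart S : hpart (odd #|S|) (zmon S).
Proof.
elim: {S}_.+1 {-2}S (ltnSn #|S|) => // n IH S Sn.
have [->|[i iS]] := finset.set_0Vmem S; first by rewrite zmon0 finset.cards0; apply: hpart1.
rewrite -(finset.setD1K iS) zmonU1 ?finset.setD11 // finset.cardsU1 finset.setD11.
have h : hpart (odd #|(S :\ i)%SET|) (zmon (S :\ i)%SET).
  by apply: IH; rewrite (finset.cardsD1 i S) iS in Sn.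
rewrite -(rmorph_sign (salg A)); apply: hpartZ.
exact: (hpartM (b := true) (oz i) h).
Qed.

(** Removing an element i from S introduces a sign twice, in [zmonU1] and in
    [zmon_mul1], and what does not cancel is the number of inversions between
    i and T. *)
Lemma zmonM S T : zmon S * zmon T =
  if [disjoint S & T]%B then (-1) ^+ inversions S T * zmon (S :|: T)%SET else 0.
Proof.
elim: {S}_.+1 {-2}S (ltnSn #|S|) => // n IH S Sn.
have [->|[i iS]] := finset.set_0Vmem S.
  rewrite zmon0 mul1r finset.set0U /inversions finset.big_set0 mul1r.
  by rewrite -finset.setI_eq0 finset.set0I eqxx.
have S'n : (#|(S :\ i)%SET| < n)%N by rewrite (finset.cardsD1 i S) iS in Sn.
rewrite -(finset.setD1K iS); set S' := (S :\ i)%SET in S'n *.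
have iS' : i \notin S' by rewrite finset.setD11.
have -> : [disjoint (i |: S')%SET & T]%B = (i \notin T) && [disjoint S' & T]%B.
  rewrite -!finset.setI_eq0 finset.setIUl finset.setU_eq0.
  by rewrite finset.setI_eq0 finset.disjoints1.
rewrite zmonU1 // -!mulrA IH //.
case: ifP => dS'T; last by rewrite andbF !mulr0.
rewrite andbT [z i * _]mulrA commr_sign -mulrA zmon_mul1 inE (negbTE iS') /=.
case: ifP => iT /=; first by rewrite !mulr0.
rewrite !mulrA -!exprD finset.setUA; congr (_ * _).
rewrite inversionsUl ?inversionsUr // ?finset.disjoints1 //.
by rewrite -[LHS]signr_odd -[RHS]signr_odd !oddD; do 3!case: (odd _).
Qed.

End Monomials.

(** * Differentiating monomials *)

Section SderPowers.
Variables (K : fieldType) (A : superAlgType K) (M : sideal A).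
Variables (p : bool) (D : A -> A).
Hypothesis hD : sder p D.

Lemma sder0 : D 0 = 0.
Proof. by rewrite -(rmorph0 (salg A)) (sder_salg hD) rmorph0. Qed.

Lemma sderZ k a : D (salg A k * a) = salg A k * D a.
Proof. by rewrite (sderM hD) (sder_salg hD) mul0r addr0. Qed.

Lemma sder_sideal_pow n a : sideal_pow M n.+1 a -> sideal_pow M n (D a).
Proof.
elim: n a => [|n IH] a; first by move=> _; apply: sideal_pow0.
move: a; apply: sideal_powS_ind.
- by rewrite sder0; apply: sideal0.
- by move=> a b ha hb; rewrite (sderD hD); apply: sidealD.
move=> a b Ma hb; rewrite (sderM hD); apply: sidealD.
  by apply: sideal_powM1 => //; apply: IH.
by apply: sidealMl; apply: sideal_psign.
Qed.

End SderPowers.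

Section SderMonomials.
Variables (K : fieldType) (A : superAlgType K) (M : sideal A) (r s : nat).
Variables (x : 'I_r -> A) (z : 'I_s -> A).
Hypothesis K2 : (2%:R : K) != 0.
Hypothesis ex : forall i, even_part (x i).
Hypothesis oz : forall i, odd_part (z i).
Hypothesis Mx : forall i, M (x i).
Hypothesis Mz : forall i, M (z i).
Local Notation "M ^^ n" := (sideal_pow M n) (at level 30).
Implicit Types (m : 'X_{1..r}) (S T U : {set 'I_s}).

Lemma mdeg_ind (P : 'X_{1..r} -> Prop) : P 0%MM ->
  (forall m i, P m -> P (m + U_(i))%MM) -> forall m, P m.
Proof.
move=> P0 PD m; elim: {m}(mdeg m) {-2}m (erefl (mdeg m)) => [|n IH] m dm.
  have : mdeg m == 0%N by rewrite dm.
  by rewrite mdeg_eq0 => /eqP->.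
have [i mi] : exists i, (0 < m i)%N.
  apply/existsP; apply: contra_eqT dm => /existsPn h.
  rewrite mdegE big1 // => i _; by have := h i; case: (m i).
have im : (U_(i) <= m)%MM.
  by apply/mnm_lepP => j; rewrite mnm1E; case: eqP => // <-.
rewrite -(submK im); apply: PD; apply: IH; apply/eqP.
by rewrite -(eqn_add2r 1) -{1}(mdeg1 i) -mdegD submK // dm addn1.
Qed.

Lemma xmon_pow m : (M ^^ mdeg m) (xmon x m).
Proof.
elim/mdeg_ind: m => [|m i IH]; first by rewrite mdeg0; apply: sideal_pow0.
by rewrite mdegD mdeg1 addn1 xmonD // xmon1; apply: sideal_powMr.
Qed.

Lemma zmon_pow S : (M ^^ #|S|) (zmon z S).
Proof.
rewrite -sum1_card /zmon; elim: (index_enum _) => [|i l IH].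
  by rewrite !big_nil; apply: sideal_pow0.
by rewrite !big_cons; case: ifP => // _; apply: sideal_powM1.
Qed.

Lemma mono_pow m S : (M ^^ (mdeg m + #|S|)) (mono x z m S).
Proof. by apply: sideal_powM; [apply: xmon_pow|apply: zmon_pow]. Qed.

Section Derivation.
Variables (p : bool) (D : A -> A).
Hypothesis hD : sder p D.

(** The scalar [c] is 1 for the partial derivative along x_i, and 0 for an odd
    derivation, which maps all the x_j into the maximal ideal. *)
Lemma sder_xmon i c : (forall j, M (D (x j) - salg A (c *+ (j == i)))) ->
  forall m, (M ^^ mdeg m) (D (xmon x m) - salg A (c *+ m i) * xmon x (m - U_(i))%MM).
Proof.
move=> hx; elim/mdeg_ind => [|m j IH]; first by rewrite mdeg0; apply: sideal_pow0.
have -> : D (xmon x (m + U_(j))%MM) -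
    salg A (c *+ (m + U_(j))%MM i) * xmon x (m + U_(j) - U_(i))%MM =
    xmon x m * (D (x j) - salg A (c *+ (j == i))) +
    (D (xmon x m) - salg A (c *+ m i) * xmon x (m - U_(i))%MM) * x j.
  rewrite xmonD // xmon1 (sderM hD) (psign_hom p (ex j)) andbF mul1r.
  rewrite mulrBr mulrBl addrACA -opprD; congr (_ - _).
  rewrite mnmDE mnm1E mulrnDr rmorphD mulrDl [RHS]addrC; congr (_ + _).
    rewrite -mulrA -(xmon1 x j) -xmonD //.
    have [mi|mi] := posnP (m i); first by rewrite mi rmorph0 !mul0r.
    congr (_ * xmon x _); apply/mnmP => k; rewrite !(mnmBE, mnmDE, mnm1E).
    by rewrite addnBAC //; case: eqP => // <-.
  rewrite -salgC; have [->|_] := eqVneq j i; last by rewrite rmorph0 !mul0r.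
  by rewrite addmK.
rewrite mdegD mdeg1 addn1; apply: sidealD; last exact: sideal_powMr.
by apply: sideal_powMr => //; apply: xmon_pow.
Qed.

Lemma sder_zmon S : (forall j, j \in S -> M (D (z j))) -> (M ^^ #|S|) (D (zmon z S)).
Proof.
move=> hz; suff : (M ^^ #|S|) (D (zmon z S)) /\ (M ^^ #|S|) (zmon z S) by case.
rewrite -sum1_card /zmon; elim: (index_enum _) => [|i l [IH1 IH2]].
  by rewrite !big_nil; split; apply: sideal_pow0.
rewrite !big_cons; case: ifP => // iS; split; last exact: sideal_powM1.
rewrite (sderM hD); apply: sidealD; first exact: sideal_powM1.
by apply: sideal_powM1; [apply: hz|apply: sideal_psign].
Qed.

End Derivation.

(** One part of the sign comes from moving z_i to the front of the monomial, the
    other from the odd derivation passing over the remaining factors. *)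
Definition contraction_sign i S : K :=
  (-1) ^+ (inversions [set i]%SET (S :\ i)%SET + odd #|(S :\ i)%SET|).

Lemma contraction_sign_neq0 i S : contraction_sign i S != 0.
Proof. by rewrite /contraction_sign signr_eq0. Qed.

Lemma sder_zmon_contract D i S : sder true D ->
  (forall j, M (D (z j) - salg A (j == i)%:R)) -> i \in S ->
  (M ^^ #|S|) (D (zmon z S) - salg A (contraction_sign i S) * zmon z (S :\ i)%SET).
Proof.
move=> hD hz iS; set S' := (S :\ i)%SET; have iS' : i \notin S' by rewrite finset.setD11.
have cS : #|S| = #|S'|.+1 by rewrite (finset.cardsD1 i S) iS.
have hS' := zmon_hpart K2 oz S'.
rewrite -{2}(finset.setD1K iS) -/S' zmonU1 // -(rmorph_sign (salg A)) (sderZ hD) (sderM hD).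
rewrite /contraction_sign -/S' exprD rmorphM -mulrA -mulrBr; apply: sidealMl.
rewrite (psign_hom true hS') /= rmorph_sign -addrA cS; apply: (@sidealD _ _ (M ^^ #|S'|.+1)).
  apply: sideal_powM1 => //; apply: (sder_zmon hD) => j jS'; have := hz j.
  have nji : j != i by apply: contraNneq iS' => <-.
  by rewrite (negbTE nji) rmorph0 subr0.
have := hz i; rewrite eqxx rmorph1 => hzi.
set w := _ ^+ _ * zmon z S'; rewrite -[X in _ - X]mul1r -mulrBl.
by apply: sideal_powM1 => //; apply: sidealMl; apply: zmon_pow.
Qed.

End SderMonomials.

(** * Linear independence of monomials modulo powers of the maximal ideal *)

Section DualFunctionals.
Variables (K : fieldType) (A : superAlgType K) (g : superHom A (base_alg K)).
Variables (r s : nat) (x : 'I_r -> A) (z : 'I_s -> A).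
Variables (Dx : 'I_r -> A -> A) (Dz : 'I_s -> A -> A).
Local Notation M := (hom_ker g).
Local Notation "M ^^ n" := (sideal_pow M n) (at level 30).
Hypothesis char0 : forall n, (n.+1%:R : K) != 0.
Hypothesis ex : forall i, even_part (x i).
Hypothesis oz : forall i, odd_part (z i).
Hypothesis Mx : forall i, M (x i).
Hypothesis hDx : forall i, sder false (Dx i).
Hypothesis hDz : forall i, sder true (Dz i).
Hypothesis Dxx : forall i j, g (Dx i (x j)) = (j == i)%:R.
Hypothesis Dxz : forall i j, g (Dx i (z j)) = 0.
Hypothesis Dzx : forall i j, g (Dz i (x j)) = 0.
Hypothesis Dzz : forall i j, g (Dz i (z j)) = (j == i)%:R.
Implicit Types (m : 'X_{1..r}) (S T U : {set 'I_s}).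

Local Notation mono := (mono x z).
Local Notation deg m S := (mdeg m + #|S : {set _}|)%N.

Let K2 : (2%:R : K) != 0 := char0 1.
Let Mz i : M (z i) := odd_in_ker g (oz i).

Lemma ker_sub_salg a k : g a = k -> M (a - salg A k).
Proof. by move=> e; rewrite /= rmorphB superHom_salg e subrr. Qed.

Lemma Dx_mono i m S :
  (M ^^ deg m S) (Dx i (mono m S) - salg A (m i)%:R * mono (m - U_(i))%MM S).
Proof.
have hx j : M (Dx i (x j) - salg A (1 *+ (j == i))) by apply: ker_sub_salg.
have := sder_xmon (m := m) ex Mx (hDx i) hx.
have hz : (M ^^ #|S|) (Dx i (zmon z S)).
  by apply: (sder_zmon Mz (hDx i)) => j _; apply: Dxz.
rewrite /mono (sderM (hDx i)) psign0 => h; rewrite -addrA mulrA -mulrBl.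
apply: sidealD; apply: sideal_powM => //; [exact: xmon_pow|exact: zmon_pow].
Qed.

Lemma Dz_mono i m S : (M ^^ deg m S) (Dz i (mono m S) -
  (if i \in S then salg A (contraction_sign K i S) * mono m (S :\ i)%SET else 0)).
Proof.
have hx : (M ^^ mdeg m) (Dz i (xmon x m)).
  have [i0 _|r0] := pickP 'I_r; last first.
    rewrite (_ : m = 0%MM); first by rewrite mdeg0; apply: sideal_pow0.
    by apply/mnmP => j; have := r0 j.
  have h0 j : M (Dz i (x j) - salg A (0 *+ (j == i0))).
    by rewrite mul0rn rmorph0 subr0; apply: Dzx.
  have := sder_xmon (m := m) ex Mx (hDz i) h0.
  by rewrite mul0rn rmorph0 mul0r subr0.
rewrite /mono (sderM (hDz i)) addrAC; apply: sidealD; last first.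
  by apply: sideal_powM => //; apply: sideal_psign; apply: zmon_pow.
have [iS|iS] := ifPn.
  rewrite -salgCA -mulrBr; apply: sideal_powM; first exact: xmon_pow.
  apply: sder_zmon_contract => // j; exact: ker_sub_salg.
rewrite subr0; apply: sideal_powM; first exact: xmon_pow.
apply: (sder_zmon Mz (hDz i)) => j jS; rewrite /= Dzz.
by case: eqP jS iS => // -> ->.
Qed.

(** Divided powers of the derivations give, in each degree n, functionals that
    kill M^(n+1) and are dual to the monomials of degree n; characteristic zero
    makes the multiplicities that appear invertible. *)
Record dual_functional n m S (L : A -> K) : Prop := DualFunctional {
  dfD : forall a b, L (a + b) = L a + L b;
  dfZ : forall k a, L (salg A k * a) = k * L a;
  df_pow : forall a, (M ^^ n.+1) a -> L a = 0;
  df_mono : forall m' S', deg m' S' = n ->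
    L (mono m' S') = ((m' == m) && (S' == S))%:R }.

Lemma dual_functionalB n m S L a b : dual_functional n m S L ->
  (M ^^ n.+1) (a - b) -> L a = L b.
Proof. by move=> hL h; rewrite -(subrK b a) (dfD hL) (df_pow hL h) add0r. Qed.

Lemma dual_functional0 n m S L : dual_functional n m S L -> L 0 = 0.
Proof. by move=> hL; rewrite -(mulr0 (salg A 0)) (dfZ hL) mul0r. Qed.

Lemma dual_functional_exists m S : exists L, dual_functional (deg m S) m S L.
Proof.
suff ind n : forall m S, deg m S = n -> exists L, dual_functional n m S L.
  exact: ind.
elim: n {m S} => [|n IH] m S dmS.
  have deg0 m' S' : deg m' S' = 0%N -> m' = 0%MM /\ S' = finset.set0.
    move/eqP; rewrite addn_eq0 mdeg_eq0 finset.cards_eq0.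
    by case/andP=> /eqP-> /eqP->.
  exists g; split.
  - by move=> a b; apply: (rmorphD g).
  - by move=> k a; rewrite [LHS](rmorphM g) superHom_salg.
  - by move=> a h; apply: (proj1 (sideal_pow1 M a) h).
  move=> m' S' /deg0[-> ->]; have [-> ->] := deg0 _ _ dmS.
  by rewrite /mono xmon0 zmon0 mulr1 rmorph1 !eqxx.
have [/existsP[i mi]|/existsPn m0] := boolP [exists i, (0 < m i)%N].
  have le1 m' : (0 < m' i)%N -> (U_(i) <= m')%MM.
    by move=> h; apply/mnm_lepP => j; rewrite mnm1E; case: eqP => // <-.
  have dsub m' S' : (0 < m' i)%N -> deg m' S' = n.+1 -> deg (m' - U_(i))%MM S' = n.
    move=> m'i; rewrite -{1}(submK (le1 m' m'i)) mdegD mdeg1 addn1 addSn.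
    by case.
  have [L hL] := IH _ S (dsub m S mi dmS).
  have mi0 : ((m i)%:R : K) != 0 by case: (m i) mi.
  exists (fun a => (m i)%:R^-1 * L (Dx i a)); split.
  - by move=> a b; rewrite (sderD (hDx i)) (dfD hL) mulrDr.
  - by move=> k a; rewrite (sderZ (hDx i)) (dfZ hL) mulrCA.
  - by move=> a ha; rewrite (df_pow hL) ?mulr0 //; apply: (sder_sideal_pow (hDx i)).
  move=> m' S' d'; have h : (M ^^ deg m' S') _ := Dx_mono i (m := m') (S := S'); rewrite d' in h.
  rewrite (dual_functionalB hL h) (dfZ hL).
  have [m'i|m'i] := posnP (m' i).
    rewrite m'i mul0r mulr0; case: eqP => [e|//].
    by rewrite -e m'i in mi.
  rewrite (df_mono hL (dsub m' S' m'i d')).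
  have -> : ((m' - U_(i))%MM == (m - U_(i))%MM) = (m' == m).
    apply/eqP/eqP => [e|->//].
    by rewrite -(submK (le1 _ m'i)) -(submK (le1 _ mi)) e.
  by case: eqP => [->|_]; rewrite /= ?mulr0 // mulrA mulVf // mul1r.
have {}m0 : m = 0%MM.
  by apply/mnmP => i; rewrite mnm0E; have := m0 i; case: (m i).
have [S0|[i iS]] := finset.set_0Vmem S.
  by rewrite m0 S0 mdeg0 finset.cards0 in dmS.
have dsub m' S' : i \in S' -> deg m' S' = n.+1 -> deg m' (S' :\ i)%SET = n.
  by move=> iS'; rewrite (finset.cardsD1 i S') iS' add1n addnS; case.
have [L hL] := IH m _ (dsub m S iS dmS).
have e0 := contraction_sign_neq0 K i S.
exists (fun a => (contraction_sign K i S)^-1 * L (Dz i a)); split.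
- by move=> a b; rewrite (sderD (hDz i)) (dfD hL) mulrDr.
- by move=> k a; rewrite (sderZ (hDz i)) (dfZ hL) mulrCA.
- by move=> a ha; rewrite (df_pow hL) ?mulr0 //; apply: (sder_sideal_pow (hDz i)).
move=> m' S' d'; have h : (M ^^ deg m' S') _ := Dz_mono i (m := m') (S := S'); rewrite d' in h.
rewrite (dual_functionalB hL h); have [iS'|iS'] := boolP (i \in S'); last first.
  rewrite (dual_functional0 hL) mulr0.
  have [e|//] := eqVneq S' S; first by rewrite -e (negbTE iS') in iS.
  by rewrite andbF.
rewrite (dfZ hL) (df_mono hL (dsub m' S' iS' d')).
have -> : ((S' :\ i)%SET == (S :\ i)%SET) = (S' == S).
  apply/eqP/eqP => [e|->//].
  by rewrite -(finset.setD1K iS') -(finset.setD1K iS) e.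
by have [->|_] := eqVneq S' S; rewrite ?andbF ?mulr0 // mulrA mulVf // mul1r.
Qed.

(** The bound restricts only the degree in the even variables: the other terms
    with total degree at least n lie in M^n and do no harm. *)
Definition tsum (c : 'X_{1..r} -> {set 'I_s} -> K) (n : nat) : A :=
  \sum_(m : 'X_{1..r < n}) \sum_S salg A (c m S) * mono m S.

(** By induction on the degree of the monomial: the functional dual to it sees
    neither the terms of higher degree nor, their coefficients being already
    known to vanish, those of lower degree. *)
Lemma tsum_free n c : (M ^^ n) (tsum c n) ->
  forall m S, (deg m S < n)%N -> c m S = 0.
Proof.
move=> hn m S; elim: {m S}_.+1 {-2}m {-2}S (ltnSn (deg m S)) => // d IH m S.
rewrite ltnS => dd dn; have [L hL] := dual_functional_exists m S.
have L0 : L (tsum c n) = 0 by apply: (df_pow hL); apply: sideal_pow_sub hn.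
have Lsum (I : finType) (F : I -> A) : L (\sum_i F i) = \sum_i L (F i).
  exact: (big_morph L (dfD hL) (dual_functional0 hL)).
have term m' S' : (m', S') != (m, S) -> c m' S' * L (mono m' S') = 0.
  move=> ne; have [lt|gt|eq] := ltngtP (deg m' S') (deg m S).
  - rewrite (IH m' S') ?mul0r //; first exact: leq_trans lt dd.
    exact: ltn_trans lt dn.
  - rewrite (df_pow hL) ?mulr0 //; apply: sideal_pow_sub gt _ _.
    exact: mono_pow.
  - rewrite (df_mono hL eq); move: ne; rewrite xpair_eqE => /negbTE->.
    by rewrite mulr0.
have mn : (mdeg m < n)%N by apply: leq_ltn_trans dn; apply: leq_addr.
rewrite -{}L0 Lsum (bigD1 (BMultinom mn)) //= Lsum (bigD1 S) //=.
rewrite (dfZ hL) (df_mono hL erefl) !eqxx mulr1 !big1 ?addr0 // => [m' nm|S' nS].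
  rewrite Lsum big1 // => S' _; rewrite (dfZ hL) term // xpair_eqE.
  suff -> : (bmnm m' == m) = false by [].
  by apply: contraNF nm => /eqP e; apply/eqP/val_inj.
by rewrite (dfZ hL) term // xpair_eqE (negbTE nS) andbF.
Qed.

End DualFunctionals.

(** * Monomials span modulo powers of the ideal *)

Section Spanning.
Variables (K : fieldType) (B : superAlgType K) (N : sideal B) (r s : nat).
Variables (x : 'I_r -> B) (z : 'I_s -> B).
Local Notation "N ^^ n" := (sideal_pow N n) (at level 30).
Hypothesis K2 : (2%:R : K) != 0.
Hypothesis ex : forall i, even_part (x i).
Hypothesis oz : forall i, odd_part (z i).
Hypothesis Nx : forall i, N (x i).
Hypothesis Nz : forall i, N (z i).
Implicit Types (m : 'X_{1..r}) (S T U : {set 'I_s}) (c : 'X_{1..r} -> {set 'I_s} -> K).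

Local Notation mono := (mono x z).
Local Notation tsum := (tsum x z).
Local Notation deg m S := (mdeg m + #|S : {set _}|)%N.

Lemma tsumD c c' n : tsum (fun m S => c m S + c' m S) n = tsum c n + tsum c' n.
Proof.
rewrite /tsum -big_split; apply: eq_bigr => m _; rewrite -big_split.
by apply: eq_bigr => S _; rewrite rmorphD mulrDl.
Qed.

Lemma tsumN c n : tsum (fun m S => - c m S) n = - tsum c n.
Proof.
rewrite /tsum -sumrN; apply: eq_bigr => m _; rewrite -sumrN.
by apply: eq_bigr => S _; rewrite rmorphN mulNr.
Qed.

Lemma tsum_delta k m S n : (mdeg m < n)%N ->
  tsum (fun m' S' => if (m' == m) && (S' == S) then k else 0) n = salg B k * mono m S.
Proof.
move=> mn; rewrite /tsum (bigD1 (BMultinom mn)) //= (bigD1 S) //= !eqxx /=.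
rewrite !big1 ?addr0 // => [m' nm|S' nS].
  rewrite big1 // => S' _; case: eqP => [e|_]; last by rewrite rmorph0 mul0r.
  by case/eqP: nm; apply: val_inj.
by rewrite (negbTE nS) rmorph0 mul0r.
Qed.

Definition tspan n (b : B) : Prop := exists c, (N ^^ n) (b - tsum c n).

Lemma tspanD n a b : tspan n a -> tspan n b -> tspan n (a + b).
Proof.
move=> [c hc] [d hd]; exists (fun m S => c m S + d m S).
by rewrite tsumD opprD addrACA; apply: sidealD.
Qed.

Lemma tspan_pow n b : (N ^^ n) b -> tspan n b.
Proof.
move=> hb; exists (fun _ _ => 0); rewrite /tsum big1 ?subr0 // => m _.
by apply: big1 => S _; rewrite rmorph0 mul0r.
Qed.

Lemma tspan_mono n k m S : tspan n (salg B k * mono m S).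
Proof.
have [mn|nm] := ltnP (mdeg m) n.
  exists (fun m' S' => if (m' == m) && (S' == S) then k else 0).
  by rewrite tsum_delta // subrr; apply: sideal0.
apply: tspan_pow; apply: sidealMl; apply: (@sideal_pow_sub _ _ N n (deg m S)).
  exact: leq_trans nm (leq_addr _ _).
exact: mono_pow.
Qed.

(** Keeping the degree homogeneous is what makes the induction of [pow_hspan]
    work: an error term in N^2 times a monomial of degree n is in N^(n+2). *)
Inductive hspan (n : nat) : B -> Prop :=
| hspan_pow w : (N ^^ n.+1) w -> hspan n w
| hspan_add u v : hspan n u -> hspan n v -> hspan n (u + v)
| hspan_mono k m S : deg m S = n -> hspan n (salg B k * mono m S).

Lemma hspan_tspan n b : hspan n b -> tspan n.+1 b.
Proof.
elim=> [w|u v _ hu _ hv|k m S _]; [exact: tspan_pow|exact: tspanD|exact: tspan_mono].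
Qed.

Lemma hspan_sum n (I : finType) (F : I -> B) :
  (forall i, hspan n (F i)) -> hspan n (\sum_i F i).
Proof.
move=> h; elim/big_ind: _ => [||i _]; [|exact: hspan_add|exact: h].
by apply: hspan_pow; apply: sideal0.
Qed.

Lemma mul_x_mono i m S : x i * mono m S = mono (m + U_(i))%MM S.
Proof. by rewrite /mono xmonD // xmon1 mulrA (evenC _ (ex i)). Qed.

Lemma mul_z_mono i m S : z i * mono m S = if i \in S then 0 else
  salg B ((-1) ^+ inversions [set i]%SET S) * mono m (i |: S)%SET.
Proof.
rewrite /mono mulrA -(evenC _ (xmon_even ex m)) -mulrA zmon_mul1 //.
by case: ifP; rewrite ?mulr0 // -(rmorph_sign (salg B)) salgCA.
Qed.

Hypothesis residueN : forall b, exists k, N (b - salg B k).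
Hypothesis cotangentN : forall b, N b ->
  exists l l', (N ^^ 2) (b - (lincomb x l + lincomb z l')).

Lemma hspan_mul n a b : N a -> hspan n b -> hspan n.+1 (a * b).
Proof.
move=> Na; elim=> {b} [w hw|u v _ hu _ hv|k m S dn].
- by apply: hspan_pow; apply: sideal_powM1.
- by rewrite mulrDr; apply: hspan_add.
have [l [l' hw]] := cotangentN Na; set L := lincomb x l + lincomb z l' in hw.
rewrite -(subrK L a) mulrDl; apply: hspan_add.
  have hm : (N ^^ n) (salg B k * mono m S).
    by apply: sidealMl; rewrite -dn; apply: mono_pow.
  exact: hspan_pow (sideal_powM hw hm).
rewrite mulrDl; apply: hspan_add.
  rewrite /lincomb mulr_suml; apply: hspan_sum => i.
  rewrite -mulrA salgCA mul_x_mono mulrA -rmorphM; apply: hspan_mono.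
  by rewrite mdegD mdeg1 addn1 addSn dn.
rewrite /lincomb mulr_suml; apply: hspan_sum => i.
rewrite -mulrA salgCA mul_z_mono; case: ifPn => iS.
  by rewrite !mulr0; apply: hspan_pow; apply: sideal0.
rewrite [salg B k * (_ * _)]mulrA -rmorphM [salg B _ * (_ * _)]mulrA -rmorphM.
apply: hspan_mono.
by rewrite finset.cardsU1 iS add1n addnS dn.
Qed.

Lemma pow_hspan n b : (N ^^ n) b -> hspan n b.
Proof.
elim: n b => [|n IH] b.
  have [k hk] := residueN b; rewrite -(subrK (salg B k) b) => _.
  apply: hspan_add; first by apply: hspan_pow; apply/sideal_pow1.
  have := @hspan_mono 0 k 0%MM finset.set0.
  by rewrite /mono xmon0 zmon0 !mulr1 mdeg0 finset.cards0; apply.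
move: b; apply: sideal_powS_ind.
- by apply: hspan_pow; apply: sideal0.
- exact: hspan_add.
- by move=> a b Na hb; apply: hspan_mul => //; apply: IH.
Qed.

Lemma tspan_all n b : tspan n b.
Proof.
elim: n => [|n [c hc]]; first by apply: tspan_pow; apply: sideal_pow0.
rewrite -(subrK (tsum c n) b); apply: tspanD.
  by apply: hspan_tspan; apply: pow_hspan.
have t0 : tspan n.+1 0 by apply: tspan_pow; apply: sideal0.
rewrite /tsum; elim/big_ind: _ => [//|a a'|m _]; first exact: tspanD.
elim/big_ind: _ => [//|a a'|S _]; first exact: tspanD.
exact: tspan_mono.
Qed.

End Spanning.

(** * From the ring to its stalk *)

Section MonomialMap.
Variables (K : fieldType) (A B : superAlgType K) (f : {rmorphism A -> B}).
Hypothesis fZ : forall k, f (salg A k) = salg B k.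
Variables (r s : nat) (x : 'I_r -> A) (z : 'I_s -> A).

Lemma map_mono m S : f (mono x z m S) = mono (f \o x) (f \o z) m S.
Proof.
rewrite /mono rmorphM !rmorph_prod; congr (_ * _).
by apply: eq_bigr => i _; rewrite rmorphXn.
Qed.

Lemma map_tsum c n : f (tsum x z c n) = tsum (f \o x) (f \o z) c n.
Proof.
rewrite /tsum rmorph_sum; apply: eq_bigr => m _.
by rewrite rmorph_sum; apply: eq_bigr => S _; rewrite rmorphM fZ map_mono.
Qed.

Lemma map_lincomb (I : finType) (y : I -> A) l :
  f (lincomb y l) = lincomb (f \o y) l.
Proof. by rewrite /lincomb rmorph_sum; apply: eq_bigr => i _; rewrite rmorphM fZ. Qed.

Lemma map_sideal_pow (M : sideal A) (N : sideal B) : (forall a, M a -> N (f a)) ->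
  forall n a, sideal_pow M n a -> sideal_pow N n (f a).
Proof.
move=> MN; elim=> [|n IH] a; first by move=> _; apply: sideal_pow0.
move: a; apply: sideal_powS_ind.
- by rewrite rmorph0; apply: sideal0.
- by move=> a b ha hb; rewrite rmorphD; apply: sidealD.
- by move=> a b Ma hb; rewrite rmorphM; apply: sideal_powM1; [apply: MN|apply: IH].
Qed.

End MonomialMap.

Section StalkPowers.
Variables (K : fieldType) (A : superAlgType K) (P : spec A).
Variable g : superHom A (base_alg K).
Hypothesis K2 : (2%:R : K) != 0.
Hypothesis Pg : forall a, even_part a -> (P a <-> g a = 0).
Local Notation M := (hom_ker g).
Local Notation N := (stalk_max_sideal P K2).

Lemma outside_neq0 a : outside P a -> (g a : K) != 0.
Proof. by move=> [ea nPa]; apply/eqP => ga; apply: nPa; apply/Pg. Qed.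

Lemma stalk_max_locP a t (ht : outside P t) : N (loc a ht) <-> M a.
Proof.
split=> [[b0 [b1 [u [hu [Pb0 ob1 /loc_eqP[w hw e]]]]]]|Ma].
  have := congr1 g e; rewrite !rmorphM rmorphD.
  have -> : g b0 = 0 by apply/Pg => //; apply: evenIdeal_even Pb0.
  have -> : g b1 = 0 by apply: odd_in_ker.
  rewrite addr0 !mulr0 => /eqP.
  rewrite !(mulf_eq0 (R := K)) (negbTE (outside_neq0 hw)) (negbTE (outside_neq0 hu)).
  by move/eqP.
exists (hcomp false a), (hcomp true a), t, ht; split; last by rewrite -hcompE.
  by apply/Pg; [apply: hcomp_hpart|apply: (sideal_comp false Ma)].
exact: hcomp_hpart.
Qed.

(** w is a nonzero constant plus an element of M, hence invertible modulo M^n: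
    if a is in M^j with j < n, then so is g(w) a modulo M^(j+1). *)
Lemma sideal_pow_unit n w a : (g w : K) != 0 -> sideal_pow M n (w * a) -> sideal_pow M n a.
Proof.
move=> w0 hwa; suff h j : (j <= n)%N -> sideal_pow M j a by apply: h.
elim: j => [|j IH] jn; first exact: sideal_pow0.
have -> : a = salg A (g w)^-1 * (w * a - (w - salg A (g w)) * a).
  rewrite mulrBl opprB addrC subrK mulrA -rmorphM.
  by rewrite (mulVf (F := K)) // rmorph1 mul1r.
apply: sidealMl; apply: sidealB; first exact: sideal_pow_sub jn _ hwa.
by apply: sideal_powM1; [apply: sub_residue_in_ker|apply: IH; apply: ltnW].
Qed.

Lemma stalk_powP n v : sideal_pow N n v ->
  exists a t (ht : outside P t), sideal_pow M n a /\ v = loc a ht.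
Proof.
elim: n v => [|n IH] v.
  move=> _; elim/loc_ind: v => a t ht; exists a, t, ht; split=> //.
  exact: sideal_pow0.
move: v; apply: sideal_powS_ind.
- by exists 0, 1, (outside1 P); split; [apply: sideal0|rewrite loc0].
- move=> _ _ [a [t [ht [ha ->]]]] [b [u [hu [hb ->]]]].
  exists (u * a + t * b), (t * u), (outsideM ht hu).
  by split; [apply: sidealD; apply: sidealMl|apply: stalk_addE].
- elim/loc_ind=> a t ht v /stalk_max_locP Ma /IH[b [u [hu [hb ->]]]].
  exists (a * b), (t * u), (outsideM ht hu).
  by split; [apply: sideal_powM1|rewrite locM].
Qed.

Lemma stalk_in_powP n a : sideal_pow N n (stalk_in P a) -> sideal_pow M n a.
Proof.
move=> /stalk_powP[b [t [ht [hb /loc_eqP[u hu e]]]]].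
apply: (@sideal_pow_unit n (u * t)); first exact: outside_neq0 (outsideM hu ht).
by rewrite -mulrA e mul1r; apply: sidealMl.
Qed.

Lemma stalk_in_pow n a : sideal_pow M n a -> sideal_pow N n (stalk_in P a).
Proof. by apply: map_sideal_pow => b Mb; apply/stalk_max_locP. Qed.

Lemma locE a t (ht : outside P t) : loc a ht = loc 1 ht * stalk_in P a.
Proof. by rewrite locM; apply: loc_eq; rewrite ?mul1r ?mulr1. Qed.

Lemma sub_loc_stalk_in a t (ht : outside P t) b :
  loc a ht - stalk_in P b = loc (a - t * b) ht.
Proof.
rewrite -locD -locN; congr (_ - _).
rewrite /stalk_in (loc_scale b (outside1 P) ht (outsideM ht (outside1 P))).
by apply: loc_eq; rewrite ?mulr1.
Qed.

Lemma stalk_residue v : exists k, N (v - salg (stalk P) k).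
Proof.
elim/loc_ind: v => a t ht; exists ((g a : K) / g t).
rewrite [salg _ _]/(stalk_in P _) sub_loc_stalk_in; apply/stalk_max_locP.
have e : g t * g (salg A ((g a : K) / g t)) = g a.
  by rewrite superHom_salg [LHS](mulrC (g t : K)) [LHS](divfK (outside_neq0 ht)).
by rewrite /= rmorphB [g (t * _)]rmorphM e subrr.
Qed.

Lemma stalk_cotangent (I : finType) (y : I -> A) :
  (forall a, M a -> spans_mod (sideal_pow M 2) y a) ->
  forall v, N v -> exists l, sideal_pow N 2 (v - lincomb (stalk_in P \o y) l).
Proof.
move=> sp; elim/loc_ind=> a t ht /stalk_max_locP Ma.
have t0 := outside_neq0 ht; pose b := salg A (g t)^-1 * a.
have [l hl] := sp b (sidealMl _ Ma); exists l.
rewrite -(subrK (stalk_in P b) (loc a ht)) -addrA; apply: sidealD.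
  rewrite sub_loc_stalk_in locE; apply: sidealMl; apply: stalk_in_pow.
  have -> : a - t * b = - (salg A (g t)^-1 * ((t - salg A (g t)) * a)).
    rewrite /b mulrBl mulrBr [salg A _ * (salg A _ * _)]mulrA -rmorphM.
    by rewrite (mulVf (F := K)) // rmorph1 mul1r opprB salgCA.
  apply: sidealN; apply: sidealMl; apply: sideal_pow2 => //.
  exact: sub_residue_in_ker.
rewrite -(map_lincomb (f := stalk_in P : {rmorphism A -> stalk P})) //.
by rewrite -rmorphB; apply: stalk_in_pow.
Qed.

End StalkPowers.

(** * Evaluating power series in a completion *)

Section SeriesEvaluation.
Variables (K : fieldType) (B : superAlgType K) (N : sideal B) (r s : nat).
Variables (x : 'I_r -> B) (z : 'I_s -> B).
Local Notation "N ^^ n" := (sideal_pow N n) (at level 30).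
Hypothesis K2 : (2%:R : K) != 0.
Hypothesis ex : forall i, even_part (x i).
Hypothesis oz : forall i, odd_part (z i).
Hypothesis Nx : forall i, N (x i).
Hypothesis Nz : forall i, N (z i).
Implicit Types (m : 'X_{1..r}) (S T U : {set 'I_s}) (p q : pseries K r).
Implicit Types (c : 'X_{1..r} -> {set 'I_s} -> K) (f h : superseries K r s).

Local Notation mono := (mono x z).
Local Notation tsum := (tsum x z).
Local Notation deg m S := (mdeg m + #|S : {set _}|)%N.

Lemma sum_bmultinom_widen n d (F : 'X_{1..r} -> B) : (n <= d)%N ->
  \sum_(m : 'X_{1..r < d} | (mdeg m < n)%N) F m = \sum_(m : 'X_{1..r < n}) F m.
Proof.
case: n => [_|n nd]; first by rewrite !big1 // => -[].
pose w (m : 'X_{1..r < n.+1}) := BMultinom (leq_trans (bmdeg m) nd).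
(* The default value is never reached: only indices of degree below the
   smaller bound are mapped back. *)
pose w' (m : 'X_{1..r < d}) : 'X_{1..r < n.+1} := insubd bm0 (bmnm m).
rewrite (reindex_onto w w') => [|m mn]; last by apply: val_inj; rewrite /= insubdK.
apply: eq_bigl => m; rewrite /= bmdeg /=.
by apply/eqP/val_inj; rewrite insubdK //; exact: (bmdeg m).
Qed.

Lemma tsum_cut c n d : (n <= d)%N -> (N ^^ n) (tsum c d - tsum c n).
Proof.
move=> nd; rewrite /tsum.
rewrite -(sum_bmultinom_widen (fun m => \sum_S salg B (c m S) * mono m S) nd).
rewrite (bigID (fun m : 'X_{1..r < d} => mdeg m < n)%N) /= [X in X - _]addrC addrK.
apply: (@sideal_sum _ _ (N ^^ n)) => m; rewrite -leqNgt => nm; apply: sideal_sum => S _.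
apply: sideal_pow_sub nm _ _; apply: sidealMl; apply: sideal_pow_sub (leq_addr #|S| _) _ _.
exact: mono_pow.
Qed.

Lemma tsum_eq c c' n : (forall m S, (deg m S < n)%N -> c m S = c' m S) ->
  (N ^^ n) (tsum c n - tsum c' n).
Proof.
move=> h; rewrite /tsum -sumrB; apply: sideal_sum => m _; rewrite -sumrB.
apply: sideal_sum => S _; rewrite -mulrBl -rmorphB.
have [lt|ge] := ltnP (deg m S) n; first by rewrite h // subrr rmorph0 mul0r; apply: sideal0.
by apply: sidealMl; apply: sideal_pow_sub ge _ _; apply: mono_pow.
Qed.

Definition pev n p : B := \sum_(m : 'X_{1..r < n}) salg B (p m) * xmon x m.

Lemma pevD n p q : pev n (p + q) = pev n p + pev n q.
Proof.
by rewrite /pev -big_split; apply: eq_bigr => m _; rewrite pseriesDE rmorphD mulrDl.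
Qed.

Lemma pevN n p : pev n (- p) = - pev n p.
Proof. by rewrite /pev -sumrN; apply: eq_bigr => m _; rewrite pseriesNE rmorphN mulNr. Qed.

Lemma pev0 n : pev n 0 = 0.
Proof.
by rewrite /pev big1 // => m _; rewrite pseries0E rmorph0 mul0r.
Qed.

Lemma pev_sum n (I : finType) (Q : pred I) (F : I -> pseries K r) :
  pev n (\sum_(i | Q i) F i) = \sum_(i | Q i) pev n (F i).
Proof. exact: (big_morph _ (pevD n) (pev0 n)). Qed.

Lemma pev_even n p : even_part (pev n p).
Proof. by apply: hpart_sum => m _; apply: hpartZ; apply: xmon_even. Qed.

(** Both sides are sums over pairs of monomials; they differ by the pairs whose
    product has degree at least n. *)
Lemma pevM n p q : (N ^^ n) (pev n (p * q) - pev n p * pev n q).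
Proof.
have -> : pev n (p * q) = \sum_(k : 'X_{1..r < n, n}) \sum_(m : 'X_{1..r < n} |
    bmnm m == (k.1 + k.2)%MM) salg B (p k.1 * q k.2) * xmon x m.
  rewrite [RHS](exchange_big_dep xpredT) //=; apply: eq_bigr => m _.
  rewrite -[(p * q) m]/(pseries_mul p q m) (pseries_mulE _ _ (bmdeg m)).
  rewrite [(_ * _)@_m](mcoeff_poly_mul _ _ (bmdeg m)) rmorph_sum mulr_suml.
  by apply: eq_bigr => k _; rewrite !pseries_truncE ?bmdeg.
have -> : pev n p * pev n q = \sum_(k : 'X_{1..r < n, n})
    salg B (p k.1 * q k.2) * xmon x (k.1 + k.2)%MM.
  rewrite /pev mulr_suml; under eq_bigr do rewrite mulr_sumr.
  rewrite pair_big /=; apply: eq_bigr => k _.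
  by rewrite xmonD // rmorphM -!mulrA; congr (_ * _); rewrite !mulrA salgC.
rewrite -sumrB; apply: sideal_sum => k _.
have [lt|ge] := ltnP (mdeg (k.1 + k.2)%MM) n.
  rewrite (big_pred1 (BMultinom lt)) => [|m]; last by rewrite /= -val_eqE.
  by rewrite subrr; apply: sideal0.
rewrite big1 => [|m /eqP e].
  rewrite sub0r; apply: sidealN; apply: sidealMl; apply: sideal_pow_sub ge _ _.
  exact: xmon_pow.
by have := bmdeg m; rewrite e ltnNge ge.
Qed.

Definition coefs f m S : K := f S m.

Lemma tsum_pev f n : tsum (coefs f) n = \sum_S pev n (f S) * zmon z S.
Proof.
rewrite /tsum exchange_big /=; apply: eq_bigr => S _.
by rewrite /pev mulr_suml; apply: eq_bigr => m _; rewrite /mono mulrA.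
Qed.

Lemma pev_xi n S T p : pev n (xi_coef K S T * p) * zmon z (S :|: T)%SET =
  pev n p * (zmon z S * zmon z T).
Proof.
rewrite zmonM // /xi_coef; case: ifP => _; last by rewrite mul0r pev0 mul0r mulr0.
rewrite -signr_odd -[in RHS]signr_odd.
by case: (odd _); rewrite ?expr1 ?mulN1r ?mul1r ?pevN ?mulrN ?mulNr.
Qed.

Lemma tsumM f h n : (N ^^ n) (tsum (coefs (f * h)) n - tsum (coefs f) n * tsum (coefs h) n).
Proof.
have -> : tsum (coefs (f * h)) n = \sum_(P : {set 'I_s} * {set 'I_s})
    pev n (f P.1 * h P.2) * (zmon z P.1 * zmon z P.2).
  rewrite tsum_pev (partition_big (fun P => P.1 :|: P.2)%SET xpredT) //=.
  apply: eq_bigr => U _; rewrite ffunE pev_sum mulr_suml.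
  by apply: eq_bigr => P /eqP <-; rewrite pev_xi.
have -> : tsum (coefs f) n * tsum (coefs h) n = \sum_(P : {set 'I_s} * {set 'I_s})
    pev n (f P.1) * pev n (h P.2) * (zmon z P.1 * zmon z P.2).
  rewrite !tsum_pev mulr_suml; under eq_bigr do rewrite mulr_sumr.
  rewrite pair_big /=; apply: eq_bigr => P _; rewrite -!mulrA; congr (_ * _).
  by rewrite evenCA //; apply: pev_even.
rewrite -sumrB; apply: sideal_sum => P _; rewrite -mulrBl.
by apply: sidealMr; apply: pevM.
Qed.

Fact series_eval_coh f n k : (n <= k)%N ->
  squot_map (N ^^ n) (squot_pi (N ^^ k) (tsum (coefs f) k)) =
  squot_pi (N ^^ n) (tsum (coefs f) n).
Proof.
move=> nk; rewrite squot_mapE; last exact: sideal_pow_sub.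
by apply: squot_pi_eq; apply: tsum_cut.
Qed.

Definition series_eval f : completion N := Completion (series_eval_coh f).

Fact series_eval_zmod : zmod_morphism series_eval.
Proof.
move=> f h; apply: completionP => n /=; rewrite -squot_piN -squot_piD; congr squot_pi.
rewrite -tsumN -tsumD; apply: eq_bigr => m _; apply: eq_bigr => S _.
by rewrite /coefs !ffunE.
Qed.

Lemma tsum_const k n : (N ^^ n) (tsum (coefs (salg (superseries K r s) k)) n - salg B k).
Proof.
case: n => [|n]; first exact: sideal_pow0.
have := @tsum_delta _ _ _ _ x z k 0%MM finset.set0 n.+1.
rewrite mdeg0 /mono xmon0 zmon0 !mulr1 => /(_ isT) <-.
apply: tsum_eq => m S _; rewrite /coefs [salg _ k]/(superseries_const _ _) ffunE.
by rewrite andbC; case: (S == _); rewrite /= ?pseries0E.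
Qed.

Fact series_eval_monoid : monoid_morphism series_eval.
Proof.
split; last first.
  move=> f h; apply: completionP => n /=; rewrite -squot_piM.
  by apply: squot_pi_eq; apply: tsumM.
apply: completionP => n /=; apply: squot_pi_eq.
have := @tsum_const 1 n; rewrite !rmorph1; exact.
Qed.

HB.instance Definition _ :=
  GRing.isZmodMorphism.Build (superseries K r s) (completion N) series_eval series_eval_zmod.
HB.instance Definition _ := GRing.isMonoidMorphism.Build
  (superseries K r s) (completion N) series_eval series_eval_monoid.

Lemma tsum_hpart b f n : hpart b f -> hpart b (tsum (coefs f) n).
Proof.
move=> hf; rewrite tsum_pev; apply: hpart_sum => S _.
have [->|/hf <-] := eqVneq (f S) 0; first by rewrite pev0 mul0r; apply: hpart0.
by apply: hpartMe; [apply: pev_even|apply: zmon_hpart].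
Qed.

Definition series_eval_hom : superHom (superseries K r s) (completion N).
Proof.
exists (series_eval : {rmorphism superseries K r s -> completion N}).
- by move=> k; apply: completionP => n /=; apply: squot_pi_eq; apply: tsum_const.
- by move=> b f hf n; exists (tsum (coefs f) n) => //; apply: tsum_hpart.
Defined.

Hypothesis free : forall n c, (N ^^ n) (tsum c n) ->
  forall m S, (deg m S < n)%N -> c m S = 0.
Hypothesis span : forall n b, exists c, (N ^^ n) (b - tsum c n).

Lemma series_eval_inj : injective series_eval.
Proof.
move=> f h e; apply/eqP; rewrite -subr_eq0; apply/eqP/ffunP => S; rewrite [RHS]ffunE.
apply: funext => m; transitivity (0 : K); last by rewrite pseries0E.
have E0 : series_eval (f - h) = 0 by rewrite series_eval_zmod e subrr.
pose n := (deg m S).+1; apply: (free (n := n) (c := coefs (f - h))) => //.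
by have := congr1 (fun u => cproj u n) E0; move/squot_pi_eq0.
Qed.

(** Truncated expansions of a coherent sequence are unique below the truncation
    degree, so that they agree and define a power series. *)
Lemma series_eval_surj u : exists f, series_eval f = u.
Proof.
have ex_c n : exists c, squot_pi (N ^^ n) (tsum c n) = cproj u n.
  have [c hc] := span n (repr (cproj u n)); exists c.
  by rewrite -[RHS]squot_reprK; apply/esym/squot_pi_eq.
pose c n := sval (cid (ex_c n)).
have cP n : squot_pi (N ^^ n) (tsum (c n) n) = cproj u n by rewrite /c; case: cid.
have coh n k m S : (n <= k)%N -> (deg m S < n)%N -> c k m S = c n m S.
  move=> nk lt; apply/eqP; rewrite -subr_eq0; apply/eqP.
  apply: (free (n := n) (c := fun m S => c k m S - c n m S)) => //.
  rewrite (tsumD _ _ (c k) (fun m S => - c n m S)) tsumN.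
  rewrite -(subrK (tsum (c k) k) (tsum (c k) n)) -addrA; apply: sidealD.
    by rewrite -opprB; apply: sidealN; apply: tsum_cut.
  apply/squot_piP; rewrite cP -(cprojP u nk) -cP squot_mapE //.
  exact: sideal_pow_sub.
pose f : superseries K r s := [ffun S => (fun m => c (deg m S).+1 m S) : pseries K r].
exists f; apply: completionP => n /=; rewrite -cP; apply: squot_pi_eq.
by apply: tsum_eq => m S lt; rewrite /coefs ffunE (coh _ _ _ _ lt).
Qed.

End SeriesEvaluation.

Lemma inj_surj_bij (T T' : Type) (f : T -> T') :
  injective f -> (forall y, exists x, f x = y) -> bijective f.
Proof.
move=> finj fsurj; pose h y := sval (cid (fsurj y)).
have hK : cancel h f by move=> y; rewrite /h; case: cid.
by exists h => // y; apply: finj; rewrite hK.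
Qed.

Section IsoSym.
Variables (K : fieldType) (A B : superAlgType K).

(** The inverse preserves parity because an isomorphism commutes with taking
    homogeneous components. *)
Lemma superIso_sym : superIso A B -> superIso B A.
Proof.
move=> [f [h fK hK]].
have finj : injective f := can_inj fK.
have hZ : zmod_morphism h by move=> a b; apply: finj; rewrite rmorphB !hK.
have hM : monoid_morphism h.
  by split=> [|a b]; apply: finj; rewrite ?rmorph1 ?rmorphM !hK.
pose hz := GRing.isZmodMorphism.Build B A h hZ.
pose hm := GRing.isMonoidMorphism.Build B A h hM.
pose hr : {rmorphism B -> A} := HB.pack h hz hm.
have hs k : hr (salg B k) = salg A k by apply: finj; rewrite superHom_salg [LHS]hK.
have hh b y : hpart b y -> hpart b (hr y).
  move=> hy; have e c : f (hcomp c (h y)) = hcomp c y.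
    have [e0 e1] : hcomp false y = f (hcomp false (h y)) /\
        hcomp true y = f (hcomp true (h y)).
      apply: hcomp_uniq; try by apply: superHom_hpart; apply: hcomp_hpart.
      by rewrite -rmorphD -hcompE hK.
    by case: c.
  have -> : hr y = hcomp b (h y) by apply: finj; rewrite e [LHS]hK (hcomp_hom _ hy) eqxx.
  exact: hcomp_hpart.
by exists (SuperHom hs hh), f.
Qed.

End IsoSym.

(** * Smoothness *)

Section SmoothPoints.
Variables (K : closedFieldType) (A : superAlgType K).
Hypothesis uncount : has_infinite_fibre K.
Hypothesis char0 : forall n, (n.+1%:R : K) != 0.
Hypothesis varA : affine_supervariety A.
Hypothesis G : group_functor A.

Let K2 : (2%:R : K) != 0 := char0 1.

Lemma closed_point_smooth (P : spec A) : closed_point P -> smooth_point P.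
Proof.
move=> closedP.
have [g Pg] := closed_point_hom K2 uncount varA.1 closedP.
have [r [s [y [hy My fr sp]]]] := cotangent_basis g varA.
have der k : exists D, sder (is_inr k) D /\ forall l, g (D (y l)) = (k == l)%:R.
  have [D hD gD] := sder_of_tangent G (coord_tangent hy fr sp k).
  by exists D; split=> // l; rewrite gD coord_basis.
pose D k := sval (cid (der k)).
have hD k : sder (is_inr k) (D k) by rewrite /D; case: cid => ? [].
have Dy k l : g (D k (y l)) = (l == k)%:R.
  by rewrite /D; case: cid => ? [_ ->]; rewrite eq_sym.
pose x := y \o inl; pose z := y \o inr.
have ex i : even_part (x i) := hy (inl i).
have oz i : odd_part (z i) := hy (inr i).
have free n c := @tsum_free _ _ g r s x z (D \o inl) (D \o inr) char0 ex oz
  (fun i => My (inl i)) (fun i => hD (inl i)) (fun i => hD (inr i))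
  (fun i j => Dy (inl i) (inl j)) (fun i j => Dy (inl i) (inr j))
  (fun i j => Dy (inr i) (inl j)) (fun i j => Dy (inr i) (inr j)) n c.
pose x' := stalk_in P \o x; pose z' := stalk_in P \o z.
have ex' i : even_part (x' i) by exists (x i), 1, (outside1 P).
have oz' i : odd_part (z' i) by exists (z i), 1, (outside1 P).
pose N := stalk_max_sideal P K2.
have Nx i : N (x' i) by apply/(stalk_max_locP _ Pg); apply: (My (inl i)).
have Nz i : N (z' i) by apply/(stalk_max_locP _ Pg); apply: (My (inr i)).
have cot v : N v -> exists l l',
    sideal_pow N 2 (v - (lincomb x' l + lincomb z' l')).
  move=> /(stalk_cotangent Pg sp)[l hl]; exists (l \o inl), (l \o inr).
  by rewrite lincomb_sum in hl.
have span n b := tspan_all K2 ex' oz' Nx Nz (stalk_residue K2 Pg) cot n b.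
have free' n c : sideal_pow N n (tsum x' z' c n) ->
    forall m S, (mdeg m + #|S : {set _}| < n)%N -> c m S = 0.
  move=> h; apply: (free n c); apply: (stalk_in_powP (K2 := K2) Pg).
  by rewrite (map_tsum (f := stalk_in P : {rmorphism A -> stalk P})).
exists r, s; apply: superIso_sym.
exists (series_eval_hom K2 ex' oz' Nx Nz); apply: inj_surj_bij.
  exact: (series_eval_inj free').
exact: (series_eval_surj ex' Nx Nz free' span).
Qed.

End SmoothPoints.

Theorem corollary4p3 (R : realType) (G : affineSupergroup R[i]) : smooth G.
Proof.
move=> P; apply: closed_point_smooth.
- exact: complex_has_infinite_fibre.
- by move=> n; rewrite pnatr_eq0.
- exact: coord_algP.
- exact: coord_group.
Qed.
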